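(* For every integer $n\ge1$, $N(n)\ge 2n+2$ unless $n=1$, $3$, or $7$.
   Context: A pair of lines in $\mathbf{R}^N$ is skew if they are not parallel and do not intersect (in particular, two equal lines are not skew). A submanifold $M^n\subset\mathbf{R}^N$ (with $C^1$ regularity) is totally skew if every pair of (affine) tangent lines of $M$ is skew, unless they are tangent to $M$ at the same point. A ($C^1$) embedding is totally skew if its image is a totally skew submanifold. $N(n)$ denotes the smallest $N$ such that $\mathbf{R}^n$ admits a totally skew embedding in $\mathbf{R}^N$. *)

(* Defs.v *)
From HB Require Import structures.
From mathcomp Require Import all_boot all_order all_algebra.
From mathcomp Require Import all_classical all_reals all_analysis.

Set Implicit Arguments.
Unset Strict Implicit.
Unset Printing Implicit Defensive.

Import Order.TTheory GRing.Theory Num.Theory.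
Import numFieldNormedType.Exports.

Local Open Scope classical_set_scope.
Local Open Scope ring_scope.

Definition line_through (R : realType) (N : nat) (p v : 'rV[R]_N) :
    set 'rV[R]_N :=
  [set p + t *: v | t in [set: R]].

(* A line is parallel to itself. *)
Definition parallel_lines (R : realType) (N : nat) (l l' : set 'rV[R]_N) :
    Prop :=
  exists p p' v : 'rV[R]_N,
    [/\ v != 0, l = line_through p v & l' = line_through p' v].

Definition skew_lines (R : realType) (N : nat) (l l' : set 'rV[R]_N) : Prop :=
  ~ parallel_lines l l' /\ l `&` l' = set0.

(* For a C^1 submanifold M, the velocities at p of the curves in M through p
   form exactly the tangent space of M at p. *)
Definition tangent_vector (R : realType) (N : nat) (M : set 'rV[R]_N)
    (p v : 'rV[R]_N) : Prop :=
  exists g : R -> 'rV[R]_N,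
    [/\ g 0 = p, \forall t \near 0, M (g t) & is_derive (0 : R) 1 g v].

Definition tangent_line (R : realType) (N : nat) (M : set 'rV[R]_N)
    (p : 'rV[R]_N) (l : set 'rV[R]_N) : Prop :=
  M p /\ exists v, [/\ v != 0, tangent_vector M p v & l = line_through p v].

(* The quantification is over points of tangency: a line tangent to M at two
   distinct points is not skew to itself and so is excluded. *)
Definition totally_skew (R : realType) (N : nat) (M : set 'rV[R]_N) : Prop :=
  forall (p q : 'rV[R]_N) (l l' : set 'rV[R]_N),
    p <> q -> tangent_line M p l -> tangent_line M q l' -> skew_lines l l'.

Definition C1_map (R : realType) (n N : nat) (f : 'rV[R]_n -> 'rV[R]_N) :
    Prop :=
  (forall x, differentiable f x) /\
  (forall v, continuous (fun x => 'd f x v)).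

(* The third clause says that the topology of the domain is the one induced by
   f, so that f is a homeomorphism onto its image. *)
Definition C1_embedding (R : realType) (n N : nat)
    (f : 'rV[R]_n -> 'rV[R]_N) : Prop :=
  [/\ C1_map f,
      injective f,
      forall U : set 'rV[R]_n, open U ->
        exists2 V : set 'rV[R]_N, open V & U = f @^-1` V &
      forall x, injective ('d f x)].

Definition totally_skew_embedding (R : realType) (n N : nat)
    (f : 'rV[R]_n -> 'rV[R]_N) : Prop :=
  C1_embedding f /\ totally_skew (range f).

Definition has_totally_skew_embedding (R : realType) (n N : nat) : Prop :=
  exists f : 'rV[R]_n -> 'rV[R]_N, totally_skew_embedding f.

(* N(n), the least element of a nonempty set (x |-> all monomials of degree 1,
   2, 3 in the coordinates of x is a totally skew embedding).  The default
   value 0 of xget would falsify any positive lower bound. *)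
Definition min_skew_dim (R : realType) (n : nat) : nat :=
  xget 0%N [set N : nat | has_totally_skew_embedding R n N /\
    forall N' : nat, has_totally_skew_embedding R n N' -> (N <= N')%N].

(* Main.v *)
(* For x <> y the skewness of the tangent lines makes the tangent spaces at x and
   y and the vector f x - f y linearly independent, so N >= 2n+1.  If N = 2n+1,
   the square matrix M(u) with rows df_u e_i + df_(-u) e_i, df_u e_i - df_(-u) e_i
   and f u - f(-u) is continuous in u, invertible for u <> 0, and u |-> -u fixes
   its first n rows and negates the other n+1.  For n even det M changes sign
   along a path from -e to e avoiding 0, so it vanishes somewhere.  For n = 2m+1,
   M trivializes n+1 copies of the tautological line bundle over RP^n modulo
   trivial bundles; as the reduced K-group of RP^(2m+1) is cyclic of order 2^m,
   this forces 2^m | 2m+2, that is, m = 0, 1 or 3.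

   The K-theoretic step is made finite as follows.  Approximate M by polynomials
   of the same parity and substitute for the first 2m coordinates the real and
   imaginary parts of weighted shifts A_1, ..., A_m on functions of
   n in {0, ..., q-1}^m, the weights vanishing at both ends; the last coordinate
   is a parameter tau.  As q grows the A_l almost commute and
   their joint symbol is z_l = nu_l (1 - nu_l) e^(i theta_l).  Let phi be the
   self-adjoint matrix with off-diagonal blocks M and M^*, gamma its grading, and
   mu = 1/2 - sum_l nu_l a mass that does not vanish where all z_l do.  Tensor
   with the exterior algebra F of C^m, graded by gamma', and let c be the Koszul
   operator of the A_l.  Then L0 = phi + mu gamma gamma' and
   L1 = gamma c + mu gamma gamma' are joined by a segment of invertible
   operators, since phi, gamma c and gamma gamma' have anticommuting symbols.
   All of them commute with the involution Pi of u |-> -u, so Pi L0 and Pi L1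
   have the same number of negative eigenvalues.  For Pi L0 this number is 2^m p,
   where p is that of phi + mu gamma twisted by the parity alone, and p is even
   because the determinant of the latter is positive (let tau grow to 1 while the mass
   decreases to 0).  For Pi L1 it is computed from a trace, and if k rows of the
   K x K matrix M are odd the outcome is 2^m p + 2 k = K (2q)^m; with q even,
   2^m divides k. *)

Require Import Defs.
From HB Require Import structures.
From mathcomp Require Import all_classical all_reals all_analysis.
From mathcomp Require Import all_boot all_order all_algebra all_solvable all_field.
From mathcomp.real_closed Require complex.
From mathcomp Require Import ring lra zify.

Set Implicit Arguments.
Unset Strict Implicit.
Unset Printing Implicit Defensive.
Import Order.TTheory GRing.Theory Num.Theory.
Import numFieldNormedType.Exports.
Local Open Scope ring_scope.

(** * Inertia of Hermitian kernels *)

Section Kernels.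
Variable C : numClosedFieldType.

(** The topology is carried by one integer, the number of negative eigenvalues of a Hermitian
    matrix, which is constant along a segment of matrices with a uniform gap at 0. Gaps are checked
    on symbols: an isometry turns the operators into multiplications up to a small squared error, so
    pointwise lower bounds survive. The constant 1/2 in the mass is there because all z_l vanish
    exactly where every nu_l is 0 or 1, and 1/2 minus an integer is never 0. The twist by Pi is
    essential: L1 alone consists of equally many copies of an operator and of its opposite, so its
    count would say nothing about the odd rows. The evenness of p supplies the last factor 2;
    without it only 2^(m-1) would be known to divide k, and n = 5 would not be excluded. All
    tolerances are fixed by the polynomials before q is chosen, so there is no circularity. Finally,
    since N(n) is a minimum, some totally skew embedding has to be exhibited. *)

Definition kapp (S T : finType) (k : S -> T -> C) (v : T -> C) : S -> C :=
  fun s => \sum_t k s t * v t.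
Definition sqn (T : finType) (v : T -> C) : C := \sum_t `|v t| ^+ 2.
Definition hip (T : finType) (u v : T -> C) : C := \sum_t (u t)^* * v t.
Definition kadj (S T : finType) (k : S -> T -> C) : T -> S -> C :=
  fun t s => (k s t)^*.
Definition kmul (S T U : finType) (k : S -> T -> C) (l : T -> U -> C) :
  S -> U -> C := fun s u => \sum_t k s t * l t u.
Definition herm (T : finType) (k : T -> T -> C) : Prop :=
  forall s t, k t s = (k s t)^*.
Definition hform (T : finType) (k : T -> T -> C) (v : T -> C) : C :=
  hip v (kapp k v).

Lemma kapp_ext (S T : finType) (k l : S -> T -> C) (v w : T -> C) :
  (forall s t, k s t = l s t) -> (forall t, v t = w t) ->
  forall s, kapp k v s = kapp l w s.
Proof. by move=> kl vw s; apply: eq_bigr => t _; rewrite kl vw. Qed.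

Lemma kapp_mul (S T U : finType) (k : S -> T -> C) (l : T -> U -> C) v s :
  kapp (kmul k l) v s = kapp k (kapp l v) s.
Proof.
rewrite /kapp /kmul; under eq_bigr do rewrite mulr_suml.
rewrite exchange_big /=; apply: eq_bigr => t _.
by rewrite mulr_sumr; apply: eq_bigr => u _; rewrite mulrA.
Qed.

Lemma kappD (S T : finType) (k : S -> T -> C) v w s :
  kapp k (fun t => v t + w t) s = kapp k v s + kapp k w s.
Proof. by rewrite /kapp -big_split /=; apply: eq_bigr => t _; rewrite mulrDr. Qed.

Lemma kappZ (S T : finType) (k : S -> T -> C) a v s :
  kapp k (fun t => a * v t) s = a * kapp k v s.
Proof. by rewrite /kapp mulr_sumr; apply: eq_bigr => t _; rewrite mulrCA. Qed.

Lemma kappN (S T : finType) (k : S -> T -> C) v s :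
  kapp k (fun t => - v t) s = - kapp k v s.
Proof. by rewrite /kapp -sumrN; apply: eq_bigr => t _; rewrite mulrN. Qed.

Lemma kappDl (S T : finType) (k l : S -> T -> C) v s :
  kapp (fun s t => k s t + l s t) v s = kapp k v s + kapp l v s.
Proof. by rewrite /kapp -big_split /=; apply: eq_bigr => t _; rewrite mulrDl. Qed.

Lemma kappZl (S T : finType) a (k : S -> T -> C) v s :
  kapp (fun s t => a * k s t) v s = a * kapp k v s.
Proof. by rewrite /kapp mulr_sumr; apply: eq_bigr => t _; rewrite mulrA. Qed.

Lemma kappNl (S T : finType) (k : S -> T -> C) v s :
  kapp (fun s t => - k s t) v s = - kapp k v s.
Proof. by rewrite /kapp -sumrN; apply: eq_bigr => t _; rewrite mulNr. Qed.

Lemma hip_kadj (S T : finType) (k : S -> T -> C) u v :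
  hip u (kapp k v) = hip (kapp (kadj k) u) v.
Proof.
rewrite /hip /kapp /kadj; under eq_bigr do rewrite mulr_sumr.
rewrite exchange_big /=; apply: eq_bigr => t _.
rewrite rmorph_sum mulr_suml; apply: eq_bigr => s _.
by rewrite rmorphM /= conjCK mulrCA mulrA.
Qed.

Lemma herm_hip (T : finType) (k : T -> T -> C) u v :
  herm k -> hip u (kapp k v) = hip (kapp k u) v.
Proof.
move=> hk; rewrite hip_kadj; apply: eq_bigr => t _; congr (_^* * _).
by apply: kapp_ext => // s t'; rewrite /kadj -hk.
Qed.

Lemma sqnE (T : finType) (v : T -> C) : sqn v = hip v v.
Proof. by apply: eq_bigr => t _; rewrite normCK mulrC. Qed.

Lemma sqn_ge0 (T : finType) (v : T -> C) : 0 <= sqn v.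
Proof. by apply: sumr_ge0 => t _; rewrite exprn_ge0. Qed.

Lemma sqn_eq0 (T : finType) (v : T -> C) : sqn v = 0 -> forall t, v t = 0.
Proof.
move=> /eqP; rewrite psumr_eq0; last by move=> t _; rewrite exprn_ge0.
by move=> /allP h t; have := h t (mem_index_enum _);
  rewrite implyTb expf_eq0 /= normr_eq0 => /eqP.
Qed.

Lemma sqn_gt0 (T : finType) (v : T -> C) t : v t != 0 -> 0 < sqn v.
Proof.
move=> vt; rewrite lt_def sqn_ge0 andbT.
by apply: contra_neq vt => /sqn_eq0.
Qed.

Lemma sqn_ext (T : finType) (v w : T -> C) :
  (forall t, v t = w t) -> sqn v = sqn w.
Proof. by move=> h; apply: eq_bigr => t _; rewrite h. Qed.

Lemma sqnZ (T : finType) a (v : T -> C) :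
  sqn (fun t => a * v t) = `|a| ^+ 2 * sqn v.
Proof. by rewrite /sqn mulr_sumr; apply: eq_bigr => t _; rewrite normrM exprMn. Qed.

Lemma hipDl (T : finType) (u v w : T -> C) :
  hip (fun t => u t + v t) w = hip u w + hip v w.
Proof. by rewrite /hip -big_split; apply: eq_bigr => t _; rewrite rmorphD mulrDl. Qed.
Lemma hipDr (T : finType) (u v w : T -> C) :
  hip w (fun t => u t + v t) = hip w u + hip w v.
Proof. by rewrite /hip -big_split; apply: eq_bigr => t _; rewrite mulrDr. Qed.
Lemma hipZl (T : finType) a (v w : T -> C) :
  hip (fun t => a * v t) w = a^* * hip v w.
Proof. by rewrite /hip mulr_sumr; apply: eq_bigr => t _; rewrite rmorphM mulrA. Qed.
Lemma hipZr (T : finType) a (v w : T -> C) :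
  hip w (fun t => a * v t) = a * hip w v.
Proof. by rewrite /hip mulr_sumr; apply: eq_bigr => t _; rewrite mulrCA. Qed.

Lemma sqnD (T : finType) (v w : T -> C) :
  sqn (fun t => v t + w t) = sqn v + sqn w + (hip v w + hip w v).
Proof. by rewrite !sqnE hipDl !hipDr [hip w v + _]addrC addrACA. Qed.

Lemma sqn_add_le (T : finType) (v w : T -> C) :
  sqn (fun t => v t + w t) <= 2 * sqn v + 2 * sqn w.
Proof.
have := sqn_ge0 (fun t => v t + -1 * w t).
rewrite !sqnD sqnZ hipZl hipZr rmorphN1 !mulN1r normrN1 expr1n mul1r -opprD.
rewrite subr_ge0 => h.
by apply: le_trans (lerD (lexx _) h) _; rewrite -mulrDr -mulr2n mulr_natl.
Qed.

(* [k] is negative definite on some subspace of dimension [#|R|], parametrized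
   by [kapp J]. *)
Definition negsub (T : finType) (k : T -> T -> C) (R : finType) : Prop :=
  exists J : T -> R -> C, forall c : R -> C,
    (exists i, c i != 0) -> hform k (kapp J c) < 0.
Definition kopp (T : finType) (k : T -> T -> C) : T -> T -> C :=
  fun s t => - k s t.
(** The last clause makes the form nondegenerate. With it, two definite subspaces of the right
    dimensions determine the pair. *)
Definition inertia (T : finType) (k : T -> T -> C) (p q : nat) : Prop :=
  [/\ negsub k 'I_p, negsub (kopp k) 'I_q & (p + q = #|T|)%N].

Lemma hform_ext (T : finType) (k l : T -> T -> C) v w :
  (forall s t, k s t = l s t) -> (forall t, v t = w t) -> hform k v = hform l w.
Proof. by move=> kl vw; apply: eq_bigr => t _; rewrite vw (kapp_ext kl vw). Qed.

Lemma hform_opp (T : finType) (k : T -> T -> C) v :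
  hform (kopp k) v = - hform k v.
Proof. by rewrite /hform /hip -sumrN; apply: eq_bigr => t _; rewrite kappNl mulrN. Qed.

Lemma hform_vopp (T : finType) (k : T -> T -> C) v :
  hform k (fun t => - v t) = hform k v.
Proof. by apply: eq_bigr => t _; rewrite kappN rmorphN mulrNN. Qed.

Lemma hform0 (T : finType) (k : T -> T -> C) v :
  (forall t, v t = 0) -> hform k v = 0.
Proof. by move=> h; rewrite /hform /hip big1 // => t _; rewrite h conjC0 mul0r. Qed.

(** Sylvester's law: a subspace on which the form is negative and one on which it is positive meet
    only in 0. If the dimensions were too large, a kernel vector of the stacked parametrizations
    would produce a common vector, up to sign. *)
Lemma negsub_bound (T : finType) (k : T -> T -> C) p q :
  negsub k 'I_p -> negsub (kopp k) 'I_q -> (p + q <= #|T|)%N.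
Proof.
move=> [J hJ] [J' hJ']; rewrite leqNgt; apply/negP => lt.
pose M := \matrix_(i < p + q, t < #|T|)
  match split i with inl a => J (enum_val t) a | inr b => J' (enum_val t) b end.
have : kermx M != 0.
  rewrite kermx_eq0; apply/negP => /eqP rM.
  by have := rank_leq_col M; rewrite rM leqNgt lt.
case/rowV0Pn => v /sub_kermxP vM vn0.
pose c a := v 0 (lshift q a); pose c' b := v 0 (rshift p b).
have e t : kapp J c t + kapp J' c' t = 0.
  have /rowP/(_ (enum_rank t)) := vM.
  rewrite !mxE big_split_ord /= => e; rewrite -[RHS]e.
  by congr (_ + _); apply: eq_bigr => i _;
    rewrite mxE ?(unsplitK (inl _)) ?(unsplitK (inr _)) enum_rankK mulrC.
have eJ : hform k (kapp J c) = hform k (kapp J' c').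
  rewrite -(hform_vopp _ (kapp J' c')); apply: hform_ext => // t.
  by apply/eqP; rewrite -addr_eq0 e.
have c'0 : (exists i, c' i != 0) -> 0 < hform k (kapp J' c').
  by move=> /hJ'; rewrite hform_opp oppr_lt0.
have z : (forall i, c' i = 0) -> hform k (kapp J' c') = 0.
  by move=> h; apply: hform0 => t; apply: big1 => i _; rewrite h mulr0.
have [/existsP h|] := boolP [exists i, c i != 0].
  have := hJ _ h; rewrite eJ.
  have [/existsP h'|] := boolP [exists i, c' i != 0].
    by move=> /lt_trans /(_ (c'0 h')); rewrite ltxx.
  by rewrite negb_exists => /forallP h'; rewrite z ?ltxx // => i; have /negPn/eqP := h' i.
rewrite negb_exists => /forallP h.
have c0 i : c i = 0 by have /negPn/eqP := h i.
have [/existsP h'|] := boolP [exists i, c' i != 0].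
  have := c'0 h'; rewrite -eJ hform0 ?ltxx // => t.
  by apply: big1 => i _; rewrite c0 mulr0.
rewrite negb_exists => /forallP h'.
case/eqP: vn0; apply/rowP => i; rewrite mxE.
case: (split_ordP i) => j ->; first exact: c0.
by have /negPn/eqP := h' j.
Qed.

Lemma negsub_card (T : finType) (k : T -> T -> C) (R : finType) :
  negsub k R -> negsub k 'I_#|R|.
Proof.
move=> [J hJ]; exists (fun t i => J t (enum_val i)) => c [i ci].
rewrite (@hform_ext _ k k _ (kapp J (c \o enum_rank))) //.
  by apply: hJ; exists (enum_val i); rewrite /= enum_valK.
move=> t; rewrite /kapp (reindex (@enum_val R predT)) /=; last first.
  by apply: onW_bij; exact: enum_val_bij.
by apply: eq_bigr => j _; rewrite enum_valK.
Qed.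

Lemma inertia_card (T : finType) (k : T -> T -> C) (R R' : finType) :
  negsub k R -> negsub (kopp k) R' -> (#|R| + #|R'| = #|T|)%N ->
  inertia k #|R| #|R'|.
Proof. by move=> h h' e; split => //; exact: negsub_card. Qed.

Lemma inertia_unique (T : finType) (k : T -> T -> C) p q r s :
  inertia k p q -> inertia k r s -> p = r /\ q = s.
Proof.
move=> [a b e] [a' b' e'].
have := negsub_bound a b'; rewrite -e leq_add2l => sq.
have := negsub_bound a' b; rewrite -e' leq_add2l => qs.
have qe : q = s by apply/eqP; rewrite eqn_leq sq qs.
by subst s; split=> //; apply/eqP; rewrite -(eqn_add2r q) e e'.
Qed.

Lemma negsub_ext (T : finType) (k l : T -> T -> C) (R : finType) :
  (forall s t, k s t = l s t) -> negsub k R -> negsub l R.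
Proof.
move=> kl [J hJ]; exists J => c hc.
by rewrite -(@hform_ext _ k l (kapp J c)) //; apply: hJ.
Qed.

Lemma inertia_ext (T : finType) (k l : T -> T -> C) p q :
  (forall s t, k s t = l s t) -> inertia k p q -> inertia l p q.
Proof.
move=> kl [a b e]; split=> //; first exact: negsub_ext a.
by apply: negsub_ext b => s t; rewrite /kopp kl.
Qed.

Lemma inertia_opp (T : finType) (k : T -> T -> C) p q :
  inertia k p q -> inertia (kopp k) q p.
Proof.
move=> [a b e]; split=> //; last by rewrite addnC.
by apply: negsub_ext a => s t; rewrite /kopp opprK.
Qed.

Lemma negsub_scale (T : finType) (k l : T -> T -> C) (d : T -> C) (R : finType) :
  (forall s t, l s t = (d s)^* * k s t * d t) -> negsub l R -> negsub k R.
Proof.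
move=> kl [J hJ]; exists (fun t i => d t * J t i) => c /hJ.
congr (_ < _); apply: eq_bigr => t _.
have e s : kapp (fun t i => d t * J t i) c s = d s * kapp J c s.
  by rewrite /kapp mulr_sumr; apply: eq_bigr => i _; rewrite mulrA.
rewrite (kapp_ext (fun _ _ => erefl (k _ _)) e) e; move: (kapp J c) => w.
rewrite rmorphM /= [(d t)^* * _]mulrC -mulrA; congr (_ * _).
by rewrite /kapp mulr_sumr; apply: eq_bigr => s _; rewrite kl -!mulrA.
Qed.

Lemma inertia_scale (T : finType) (k l : T -> T -> C) (d : T -> C) p q :
  (forall s t, l s t = (d s)^* * k s t * d t) -> inertia l p q -> inertia k p q.
Proof.
move=> kl [a b e]; split=> //; first exact: negsub_scale a.
by apply: negsub_scale b => s t; rewrite /kopp kl mulrN mulNr.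
Qed.

End Kernels.

(** * Direct sums and diagonalization of Hermitian kernels *)

Section Inertia.
Variable C : numClosedFieldType.

Section DirectSum.
Variables (T U S : finType) (f : U * S -> T) (g : T -> U * S).
Hypotheses (fK : cancel f g) (gK : cancel g f).
Variables (k : T -> T -> C) (ks : S -> U -> U -> C).
Hypothesis kE : forall u s u' s', k (f (u, s)) (f (u', s')) = (s == s')%:R * ks s u u'.

Lemma hform_sum v : hform k v = \sum_s hform (ks s) (fun u => v (f (u, s))).
Proof.
have bf : bijective f by exists g.
rewrite {1}/hform /hip (reindex f) /=; last exact: onW_bij.
rewrite (eq_bigr (fun p => (v (f (p.1, p.2)))^* * kapp k v (f (p.1, p.2))));
  last by case.
rewrite -(pair_bigA _ (fun u s => (v (f (u, s)))^* * kapp k v (f (u, s)))) /=.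
rewrite exchange_big /=; apply: eq_bigr => s _; apply: eq_bigr => u _.
congr (_ * _); rewrite {1}/kapp (reindex f) /=; last exact: onW_bij.
rewrite (eq_bigr (fun p => k (f (u, s)) (f (p.1, p.2)) * v (f (p.1, p.2))));
  last by case.
rewrite -(pair_bigA _ (fun u' s' => k (f (u, s)) (f (u', s')) * v (f (u', s')))) /=.
apply: eq_bigr => u' _; rewrite (bigD1 s) //= kE eqxx mul1r big1 ?addr0 //.
by move=> s' /negbTE; rewrite eq_sym kE => ->; rewrite !mul0r.
Qed.

(** The form is the sum of the forms on the summands. A nonzero coefficient makes one of them
    strictly negative, and the others are at most 0. *)
Lemma negsub_sum (R : S -> finType) :
  (forall s, negsub (ks s) (R s)) -> negsub k {s : S & R s}.
Proof.
move=> /fin_all_exists [J hJ].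
exists (fun t r => if (g t).2 == tag r then J (tag r) (g t).1 (tagged r) else 0).
move=> c [[s i] ci]; rewrite hform_sum.
set w := kapp _ c.
have wE s' u : w (f (u, s')) = kapp (J s') (fun j => c (Tagged (fun s => R s : Type) j)) u.
  transitivity (\sum_(s'' : S) \sum_(j : R s'')
      (if s' == s'' then J s'' u j else 0) * c (Tagged (fun s => R s : Type) j)).
    rewrite (sig_big_dep (fun=> true) (fun _ => predT) (fun s'' (j : R s'') => 
      (if s' == s'' then J s'' u j else 0) * c (Tagged (fun s => R s : Type) j))) /=.
    by apply: eq_bigr => -[s'' j] _; rewrite /= fK.
  rewrite (bigD1 s') //= [X in _ + X]big1 ?addr0.
    by apply: eq_bigr => j _; rewrite eqxx.
  move=> s'' /negbTE n; apply: big1 => j _.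
  by rewrite eq_sym n mul0r.
have le s' : hform (ks s') (fun u => w (f (u, s'))) <= 0.
  rewrite (hform_ext (fun _ _ => erefl (ks s' _ _)) (wE s')).
  have [/existsP h|] := boolP [exists j, c (Tagged (fun s => R s : Type) (j : R s')) != 0].
    by apply: ltW; apply: hJ.
  rewrite negb_exists => /forallP h; rewrite hform0 // => t; apply: big1 => j _.
  by have /negPn/eqP -> := h j; rewrite mulr0.
rewrite (bigD1 s) //= -[X in _ < X]addr0; apply: ltr_leD; last exact: sumr_le0.
rewrite (hform_ext (fun _ _ => erefl (ks s _ _)) (wE s)).
by apply: hJ; exists i.
Qed.

End DirectSum.

(** The operators to be split are indexed by nested products whose summation index need not come
    last, hence the reindexing by [f] and [g]. *)
Lemma inertia_sum (T U S : finType) (f : U * S -> T) (g : T -> U * S)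
    (k : T -> T -> C) (ks : S -> U -> U -> C) (p q : S -> nat) :
  cancel f g -> cancel g f ->
  (forall u s u' s', k (f (u, s)) (f (u', s')) = (s == s')%:R * ks s u u') ->
  (forall s, inertia (ks s) (p s) (q s)) ->
  inertia k (\sum_s p s) (\sum_s q s).
Proof.
move=> fK gK kE h.
have card (r : S -> nat) : #|{: {s : S & 'I_(r s)}}| = (\sum_s r s)%N.
  by rewrite card_tagged sumnE big_map big_enum; apply: eq_bigr => s _; rewrite card_ord.
rewrite -!card; apply: inertia_card.
- by apply: (negsub_sum fK gK kE (R := fun s => 'I_(p s))) => s; case: (h s).
- have kE' u s u' s' : kopp k (f (u, s)) (f (u', s')) =
      (s == s')%:R * kopp (ks s) u u' by rewrite /kopp kE mulrN.
  by apply: (negsub_sum fK gK kE' (R := fun s => 'I_(q s))) => s; case: (h s).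
- rewrite !card -big_split /=.
  have e : #|T| = #|{: U * S}|.
    by apply: bij_eq_card (Bijective gK fK).
  rewrite e card_prod mulnC -sum_nat_const.
  by apply: eq_bigr => s _; case: (h s).
Qed.

Definition mxk (T : finType) (k : T -> T -> C) : 'M[C]_#|T| :=
  \matrix_(i, j) k (enum_val i) (enum_val j).

Lemma mxk_mul (T : finType) (k l : T -> T -> C) :
  mxk (kmul k l) = mxk k *m mxk l.
Proof.
apply/matrixP => i j; rewrite !mxE /kmul (reindex (@enum_val T predT)) /=; last first.
  by apply: onW_bij; exact: enum_val_bij.
by apply: eq_bigr => a _; rewrite !mxE.
Qed.

Lemma mxtr (T : finType) (k : T -> T -> C) : \tr (mxk k) = \sum_t k t t.
Proof.
rewrite /mxtrace [RHS](reindex (@enum_val T predT)) /=; last first.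
  by apply: onW_bij; exact: enum_val_bij.
by apply: eq_bigr => a _; rewrite !mxE.
Qed.

(** The spectral theorem for matrices, transported along [enum_rank]. The rows of [U] are the
    conjugates of the eigenvectors. *)
Lemma spectral_kernel (T : finType) (k : T -> T -> C) : herm k ->
  exists (U : T -> T -> C) (d : T -> C),
  [/\ forall t, d t \is Num.real,
      forall s t, \sum_i U i s * (U i t)^* = (s == t)%:R,
      forall i j, \sum_t U i t * (U j t)^* = (i == j)%:R,
      forall s t, k s t = \sum_i (U i s)^* * d i * U i t &
      \det (mxk k) = \prod_t d t /\ \sum_t k t t = \sum_t d t].
Proof.
move=> hk; pose A := mxk k.
have hA : A \is hermsymmx.
  apply/is_hermitianmxP; rewrite expr0 scale1r; apply/matrixP => i j.
  by rewrite !mxE -hk.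
have dr := hermitian_spectral_diag_real hA.
have /orthomx_spectralP eA := hermitian_normalmx hA.
have Pu := spectral_unitarymx A; move: (spectral_diag A) (spectralmx A) dr eA Pu => D P dr eA Pu.
have iP := invmx_unitary Pu; have uP := unitarymx_unit Pu.
have sumT (F : T -> C) : \sum_t F t = \sum_i F (enum_val (A := predT) i).
  by rewrite (reindex (@enum_val T predT)) //; apply: onW_bij; exact: enum_val_bij.
exists (fun i t => P (enum_rank i) (enum_rank t)), (fun i => D 0 (enum_rank i)); split.
- by move=> t; apply: (mxOverP dr).
- move=> s t; have /matrixP/(_ (enum_rank t) (enum_rank s)) := mulVmx uP.
  rewrite iP !mxE (inj_eq enum_rank_inj) eq_sym => <-; rewrite sumT.
  by apply: eq_bigr => i _; rewrite enum_valK !mxE mulrC.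
- move=> i j; have /matrixP/(_ (enum_rank i) (enum_rank j)) := mulmxV uP.
  rewrite iP !mxE (inj_eq enum_rank_inj) => <-; rewrite sumT.
  by apply: eq_bigr => t _; rewrite enum_valK !mxE.
- move=> s t; have /matrixP/(_ (enum_rank s) (enum_rank t)) := eA.
  rewrite !mxE !enum_rankK => ->; rewrite sumT; apply: eq_bigr => i _.
  rewrite mul_mx_diag !mxE iP !enum_valK !mxE; congr (_ * _).
- split.
  + rewrite -/A eA !det_mulmx mulrC mulrA -det_mulmx mulmxV // det1 mul1r det_diag.
    rewrite (reindex (@enum_val T predT)) /=; last by apply: onW_bij; exact: enum_val_bij.
    by apply: eq_bigr => i _; rewrite enum_valK.
  + rewrite -mxtr -/A eA -mulmxA mxtrace_mulC mulmxK // mxtrace_diag.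
    rewrite sumT.
    by apply: eq_bigr => i _; rewrite enum_valK.
Qed.

End Inertia.

(** * Spectral gaps and the stability of inertia *)

Section Spectral.
Variable C : numClosedFieldType.

Lemma sqn_isometry (S T : finType) (U : S -> T -> C) v :
  (forall s t, \sum_i U i s * (U i t)^* = (s == t)%:R) ->
  sqn (kapp U v) = sqn v.
Proof.
move=> h; rewrite !sqnE hip_kadj; apply: eq_bigr => t _; congr (_^* * _).
rewrite -kapp_mul /kapp (bigD1 t) //= [X in _ + X]big1 ?addr0.
  rewrite /kmul /kadj (eq_bigr (fun i => U i t * (U i t)^*)).
    by rewrite h eqxx mul1r.
  by move=> i _; rewrite mulrC.
move=> s /negbTE n; rewrite /kmul /kadj (eq_bigr (fun i => U i s * (U i t)^*)).
  by rewrite h n mul0r.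
by move=> i _; rewrite mulrC.
Qed.

Section Diagonalized.
Variables (T : finType) (k U : T -> T -> C) (d : T -> C).
Hypothesis dr : forall t, d t \is Num.real.
Hypothesis U1 : forall s t, \sum_i U i s * (U i t)^* = (s == t)%:R.
Hypothesis U2 : forall i j, \sum_t U i t * (U j t)^* = (i == j)%:R.
Hypothesis kE : forall s t, k s t = \sum_i (U i s)^* * d i * U i t.

Lemma spectral_app v s : kapp k v s = \sum_i (U i s)^* * (d i * kapp U v i).
Proof.
rewrite /kapp; under eq_bigr do rewrite kE mulr_suml.
rewrite exchange_big /=; apply: eq_bigr => i _.
by rewrite !mulr_sumr; apply: eq_bigr => t _; rewrite !mulrA.
Qed.

Lemma spectral_coord v i : kapp U (kapp k v) i = d i * kapp U v i.
Proof.
rewrite {1}/kapp; under eq_bigr do rewrite spectral_app mulr_sumr.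
rewrite exchange_big /= (bigD1 i) //= [X in _ + X]big1 ?addr0.
  by under eq_bigr do rewrite mulrA; rewrite -mulr_suml U2 eqxx mul1r.
move=> j /negbTE n; under eq_bigr do rewrite mulrA.
by rewrite -mulr_suml U2 eq_sym n mul0r.
Qed.

Lemma spectral_form v : hform k v = \sum_i d i * `|kapp U v i| ^+ 2.
Proof.
rewrite /hform /hip; under eq_bigr do rewrite spectral_app mulr_sumr.
rewrite exchange_big /=; apply: eq_bigr => i _.
rewrite normCK.
transitivity ((kapp U v i)^* * (d i * kapp U v i)); last by ring.
rewrite {2}/kapp rmorph_sum /= mulr_suml; apply: eq_bigr => t _.
by rewrite rmorphM /=; ring.
Qed.

(** The bound is tested on the eigenvector [(U i t)^*], whose coordinates are those of a basis
    vector. *)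
Lemma spectral_gap a i :
  (forall v, a * sqn v <= sqn (kapp k v)) -> a <= d i ^+ 2.
Proof.
move=> /(_ (fun t => (U i t)^*)).
have yE j : kapp U (fun t => (U i t)^*) j = (j == i)%:R by exact: U2.
rewrite -(sqn_isometry (kapp k _) U1) -(sqn_isometry (fun t => _) U1).
rewrite (sqn_ext yE) (sqn_ext (spectral_coord _)) /sqn.
rewrite (bigD1 i) //= [X in _ + X]big1; last first.
  by move=> j /negbTE ->; rewrite normr0 expr0n.
rewrite (bigD1 i) //= [X in _ <= _ + X]big1; last first.
  by move=> j /negbTE n; rewrite yE n mulr0 normr0 expr0n.
by rewrite yE eqxx !addr0 normr1 expr1n !mulr1 real_normK.
Qed.

Variable P : pred T.
Definition eigspace : T -> {i | P i} -> C := fun t r => (U (val r) t)^*.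

Lemma eigspace_coord c j :
  kapp U (kapp eigspace c) j = \sum_r (j == val r)%:R * c r.
Proof.
rewrite -kapp_mul /kapp; apply: eq_bigr => r _; congr (_ * _).
exact: U2.
Qed.

Lemma eigspace_out c j : ~~ P j -> kapp U (kapp eigspace c) j = 0.
Proof.
move=> Pj; rewrite eigspace_coord big1 // => r _.
by case: eqP => [e|]; rewrite ?mul0r // e (valP r) in Pj *.
Qed.

Lemma eigspace_gt0 c : (exists r, c r != 0) -> 0 < sqn (kapp eigspace c).
Proof.
move=> [r cr]; rewrite -(sqn_isometry _ U1); apply: (@sqn_gt0 _ _ _ (val r)).
rewrite eigspace_coord (bigD1 r) //= eqxx mul1r big1 ?addr0 //.
by move=> s n; rewrite (inj_eq val_inj) eq_sym (negbTE n) mul0r.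
Qed.

End Diagonalized.

Lemma sqr_le_abs (a b : C) : 0 < a -> b \is Num.real -> a ^+ 2 <= b ^+ 2 ->
  b < 0 /\ b <= - a \/ 0 < b /\ a <= b.
Proof.
move=> a0 br; rewrite -(real_normK br) ler_pXn2r ?nnegrE ?normr_ge0 ?(ltW a0) // => h.
have [b0|b0|b0] := real_ltgtP br (rpred0 _); [left|right|].
- by split=> //; rewrite lerNr -(ltr0_norm b0).
- by split=> //; rewrite -(gtr0_norm b0).
- by move: h; rewrite b0 normr0 (lt_geF a0).
Qed.

(** A single diagonalization serves all later uses. Both eigenspaces come with the quantitative
    bound [a], which a perturbation argument consumes, and the eigenvalues [d] are kept for counting
    through the trace and the determinant. *)
Lemma spectral_inertia (T : finType) (k : T -> T -> C) (a : C) :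
  herm k -> 0 < a -> (forall v, a ^+ 2 * sqn v <= sqn (kapp k v)) ->
  exists (d : T -> C) (R R' : finType) (J : T -> R -> C) (J' : T -> R' -> C),
  [/\ (#|R| + #|R'| = #|T|)%N,
      forall c, (exists i, c i != 0) -> 0 < sqn (kapp J c) /\
        hform k (kapp J c) <= - a * sqn (kapp J c),
      forall c, (exists i, c i != 0) -> 0 < sqn (kapp J' c) /\
        a * sqn (kapp J' c) <= hform k (kapp J' c),
      ((forall t, d t \is Num.real) /\ (forall t, a ^+ 2 <= d t ^+ 2)) /\
        (#|R| = #|[pred i | d i < 0]| /\ #|R'| = #|[pred i | 0 < d i]|) &
      (\det (mxk k) = \prod_t d t /\ \sum_t k t t = \sum_t d t) /\
      (forall b, (forall v t, kapp k (kapp k v) t = b * v t) -> forall t, d t ^+ 2 = b)].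
Proof.
move=> hk a0 gap; have [U [d [dr U1 U2 kE dt]]] := spectral_kernel hk.
have dg i := spectral_gap dr U1 U2 kE i gap.
pose N := [pred i | d i < 0]; pose N' := [pred i | 0 < d i].
exists d, {i | N i}, {i | N' i}, (eigspace U (P := N)), (eigspace U (P := N')).
have cN (Q : pred T) : #|{: {i | Q i}}| = #|Q| by rewrite card_sig.
split.
- rewrite !cN -(cardC N); congr (_ + _)%N; apply: eq_card => i; rewrite !inE.
  case: (sqr_le_abs a0 (dr i) (dg i)) => -[h _].
    by rewrite h lt_gtF.
  by rewrite h lt_gtF.
- move=> c hc; have c0 := eigspace_gt0 U1 U2 hc; split=> //.
  rewrite (spectral_form kE) -(sqn_isometry (kapp _ c) U1) /sqn mulr_sumr.
  apply: ler_sum => i _; have [Ni|Ni] := boolP (N i); last first.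
    by rewrite (eigspace_out U2 _ Ni) normr0 expr0n !mulr0.
  apply: ler_wpM2r; first exact: exprn_ge0.
  case: (sqr_le_abs a0 (dr i) (dg i)) => -[h h'] //.
  by move: Ni; rewrite /N /= lt_gtF.
- move=> c hc; have c0 := eigspace_gt0 U1 U2 hc; split=> //.
  rewrite (spectral_form kE) -(sqn_isometry (kapp _ c) U1) /sqn mulr_sumr.
  apply: ler_sum => i _; have [Ni|Ni] := boolP (N' i); last first.
    by rewrite (eigspace_out U2 _ Ni) normr0 expr0n !mulr0.
  apply: ler_wpM2r; first exact: exprn_ge0.
  case: (sqr_le_abs a0 (dr i) (dg i)) => -[h h'] //.
  by move: Ni; rewrite /N' /= lt_gtF.
- by rewrite !cN.
- split=> // b hb t.
  have yE j : kapp U (fun s => (U t s)^*) j = (j == t)%:R by exact: U2.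
  have := spectral_coord U2 kE (kapp k (fun s => (U t s)^*)) t.
  rewrite (kapp_ext (fun _ _ => erefl (U _ _)) (hb _)) kappZ.
  rewrite (spectral_coord U2 kE) yE eqxx !mulr1 => ->.
  by rewrite expr2.
Qed.

Lemma inertia_definite (T R R' : finType) (k : T -> T -> C) (a : C)
    (J : T -> R -> C) (J' : T -> R' -> C) :
  0 < a -> (#|R| + #|R'| = #|T|)%N ->
  (forall c, (exists i, c i != 0) -> 0 < sqn (kapp J c) /\
     hform k (kapp J c) <= - a * sqn (kapp J c)) ->
  (forall c, (exists i, c i != 0) -> 0 < sqn (kapp J' c) /\
     a * sqn (kapp J' c) <= hform k (kapp J' c)) ->
  inertia k #|R| #|R'|.
Proof.
move=> a0 e hJ hJ'; apply: inertia_card => //.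
  exists J => c /hJ [s0 /le_lt_trans]; apply.
  by rewrite mulNr oppr_lt0 mulr_gt0.
exists J' => c /hJ' [s0 le]; rewrite hform_opp oppr_lt0.
by apply: lt_le_trans le; rewrite mulr_gt0.
Qed.

Lemma inertia_exists (T : finType) (k : T -> T -> C) (a : C) :
  herm k -> 0 < a -> (forall v, a ^+ 2 * sqn v <= sqn (kapp k v)) ->
  exists p q, inertia k p q.
Proof.
move=> hk a0 g; have [d [R [R' [J [J' [e h h' _ _]]]]]] := spectral_inertia hk a0 g.
by exists #|R|, #|R'|; exact: inertia_definite h h'.
Qed.

(** Cauchy-Schwarz without square roots: expand the squared norm of [a / 2 * e * v + w] for [e = 1]
    and [e = -1]. *)
Lemma hip_perturb (T : finType) (v w : T -> C) (a : C) : 0 < a ->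
  hip v w \is Num.real -> sqn w <= (a / 2) ^+ 2 * sqn v ->
  `|hip v w| <= a / 2 * sqn v.
Proof.
move=> a0 hr le.
have wv : hip w v = hip v w.
  rewrite -[RHS](CrealP hr) /hip rmorph_sum; apply: eq_bigr => t _ /=.
  by rewrite rmorphM /= conjCK mulrC.
have b0 : 0 < a / 2 by rewrite divr_gt0.
have k e : e ^+ 2 = 1 -> e \is Num.real -> - (e * hip v w) <= a / 2 * sqn v.
  move=> e2 er; have := sqn_ge0 (fun t => (a / 2 * e) * v t + w t).
  rewrite sqnD sqnZ hipZl hipZr wv.
  have br : a / 2 \is Num.real by apply: gtr0_real.
  have abr : a / 2 * e \is Num.real by rewrite rpredM.
  rewrite (CrealP abr) real_normK // exprMn e2 mulr1.
  move=> h; rewrite -(ler_pM2l b0) -(ler_pM2l (ltr0Sn C 1)).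
  rewrite -subr_ge0; apply: le_trans h _.
  rewrite -subr_ge0.
  have -> : 2 * (a / 2 * (a / 2 * sqn v)) - 2 * (a / 2 * - (e * hip v w)) -
    ((a / 2) ^+ 2 * sqn v + sqn w + (a / 2 * e * hip v w + a / 2 * e * hip v w))
    = (a / 2) ^+ 2 * sqn v - sqn w by field.
  by rewrite subr_ge0.
rewrite real_ler_norml // lerNl; apply/andP; split.
  by have := k 1 (expr1n _ _) (rpred1 _); rewrite mul1r.
by have := k (-1); rewrite sqrrN expr1n mulN1r opprK rpredN1; apply.
Qed.


(** A perturbation of norm at most [a / 2] moves the form by at most half of the gap. The two
    eigenspaces of [k] therefore remain definite for [l], and their dimensions still fill the
    space. *)
Lemma inertia_perturb (T : finType) (k l : T -> T -> C) (a : C) p q :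
  herm k -> herm l -> 0 < a -> (forall v, a ^+ 2 * sqn v <= sqn (kapp k v)) ->
  (forall v, sqn (fun t => kapp l v t - kapp k v t) <= (a / 2) ^+ 2 * sqn v) ->
  inertia k p q -> inertia l p q.
Proof.
move=> hk hl a0 g h kpq.
have [d [R [R' [J [J' [e hJ hJ' _ _]]]]]] := spectral_inertia hk a0 g.
have krr := inertia_definite a0 e hJ hJ'.
have [-> ->] := inertia_unique kpq krr.
pose m s t := l s t - k s t.
have hm : herm m by move=> s t; rewrite /m rmorphB hk hl.
have mE v t : kapp m v t = kapp l v t - kapp k v t.
  by rewrite /m kappDl kappNl.
have lE v : hform l v = hform k v + hip v (kapp m v).
  rewrite /hform -hipDr; apply: eq_bigr => t _; congr (_ * _).
  by rewrite mE addrC subrK.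
have mr v : hip v (kapp m v) \is Num.real.
  apply/CrealP; rewrite [in RHS]herm_hip // /hip rmorph_sum.
  by apply: eq_bigr => t _; rewrite rmorphM /= conjCK mulrC.
have mle v : `|hip v (kapp m v)| <= a / 2 * sqn v.
  by apply: hip_perturb => //; rewrite (sqn_ext (mE v)).
have a2 : 0 < a / 2 by rewrite divr_gt0.
have aE x : a * x = a / 2 * x + a / 2 * x by field.
apply: inertia_card => //.
  exists J => c /hJ [s0 le]; rewrite lE.
  have /lerD/(_ (le_trans (real_ler_norm (mr _)) (mle (kapp J c)))) := le.
  move/le_lt_trans; apply; rewrite mulNr (aE (sqn _)) opprD addrNK oppr_lt0.
  by rewrite mulr_gt0.
exists J' => c /hJ' [s0 le]; rewrite hform_opp oppr_lt0 lE.
have := mle (kapp J' c); rewrite real_ler_norml // => /andP[+ _] => /(lerD le).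
by apply: lt_le_trans; rewrite (aE (sqn _)) addrK mulr_gt0.
Qed.

(** All eigenvalues are 1 or -1. *)
Lemma inertia_trace (T : finType) (k : T -> T -> C) p q :
  herm k -> (forall v t, kapp k (kapp k v) t = v t) -> inertia k p q ->
  \sum_t k t t = q%:R - p%:R.
Proof.
move=> hk k2 kpq.
have g v : 1 ^+ 2 * sqn v <= sqn (kapp k v).
  by rewrite expr1n mul1r !sqnE -herm_hip // /hip (eq_bigr _ (fun t _ => congr1 _ (k2 v t))).
have [d [R [R' [J [J' [e hJ hJ' [[dr dg] [cR cR']] [[_ tr] sq]]]]]]] :=
  spectral_inertia hk ltr01 g.
have krr := inertia_definite ltr01 e hJ hJ'.
have [-> ->] := inertia_unique kpq krr.
rewrite tr cR cR' -!sum1_card !natr_sum [X in _ = X - _]big_mkcond [X in _ = _ - X]big_mkcond /= -sumrB.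
apply: eq_bigr => t _; rewrite !inE.
have : d t ^+ 2 = 1 by apply: sq => v u; rewrite k2 mul1r.
move/eqP; rewrite -subr_eq0 -{1}(expr1n _ 2) subr_sqr mulf_eq0 subr_eq0 addr_eq0.
case/orP => /eqP ->.
  by rewrite ltr01 lt_gtF ?ltr01 // subr0.
by rewrite oppr_lt0 ltr01 oppr_gt0 lt_gtF ?ltr01 // sub0r.
Qed.

Lemma inertia_det (T : finType) (k : T -> T -> C) (a : C) p q :
  herm k -> 0 < a -> (forall v, a ^+ 2 * sqn v <= sqn (kapp k v)) ->
  inertia k p q -> 0 < (-1) ^+ p * \det (mxk k).
Proof.
move=> hk a0 g kpq.
have [d [R [R' [J [J' [e hJ hJ' [[dr dg] [cR cR']] [[dE _] _]]]]]]] :=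
  spectral_inertia hk a0 g.
have krr := inertia_definite a0 e hJ hJ'.
have [-> _] := inertia_unique kpq krr.
rewrite dE cR -prodr_const big_mkcond -big_split /=.
apply: prodr_gt0 => t _; rewrite inE.
case: (sqr_le_abs a0 (dr t) (dg t)) => -[h _].
  by rewrite h mulN1r oppr_gt0.
by rewrite (lt_gtF h) mul1r.
Qed.


Lemma sqr_sum_le (I : finType) (a : I -> C) :
  `|\sum_i a i| ^+ 2 <= #|I|%:R * \sum_i `|a i| ^+ 2.
Proof.
set x := fun i => `|a i|.
have : (\sum_i x i) ^+ 2 <= #|I|%:R * \sum_i x i ^+ 2.
  have : 0 <= \sum_i \sum_j (x i - x j) ^+ 2.
    apply: sumr_ge0 => i _; apply: sumr_ge0 => j _.
    by apply: real_exprn_even_ge0 => //; rewrite rpredB // normr_real.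
  have -> : \sum_i \sum_j (x i - x j) ^+ 2 =
      2 * (#|I|%:R * \sum_i x i ^+ 2 - (\sum_i x i) ^+ 2).
    transitivity (\sum_i (#|I|%:R * x i ^+ 2 + \sum_j x j ^+ 2
        - 2 * (x i * \sum_j x j))).
      apply: eq_bigr => i _; rewrite [#|I|%:R * _]mulr_natl -sumr_const.
      rewrite !mulr_sumr -big_split -sumrB; apply: eq_bigr => j _ /=.
      by ring.
    rewrite sumrB big_split /= -!mulr_sumr -mulr_suml sumr_const -mulr_natl.
    by rewrite expr2; ring.
  by rewrite pmulr_rge0 // subr_ge0.
apply: le_trans; rewrite ler_pXn2r ?nnegrE ?normr_ge0 ?ler_norm_sum //.
by apply: sumr_ge0 => i _; exact: normr_ge0.
Qed.

Lemma kapp_bounded (S T : finType) (k : S -> T -> C) v :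
  sqn (kapp k v) <= (#|T|%:R * \sum_s \sum_t `|k s t| ^+ 2) * sqn v.
Proof.
rewrite mulrAC -mulrA mulr_sumr mulr_sumr; apply: ler_sum => s _.
apply: le_trans (sqr_sum_le _) _; apply: ler_wpM2l; first exact: ler0n.
rewrite mulr_sumr; apply: ler_sum => t _; rewrite normrM exprMn mulrC.
apply: ler_wpM2r; first exact: exprn_ge0.
by rewrite /sqn (bigD1 t) //= lerDl sumr_ge0 // => i _; exact: exprn_ge0.
Qed.

(** The segment is cut into equal steps, each a perturbation by at most half of the gap. The
    Archimedean property is a hypothesis because [C] is an abstract closed field. *)
Lemma inertia_segment (T : finType) (k l : T -> T -> C) (a : C) p q :
  (forall x : C, x \is Num.real -> exists n : nat, x <= n%:R) ->
  herm k -> herm l -> 0 < a ->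
  (forall u v, 0 <= u <= 1 ->
     a ^+ 2 * sqn v <= sqn (fun t => (1 - u) * kapp k v t + u * kapp l v t)) ->
  inertia k p q -> inertia l p q.
Proof.
move=> arch hk hl a0 gap kpq.
pose m s t := l s t - k s t.
have [B [B0 hB]] : exists B, 0 <= B /\ forall v, sqn (kapp m v) <= B * sqn v.
  exists (#|T|%:R * \sum_s \sum_t `|m s t| ^+ 2); split.
    by rewrite mulr_ge0 // sumr_ge0 // => s _; rewrite sumr_ge0 // => t _; exact: exprn_ge0.
  by move=> v; exact: kapp_bounded.
have a2 : 0 < (a / 2) ^+ 2 by rewrite exprn_gt0 // divr_gt0.
(* A step of length [1 / N] has squared size at most [B / N^2]; with [N = n + 1] the inequality
   [n <= N^2] is enough. *)
have [n hn] := arch (B / (a / 2) ^+ 2) (ger0_real (divr_ge0 B0 (ltW a2))).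
pose N : C := n.+1%:R; have N0 : 0 < N by rewrite ltr0n.
pose ku i s t := k s t + (i%:R / N) * m s t.
have kuE i v t : kapp (ku i) v t = kapp k v t + (i%:R / N) * kapp m v t.
  by rewrite /ku kappDl kappZl.
have mE v t : kapp m v t = kapp l v t - kapp k v t.
  by rewrite /m kappDl kappNl.
have hku i : herm (ku i).
  move=> s t; rewrite /ku /m rmorphD rmorphM rmorphB /= -hk -hl; congr (_ + _ * _).
  by rewrite fmorph_div !rmorph_nat.
have step i : (i <= n.+1)%N -> inertia (ku i) p q.
  elim: i => [_|i IH lt].
    by apply: inertia_ext kpq => s t; rewrite /ku mul0r mul0r addr0.
  apply: (inertia_perturb (hku i) (hku i.+1) a0 _ _ (IH (ltnW lt))).
    move=> v; have u01 : 0 <= i%:R / N <= (1 : C).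
      by rewrite divr_ge0 ?ler0n //= ler_pdivrMr // mul1r ler_nat ltnW.
    have := gap _ v u01; congr (_ <= _); apply: sqn_ext => t.
    by rewrite kuE mE; ring.
  move=> v; rewrite (sqn_ext (w := fun t => N^-1 * kapp m v t)); last first.
    by move=> t; rewrite !kuE -natr1; ring.
  rewrite sqnZ ger0_norm ?invr_ge0 ?(ltW N0) //.
  have N2 : 0 < N ^+ 2 by rewrite exprn_gt0.
  rewrite exprVn mulrC ler_pdivrMr //.
  apply: le_trans (hB v) _; rewrite mulrAC; apply: ler_wpM2r; first exact: sqn_ge0.
  rewrite mulrC -ler_pdivrMr //; apply: le_trans hn _.
  by rewrite /N -natrX ler_nat (leq_trans (leqnSn n)) // -mulnn leq_pmulr.
apply: inertia_ext (step n.+1 (leqnn _)) => s t.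
by rewrite /ku divff ?gt_eqF // mul1r /m addrC subrK.
Qed.

End Spectral.

(** * Symbols of operators *)

Section Quantization.
Variable C : numClosedFieldType.

Definition isometry (X N : finType) (V : X -> N -> C) : Prop :=
  forall v, sqn (kapp V v) = sqn v.
(* Up to the squared error [e], the isometry [V] turns the operator [T] (and its
   adjoint) into multiplication by the symbol [F]. *)
Definition quant1 (X N : finType) (V : X -> N -> C) (T : N -> N -> C)
    (F : X -> C) (e : C) : Prop :=
  forall v, sqn (fun x => kapp V (kapp T v) x - F x * kapp V v x) <= e * sqn v.
Definition quant (X N : finType) (V : X -> N -> C) (T : N -> N -> C)
    (F : X -> C) (e : C) : Prop :=
  quant1 V T F e /\ quant1 V (kadj T) (fun x => (F x)^*) e.

Section Fixed.
Variables (X N : finType) (V : X -> N -> C).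

Lemma quant1_ext T T' F F' e : (forall s t, T s t = T' s t) ->
  (forall x, F x = F' x) -> quant1 V T F e -> quant1 V T' F' e.
Proof.
move=> hT hF h v; apply: le_trans (h v); rewrite le_eqVlt; apply/orP; left.
apply/eqP; apply: sqn_ext => x; rewrite hF; congr (_ - _).
by apply: kapp_ext => // n; exact: kapp_ext.
Qed.

Lemma quant_ext T T' F F' e : (forall s t, T s t = T' s t) ->
  (forall x, F x = F' x) -> quant V T F e -> quant V T' F' e.
Proof.
move=> hT hF [h h']; split; first exact: quant1_ext h.
by apply: quant1_ext h' => [s t|x]; rewrite ?/kadj ?hT ?hF.
Qed.

Lemma quant1_le T F e e' : e <= e' -> quant1 V T F e -> quant1 V T F e'.
Proof. by move=> le h v; apply: le_trans (h v) _; rewrite ler_wpM2r // sqn_ge0. Qed.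

Lemma quant_le T F e e' : e <= e' -> quant V T F e -> quant V T F e'.
Proof. by move=> le [h h']; split; apply: quant1_le le _. Qed.

Lemma quant_adj T F e : quant V T F e -> quant V (kadj T) (fun x => (F x)^*) e.
Proof.
move=> [h h']; split=> //; apply: quant1_ext h => [s t|x].
  by rewrite /kadj conjCK.
by rewrite conjCK.
Qed.

Lemma quant1_add T T' F F' e e' : quant1 V T F e -> quant1 V T' F' e' ->
  quant1 V (fun s t => T s t + T' s t) (fun x => F x + F' x) (2 * e + 2 * e').
Proof.
move=> h h' v; rewrite mulrDl -!mulrA.
apply: le_trans (lerD (ler_wpM2l (ler0n _ 2) (h v)) (ler_wpM2l (ler0n _ 2) (h' v))).
apply: le_trans (sqn_add_le _ _); rewrite le_eqVlt; apply/orP; left; apply/eqP.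
apply: sqn_ext => x.
rewrite (kapp_ext (w := fun n => kapp T v n + kapp T' v n) (fun _ _ => erefl (V _ _))).
  by rewrite kappD; ring.
by move=> n; rewrite kappDl.
Qed.

Lemma quant_add T T' F F' e e' : quant V T F e -> quant V T' F' e' ->
  quant V (fun s t => T s t + T' s t) (fun x => F x + F' x) (2 * e + 2 * e').
Proof.
move=> [h k] [h' k']; split; first exact: quant1_add.
by apply: quant1_ext (quant1_add k k') => [s t|x]; rewrite /kadj rmorphD.
Qed.

Lemma quant1_scale a T F e : quant1 V T F e ->
  quant1 V (fun s t => a * T s t) (fun x => a * F x) (`|a| ^+ 2 * e).
Proof.
move=> h v; rewrite -mulrA.
rewrite (sqn_ext (w := fun x => a * (kapp V (kapp T v) x - F x * kapp V v x))).
  by rewrite sqnZ; apply: ler_wpM2l (h v); exact: exprn_ge0.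
move=> x; rewrite (kapp_ext (w := fun n => a * kapp T v n) (fun _ _ => erefl (V _ _))).
  by rewrite kappZ; ring.
by move=> n; rewrite kappZl.
Qed.

Lemma quant_scale a T F e : quant V T F e ->
  quant V (fun s t => a * T s t) (fun x => a * F x) (`|a| ^+ 2 * e).
Proof.
move=> [h k]; split; first exact: quant1_scale.
have := quant1_scale a^* k; rewrite norm_conjC.
by apply: quant1_ext => [s t|x]; rewrite /kadj rmorphM.
Qed.

Lemma quant_id : quant V (fun s t => (s == t)%:R) (fun _ => 1) 0.
Proof.
have h : quant1 V (fun s t : N => (s == t)%:R) (fun _ => 1) 0.
  move=> v; rewrite mul0r le_eqVlt; apply/orP; left; apply/eqP.
  rewrite /sqn big1 // => x _.
  rewrite (kapp_ext (w := v) (fun _ _ => erefl (V _ _))).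
    by rewrite mul1r subrr normr0 expr0n.
  move=> n; rewrite /kapp (bigD1 n) //= eqxx mul1r big1 ?addr0 //.
  by move=> m /negbTE n'; rewrite eq_sym n' mul0r.
split=> //; apply: quant1_ext h => [s t|x]; last by rewrite conjC1.
by rewrite /kadj rmorph_nat eq_sym.
Qed.

Hypothesis Viso : isometry V.

Lemma quant1_bound T F e B : quant1 V T F e -> (forall x, `|F x| ^+ 2 <= B) ->
  forall v, sqn (kapp T v) <= (2 * e + 2 * B) * sqn v.
Proof.
move=> h hB v; rewrite -(Viso (kapp T v)) mulrDl -!mulrA.
have : sqn (fun x => F x * kapp V v x) <= B * sqn v.
  rewrite -(Viso v) /sqn mulr_sumr; apply: ler_sum => x _.
  by rewrite normrM exprMn ler_wpM2r // exprn_ge0.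
move/(ler_wpM2l (ler0n _ 2))/(lerD (ler_wpM2l (ler0n _ 2) (h v))); apply: le_trans.
apply: le_trans (sqn_add_le _ _); rewrite le_eqVlt; apply/orP; left; apply/eqP.
by apply: sqn_ext => x; rewrite subrK.
Qed.

(** The error splits as [(V T - F V) T' v + F (V T' - F' V) v]. As [e <= 1], the squared norm of
    [T' v] is at most [2 + 2 B] times that of [v], which gives [2 (2 + 2 B) e + 2 B e]. *)
Lemma quant1_mul T T' F F' e B : quant1 V T F e -> quant1 V T' F' e ->
  0 <= e <= 1 -> 0 <= B -> (forall x, `|F x| ^+ 2 <= B) -> (forall x, `|F' x| ^+ 2 <= B) ->
  quant1 V (kmul T T') (fun x => F x * F' x) ((4 + 6 * B) * e).
Proof.
move=> h h' /andP[e0 e1] B0 hB hB' v.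
have -> : (4 + 6 * B) * e * sqn v =
    2 * (e * ((2 * 1 + 2 * B) * sqn v)) + 2 * (B * (e * sqn v)) by ring.
have le1 : sqn (fun x => kapp V (kapp T (kapp T' v)) x - F x * kapp V (kapp T' v) x)
    <= e * ((2 * 1 + 2 * B) * sqn v).
  apply: le_trans (h _) _; apply: ler_wpM2l => //.
  apply: le_trans (quant1_bound h' hB' v) _; apply: ler_wpM2r; first exact: sqn_ge0.
  by rewrite lerD2r ler_pM2l.
have le2 : sqn (fun x => F x * (kapp V (kapp T' v) x - F' x * kapp V v x))
    <= B * (e * sqn v).
  apply: le_trans (ler_wpM2l B0 (h' v)); rewrite /sqn mulr_sumr.
  by apply: ler_sum => y _; rewrite normrM exprMn ler_wpM2r // exprn_ge0.
apply: le_trans (lerD (ler_wpM2l (ler0n _ 2) le1) (ler_wpM2l (ler0n _ 2) le2)).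
apply: le_trans (sqn_add_le _ _); rewrite le_eqVlt; apply/orP; left; apply/eqP.
apply: sqn_ext => x; rewrite (kapp_ext (w := kapp T (kapp T' v)) (fun _ _ => erefl (V _ _))).
  by ring.
by move=> n; rewrite kapp_mul.
Qed.

Lemma quant_mul T T' F F' e B : quant V T F e -> quant V T' F' e ->
  0 <= e <= 1 -> 0 <= B ->
  (forall x, `|F x| ^+ 2 <= B) -> (forall x, `|F' x| ^+ 2 <= B) ->
  quant V (kmul T T') (fun x => F x * F' x) ((4 + 6 * B) * e).
Proof.
move=> [h k] [h' k'] e01 B0 hB hB'; split; first exact: quant1_mul.
have : quant1 V (kmul (kadj T') (kadj T)) (fun x => (F' x)^* * (F x)^*) ((4 + 6 * B) * e).
  by apply: quant1_mul => // x; rewrite norm_conjC.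
apply: quant1_ext => [s t|x]; last by rewrite rmorphM mulrC.
by rewrite /kmul /kadj rmorph_sum; apply: eq_bigr => u _; rewrite rmorphM mulrC.
Qed.

End Fixed.

(** * Block operators and matrix-valued symbols *)

Section Blocks.
Variables (X N E : finType) (V : X -> N -> C).
Hypothesis Viso : isometry V.

Definition kblock (L : E -> E -> N -> N -> C) : N * E -> N * E -> C :=
  fun s t => L s.2 t.2 s.1 t.1.
Definition klift (v : N * E -> C) : X * E -> C :=
  fun p => kapp V (fun n => v (n, p.2)) p.1.
Definition symapp (F : X -> E -> E -> C) (w : X * E -> C) : X * E -> C :=
  fun p => kapp (F p.1) (fun e => w (p.1, e)) p.2.
(* The same with values in [E]: a block operator against a matrix-valued symbol. *)
Definition quantE (L : N * E -> N * E -> C) (F : X -> E -> E -> C) (r : C) : Prop :=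
  forall v, sqn (fun p => klift (kapp L v) p - symapp F (klift v) p) <= r * sqn v.

Lemma sqn_pair (I J : finType) (v : I * J -> C) :
  sqn v = \sum_j sqn (fun i => v (i, j)).
Proof.
rewrite /sqn exchange_big pair_bigA /=; apply: eq_bigr => -[i j] _ //.
Qed.

Lemma sqn_pair_l (I J : finType) (v : I * J -> C) :
  sqn v = \sum_i sqn (fun j => v (i, j)).
Proof. by rewrite /sqn pair_bigA /=; apply: eq_bigr => -[i j] _. Qed.

Lemma sqn_klift v : sqn (klift v) = sqn v.
Proof. by rewrite !sqn_pair; apply: eq_bigr => j _; exact: (Viso (fun n => v (n, j))). Qed.

(** Cauchy-Schwarz over the columns costs one factor [#|E|], the sum over the rows another. *)
Lemma quant_blocks (L : E -> E -> N -> N -> C) (F : X -> E -> E -> C) r :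
  (forall e e', quant1 V (L e e') (fun x => F x e e') r) ->
  quantE (kblock L) F (#|E|%:R ^+ 2 * r).
Proof.
move=> h v; rewrite sqn_pair.
have le e : sqn (fun x => klift (kapp (kblock L) v) (x, e) - symapp F (klift v) (x, e))
    <= #|E|%:R * (r * sqn v).
  pose d e' x := kapp V (kapp (L e e') (fun n => v (n, e'))) x
    - F x e e' * kapp V (fun n => v (n, e')) x.
  rewrite (sqn_ext (w := fun x => \sum_e' d e' x)); last first.
    move=> x; rewrite /d sumrB; congr (_ - _).
    rewrite /klift /= {1}/kapp; transitivity (\sum_n \sum_e' V x n * kapp (L e e') (fun n => v (n, e')) n).
      apply: eq_bigr => n _; rewrite -mulr_sumr; congr (_ * _).
      by rewrite /kapp exchange_big pair_bigA /=; apply: eq_bigr => -[m e'] _.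
    by rewrite exchange_big.
  rewrite /sqn; apply: le_trans (ler_sum _ (fun x _ => sqr_sum_le (fun e' => d e' x))) _.
  rewrite -mulr_sumr; apply: ler_wpM2l; first exact: ler0n.
  rewrite exchange_big /= -/(sqn v) sqn_pair mulr_sumr; apply: ler_sum => e' _.
  exact: h.
apply: le_trans (ler_sum _ (fun e _ => le e)) _.
by rewrite sumr_const expr2 -!mulrA [X in _ <= X]mulr_natl.
Qed.

Lemma quantE_le L F r r' : r <= r' -> quantE L F r -> quantE L F r'.
Proof. by move=> le h v; apply: le_trans (h v) _; rewrite ler_wpM2r // sqn_ge0. Qed.

(* A lower bound on the symbol, pointwise in [x], passes to the operator because
   [V] is isometric and intertwines the two up to [r]. *)
Lemma quantE_gap L0 L1 F0 F1 r a u : quantE L0 F0 r -> quantE L1 F1 r ->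
  0 <= u <= 1 -> 0 < a -> 0 <= r <= a ^+ 2 / 4 ->
  (forall x w, 4 * a ^+ 2 * sqn w <=
     sqn (fun e => (1 - u) * kapp (F0 x) w e + u * kapp (F1 x) w e)) ->
  forall v, a ^+ 2 * sqn v <= sqn (fun t => (1 - u) * kapp L0 v t + u * kapp L1 v t).
Proof.
move=> h0 h1 /andP[u0 u1] a0 /andP[r0 ra] gap v.
set w := fun t => _.
pose d0 p := klift (kapp L0 v) p - symapp F0 (klift v) p.
pose d1 p := klift (kapp L1 v) p - symapp F1 (klift v) p.
pose sy p := (1 - u) * symapp F0 (klift v) p + u * symapp F1 (klift v) p.
have le1 : 4 * a ^+ 2 * sqn v <= sqn sy.
  rewrite -sqn_klift !sqn_pair_l mulr_sumr; apply: ler_sum => x _.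
  exact: gap.
have syE p : sy p = klift w p + ((- (1 - u)) * d0 p + (- u) * d1 p).
  rewrite /sy /d0 /d1 /klift.
  have -> : kapp V (fun n => w (n, p.2)) p.1 = (1 - u) * kapp V (fun n => kapp L0 v (n, p.2)) p.1
      + u * kapp V (fun n => kapp L1 v (n, p.2)) p.1.
    by rewrite -!kappZ -kappD.
  by ring.
have sq1 (x : C) : 0 <= x <= 1 -> `|- x| ^+ 2 <= 1.
  by move=> /andP[x0 x1]; rewrite normrN ger0_norm // exprn_ile1.
have le2 : sqn (fun p => (- (1 - u)) * d0 p + (- u) * d1 p) <= 4 * r * sqn v.
  apply: le_trans (sqn_add_le _ _) _; rewrite !sqnZ.
  have -> : 4 * r * sqn v = 2 * (1 * (r * sqn v)) + 2 * (1 * (r * sqn v)) by ring.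
  apply: lerD; apply: ler_wpM2l; rewrite ?ler0n //; apply: ler_pM;
    rewrite ?exprn_ge0 ?sqn_ge0 //; try exact: h0; try exact: h1; apply: sq1.
    by rewrite subr_ge0 u1 /= lerBlDr lerDl.
  by rewrite u0.
have := le_trans le1 (le_trans (eq_ind _ (fun x => x <= _) (sqn_add_le _ _) _ (sqn_ext (fun p => esym (syE p)))) (lexx _)).
rewrite sqn_klift => /le_trans /(_ (lerD (lexx _) (ler_wpM2l (ler0n _ 2) le2))) le3.
rewrite -(ler_pM2l (ltr0Sn C 1)) -(lerD2r (2 * (4 * r * sqn v))); apply: le_trans le3.
have -> : 4 * a ^+ 2 * sqn v = 2 * (a ^+ 2 * sqn v) + 2 * (a ^+ 2 * sqn v) by ring.
rewrite lerD2l ler_pM2l //; apply: ler_wpM2r; first exact: sqn_ge0.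
by rewrite mulrC -ler_pdivlMr.
Qed.

(** The sign [sg] will be an involution commuting with both operators. Having modulus 1 it preserves
    norms, so the gap of the segment from [L0] to [L1] is also that of the twisted segment. *)
Lemma quantE_inertia L0 L1 F0 F1 r a (sg : N * E -> C) p q :
  (forall x : C, x \is Num.real -> exists n : nat, x <= n%:R) ->
  quantE L0 F0 r -> quantE L1 F1 r -> 0 < a -> 0 <= r <= a ^+ 2 / 4 ->
  (forall u x w, 0 <= u <= 1 -> 4 * a ^+ 2 * sqn w <=
     sqn (fun e => (1 - u) * kapp (F0 x) w e + u * kapp (F1 x) w e)) ->
  (forall s, `|sg s| = 1) ->
  herm (fun s t => sg s * L0 s t) -> herm (fun s t => sg s * L1 s t) ->
  inertia (fun s t => sg s * L0 s t) p q -> inertia (fun s t => sg s * L1 s t) p q.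
Proof.
move=> arch h0 h1 a0 ra gap sg1 k0 k1; apply: (inertia_segment arch k0 k1 a0).
move=> u v u01; apply: le_trans (quantE_gap h0 h1 u01 a0 ra (fun x w => gap u x w u01) v) _.
rewrite le_eqVlt; apply/orP; left; apply/eqP; apply: eq_bigr => s _.
have sgE (L : N * E -> N * E -> C) : kapp (fun s t => sg s * L s t) v s = sg s * kapp L v s.
  by rewrite /kapp mulr_sumr; apply: eq_bigr => t _; rewrite mulrA.
by rewrite !sgE !mulrA ![_ * sg s]mulrC -!mulrA -mulrDr normrM sg1 mul1r.
Qed.

End Blocks.

End Quantization.

(** * Polynomial approximation on a cube *)

(* Unevaluated polynomials: the variables are replaced first by reals, later by
   operators that do not commute. *)
Inductive pexp (R J : Type) : Type :=
| PC of R
| PX of J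
| PA of pexp R J & pexp R J
| PM of pexp R J & pexp R J.
Arguments PC {R J} _.
Arguments PX {R J} _.

Section PexpEval.
Variables (R : realType) (J : finType).

Fixpoint peval (w : J -> R) (e : pexp R J) : R :=
  match e with
  | PC c => c
  | PX j => w j
  | PA e1 e2 => peval w e1 + peval w e2
  | PM e1 e2 => peval w e1 * peval w e2
  end.

Fixpoint pneg (e : pexp R J) : pexp R J :=
  match e with
  | PC c => PC c
  | PX j => PM (PC (-1)) (PX j)
  | PA e1 e2 => PA (pneg e1) (pneg e2)
  | PM e1 e2 => PM (pneg e1) (pneg e2)
  end.

(** The projection onto polynomials of parity [b], performed on expressions so that it keeps its
    meaning for arguments that do not commute. *)
Definition psym (b : bool) (e : pexp R J) : pexp R J :=
  PM (PC 2^-1) (PA e (PM (PC ((-1) ^+ b)) (pneg e))).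

Lemma peval_pneg w e : peval w (pneg e) = peval (fun j => - w j) e.
Proof. by elim: e => //= [j|e1 -> e2 ->|e1 -> e2 ->] //; rewrite mulN1r. Qed.

Definition psum : seq (pexp R J) -> pexp R J := foldr (@PA R J) (PC 0).
Definition pprod : seq (pexp R J) -> pexp R J := foldr (@PM R J) (PC 1).

Lemma peval_psum w s : peval w (psum s) = \sum_(e <- s) peval w e.
Proof. by elim: s => [|e s IH]; rewrite ?big_nil ?big_cons //= IH. Qed.

Lemma peval_pprod w s : peval w (pprod s) = \prod_(e <- s) peval w e.
Proof. by elim: s => [|e s IH]; rewrite ?big_nil ?big_cons //= IH. Qed.

Definition incube (u : J -> R) : Prop := forall j, `|u j| <= 1.

(* The Bernstein polynomials of [g], written as expectations of
   [g] over the means of [M] independent signs of expectation [u j]. *)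
Section Bernstein.
Variable M : nat.
Hypothesis M0 : (0 < M)%N.
Local Notation omega := {ffun J * 'I_M -> bool}.
Definition rsign (b : bool) : R := if b then 1 else -1.
Definition bweight (u : J -> R) (s : omega) : R :=
  \prod_a ((1 + rsign (s a) * u a.1) / 2).
Definition bmean (s : omega) (j : J) : R := M%:R^-1 * \sum_i rsign (s (j, i)).
Definition bernstein (g : (J -> R) -> R) : pexp R J :=
  psum [seq PM (PC (g (bmean s)))
    (pprod [seq PM (PC 2^-1) (PA (PC 1) (PM (PC (rsign (s a))) (PX a.1)))
           | a <- enum {: J * 'I_M}]) | s <- enum {: omega}].

Lemma peval_bernstein g u :
  peval u (bernstein g) = \sum_s bweight u s * g (bmean s).
Proof.
rewrite /bernstein peval_psum big_map big_enum; apply: eq_bigr => s _ /=.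
rewrite peval_pprod big_map big_enum mulrC; congr (_ * _).
by apply: eq_bigr => a _ /=; rewrite mulrC.
Qed.

(** Independence of the signs, which here is the distributive law. *)
Lemma bweight_expect (u : J -> R) (h : J * 'I_M -> bool -> R) :
  \sum_s bweight u s * \prod_a h a (s a) =
  \prod_a \sum_(b : bool) ((1 + rsign b * u a.1) / 2) * h a b.
Proof.
rewrite bigA_distr_bigA; apply: eq_bigr => s _.
by rewrite -big_split.
Qed.

Lemma prod_at (K : finType) (a : K) (x : K -> R) :
  \prod_c (if c == a then x c else 1) = x a.
Proof. by rewrite -big_mkcond big_pred1_eq. Qed.

Lemma bweight_sum u : \sum_s bweight u s = 1.
Proof.
have := bweight_expect u (fun _ _ => 1).
rewrite (eq_bigr (bweight u)) => [->|s _]; last by rewrite big1_eq mulr1.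
 rewrite big1 // => a _; rewrite big_bool /=.
by field.
Qed.

Lemma bweight_cov u a a' :
  \sum_s bweight u s * ((rsign (s a) - u a.1) * (rsign (s a') - u a'.1)) =
  if a == a' then 1 - u a.1 ^+ 2 else 0.
Proof.
pose h c b : R := (if c == a then rsign b - u c.1 else 1) *
                  (if c == a' then rsign b - u c.1 else 1).
transitivity (\prod_c \sum_(b : bool) ((1 + rsign b * u c.1) / 2) * h c b).
  rewrite -bweight_expect; apply: eq_bigr => s _; congr (_ * _).
  by rewrite /h big_split /= !prod_at.
rewrite (bigD1 a) //= big_bool /= /h eqxx.
have [<-|n] := eqVneq a a'; last by rewrite /=; ring.
rewrite big1 ?mulr1 /=; first by field.
by move=> c /negbTE n; rewrite big_bool /= n /=; field.
Qed.

Lemma bweight_var u j : \sum_s bweight u s * (bmean s j - u j) ^+ 2 =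
  M%:R^-1 * (1 - u j ^+ 2).
Proof.
have Mn : M%:R != 0 :> R by rewrite pnatr_eq0 -lt0n.
have E s : (bmean s j - u j) ^+ 2 = M%:R^-1 ^+ 2 *
   \sum_i \sum_i' (rsign (s (j, i)) - u j) * (rsign (s (j, i')) - u j).
  have -> : bmean s j - u j = M%:R^-1 * \sum_i (rsign (s (j, i)) - u j).
    rewrite sumrB sumr_const card_ord mulrBr /bmean; congr (_ - _).
    by rewrite -[u j *+ M]mulr_natl mulKf.
  rewrite exprMn [X in _ * X = _]expr2 mulr_suml; congr (_ * _).
  by apply: eq_bigr => i _; rewrite mulr_sumr.
under eq_bigr do rewrite E mulrCA mulr_sumr.
rewrite -mulr_sumr exchange_big /=.
have -> : \sum_i \sum_s bweight u s * (\sum_i' (rsign (s (j, i)) - u j) * (rsign (s (j, i')) - u j))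
   = \sum_(i < M) (1 - u j ^+ 2).
  apply: eq_bigr => i _; under eq_bigr do rewrite mulr_sumr.
  rewrite exchange_big /= (bigD1 i) //= (bweight_cov u (j, i) (j, i)) eqxx.
  rewrite big1 ?addr0 // => i' n; rewrite (bweight_cov u (j, i) (j, i')).
  by rewrite xpair_eqE eqxx eq_sym (negbTE n).
by rewrite sumr_const card_ord -[(1 - u j ^+ 2) *+ M]mulr_natl expr2 -mulrA mulKf.
Qed.

Lemma bmean_cube s : incube (bmean s).
Proof.
move=> j; have Mp : 0 < M%:R :> R by rewrite ltr0n.
rewrite /bmean normrM ger0_norm ?invr_ge0 ?(ltW Mp) // mulrC ler_pdivrMr // mul1r.
apply: le_trans (ler_norm_sum _ _ _) _.
rewrite -[X in X%:R]card_ord -sumr_const; apply: ler_sum => i _.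
by rewrite /rsign; case: ifP; rewrite ?normrN normr1.
Qed.

Lemma bweight_ge0 u s : incube u -> 0 <= bweight u s.
Proof.
move=> hu; apply: prodr_ge0 => -[j i] _ /=; have := hu j.
by rewrite ler_norml => /andP[h1 h2]; rewrite /rsign; case: ifP => _; lra.
Qed.

(** Chebyshev's argument: means within [d] of [u] contribute at most [eps]. For the others 1 is
    bounded by the sum over [j] of [(bmean s j - u j)^2 / d^2], and each squared deviation has
    expectation at most [1 / M]. *)
Lemma bernstein_bound g u G d eps : incube u -> 0 < d -> 0 <= eps ->
  (forall v, incube v -> `|g v| <= G) ->
  (forall v, incube v -> (forall j, `|v j - u j| < d) -> `|g v - g u| <= eps) ->
  `|peval u (bernstein g) - g u| <= eps + 2 * G / d ^+ 2 * #|J|%:R / M%:R.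
Proof.
move=> hu d0 e0 hG hd; rewrite peval_bernstein.
have G0 : 0 <= G by apply: le_trans (hG u hu).
have -> : \sum_s bweight u s * g (bmean s) - g u =
    \sum_s bweight u s * (g (bmean s) - g u).
  under [in RHS]eq_bigr do rewrite mulrBr.
  by rewrite sumrB -mulr_suml bweight_sum mul1r.
apply: le_trans (ler_norm_sum _ _ _) _.
have c0 : 0 <= 2 * G / d ^+ 2 by apply: divr_ge0; [exact: mulr_ge0 | exact: sqr_ge0].
apply: (@le_trans _ _ (\sum_s bweight u s *
    (eps + 2 * G / d ^+ 2 * \sum_j (bmean s j - u j) ^+ 2))).
  apply: ler_sum => s _; rewrite normrM ger0_norm ?bweight_ge0 //.
  apply: ler_wpM2l; first exact: bweight_ge0.
  have S0 j : 0 <= (bmean s j - u j) ^+ 2 by exact: sqr_ge0.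
  have [/forallP near|] := boolP [forall j, `|bmean s j - u j| < d].
    apply: le_trans (hd _ (bmean_cube s) near) _; rewrite lerDl mulr_ge0 //.
    by apply: sumr_ge0 => j _.
  rewrite negb_forall => /existsP[j]; rewrite -leNgt => far.
  apply: le_trans (ler_normB _ _) _.
  apply: le_trans (lerD (hG _ (bmean_cube s)) (hG u hu)) _.
  apply: (@le_trans _ _ (2 * G / d ^+ 2 * d ^+ 2)).
    by rewrite divfK ?gt_eqF ?exprn_gt0 // mulr_natl mulr2n.
  rewrite -[X in X <= _]add0r; apply: lerD => //; apply: ler_wpM2l => //.
  apply: (@le_trans _ _ ((bmean s j - u j) ^+ 2)).
    by rewrite -[X in _ <= X]real_normK ?num_real // ler_pXn2r ?nnegrE ?normr_ge0 ?(ltW d0).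
  by rewrite (bigD1 j) //= lerDl sumr_ge0.
under eq_bigr do rewrite mulrDr.
rewrite big_split /= -mulr_suml bweight_sum mul1r lerD2l.
under eq_bigr do rewrite mulrCA mulr_sumr.
rewrite -mulr_sumr exchange_big /= -[X in _ <= X]mulrA; apply: ler_wpM2l => //.
rewrite -[#|J|%:R]sumr_const mulr_suml; apply: ler_sum => j _.
rewrite bweight_var mul1r ler_piMr ?invr_ge0 // lerBlDr lerDl.
exact: sqr_ge0.
Qed.
End Bernstein.

Theorem weierstrass (g : (J -> R) -> R) G :
  (forall v, incube v -> `|g v| <= G) ->
  (forall eps, 0 < eps -> exists2 d, 0 < d & forall u v, incube u -> incube v ->
     (forall j, `|v j - u j| < d) -> `|g v - g u| <= eps) ->
  forall eps, 0 < eps -> exists e : pexp R J,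
    forall u, incube u -> `|peval u e - g u| <= eps.
Proof.
move=> hG hc eps e0; have e2 : 0 < eps / 2 by rewrite divr_gt0.
have [d d0 hd] := hc _ e2.
pose A := 2 * G / d ^+ 2 * #|J|%:R.
pose M := (Num.truncn (A / (eps / 2))).+1.
exists (bernstein M g) => u hu.
apply: le_trans (bernstein_bound (isT : 0 < M)%N hu d0 (ltW e2) hG _) _.
  by move=> v hv; exact: hd.
rewrite -/A [X in _ <= X](splitr eps) lerD2l ler_pdivrMr ?ltr0n //.
rewrite mulrC -ler_pdivrMr //; apply: ltW; exact: truncnS_gt.
Qed.

End PexpEval.

(** * Polynomials in operators *)

Section OperatorPolynomials.
Variables (C : numClosedFieldType) (R : realType) (iota : {rmorphism R -> C}).
Hypothesis iotaC : forall c, (iota c)^* = iota c.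
Variable J : finType.

Fixpoint kev (N : finType) (X : J -> N -> N -> C) (e : pexp R J) : N -> N -> C :=
  match e with
  | PC c => fun s t => iota c * (s == t)%:R
  | PX j => X j
  | PA e1 e2 => fun s t => kev X e1 s t + kev X e2 s t
  | PM e1 e2 => kmul (kev X e1) (kev X e2)
  end.

Section Parity.
Variables (N : finType) (X : J -> N -> N -> C) (sg : N -> C).
Hypothesis sg2 : forall n, sg n * sg n = 1.
Hypothesis sgX : forall j s t, sg s * X j s t * sg t = - X j s t.

Lemma kev_PC_mul c (T : N -> N -> C) s t :
  kmul (fun s t => iota c * (s == t)%:R) T s t = iota c * T s t.
Proof.
rewrite /kmul (bigD1 s) //= eqxx mulr1 big1 ?addr0 //.
by move=> u /negbTE n; rewrite eq_sym n mulr0 mul0r.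
Qed.

(** Conjugation by [sg] is multiplicative and negates every generator. It therefore realizes the
    substitution of [- X] for [X], whether or not the generators commute. *)
Lemma kev_pneg e s t : kev X (pneg e) s t = sg s * kev X e s t * sg t.
Proof.
elim: e s t => [c|j|e1 IH1 e2 IH2|e1 IH1 e2 IH2] s t /=.
- by case: eqVneq => [->|_]; rewrite ?mulr0 ?mul0r // mulr1 mulrAC sg2 mul1r.
- by rewrite kev_PC_mul rmorphN1 mulN1r sgX.
- by rewrite IH1 IH2 mulrDr mulrDl.
- rewrite /kmul mulr_sumr mulr_suml; apply: eq_bigr => u _.
  rewrite IH1 IH2; transitivity (sg s * (kev X e1 s u * kev X e2 u t) * sg t * (sg u * sg u)).
    by ring.
  by rewrite sg2 mulr1.
Qed.

Lemma kev_psym b e s t :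
  sg s * kev X (psym b e) s t * sg t = (-1) ^+ b * kev X (psym b e) s t.
Proof.
rewrite /psym /= !kev_PC_mul /= kev_pneg !rmorphXn rmorphN1.
set k := kev X e s t; set z := iota _; have e1 : sg s * sg s * (sg t * sg t) = 1.
  by rewrite !sg2 mulr1.
case: b; rewrite ?expr1 ?expr0.
  transitivity (z * (sg s * k * sg t + -1 * (sg s * sg s * (sg t * sg t)) * k)); first by ring.
  by rewrite e1; ring.
transitivity (z * (sg s * k * sg t + (sg s * sg s * (sg t * sg t)) * k)); first by ring.
by rewrite e1; ring.
Qed.
End Parity.

Lemma iota_real x : iota x \is Num.real.
Proof. exact/CrealP/iotaC. Qed.

Lemma iota_ge0 x : 0 <= x -> 0 <= iota x.
Proof.
move=> x0; rewrite -(sqr_sqrtr x0) rmorphXn /=.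
by apply: real_exprn_even_ge0 => //; exact: iota_real.
Qed.

Lemma iota_le x y : x <= y -> iota x <= iota y.
Proof. by move=> h; rewrite -subr_ge0 -rmorphB; apply: iota_ge0; rewrite subr_ge0. Qed.

Lemma iota_lt x y : x < y -> iota x < iota y.
Proof.
move=> h; rewrite lt_def iota_le ?(ltW h) // andbT.
by rewrite (inj_eq (fmorph_inj iota)) gt_eqF.
Qed.

Lemma iota_norm x : `|iota x| = iota `|x|.
Proof.
have [x0|x0] := leP 0 x; first by rewrite (ger0_norm x0) ger0_norm // iota_ge0.
by rewrite (ltr0_norm x0) rmorphN ltr0_norm // -(rmorph0 iota) iota_lt.
Qed.

Lemma peval_bound (e : pexp R J) : exists2 B : C, 0 <= B &
  forall w : J -> R, incube w -> `|iota (peval w e)| ^+ 2 <= B.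
Proof.
elim: e => [c|j|e1 [B1 B10 h1] e2 [B2 B20 h2]|e1 [B1 B10 h1] e2 [B2 B20 h2]].
- by exists (`|iota c| ^+ 2); rewrite ?exprn_ge0.
- exists 1 => // w hw; rewrite /= iota_norm -rmorphXn -(rmorph1 iota).
  by apply: iota_le; rewrite exprn_ile1.
- exists (2 * B1 + 2 * B2); first by rewrite addr_ge0 ?mulr_ge0.
  move=> w hw; rewrite /= rmorphD.
  have := sqn_add_le (fun _ : 'I_1 => iota (peval w e1)) (fun _ : 'I_1 => iota (peval w e2)).
  rewrite /sqn !big_ord1 => /le_trans; apply.
  by apply: lerD; apply: ler_wpM2l; rewrite ?ler0n // ?h1 ?h2.
- exists (B1 * B2); first exact: mulr_ge0.
  move=> w hw; rewrite /= rmorphM normrM exprMn.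
  by apply: ler_pM; rewrite ?exprn_ge0 // ?h1 ?h2.
Qed.

(** The tolerance depends on the expression and on [eps] but not on the model, whose size is chosen
    afterwards. A product of tolerances that are at most 1 plays the part of their minimum. *)
Lemma quant_pexp (e : pexp R J) (eps : C) : 0 < eps ->
  exists2 eps' : C, 0 < eps' <= 1 &
  forall (N X : finType) (V : X -> N -> C) (T : J -> N -> N -> C) (w : X -> J -> R),
    isometry V -> (forall x, incube (w x)) ->
    (forall j, quant V (T j) (fun x => iota (w x j)) eps') ->
    quant V (kev T e) (fun x => iota (peval (w x) e)) eps.
Proof.
elim: e eps => [c|j|e1 IH1 e2 IH2|e1 IH1 e2 IH2] eps e0.
- exists 1; first by rewrite ltr01 lexx.
  move=> N X V T w _ _ _; apply: (@quant_le _ _ _ _ _ _ (`|iota c| ^+ 2 * 0)).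
    by rewrite mulr0 ltW.
  apply: quant_ext (quant_scale (iota c) (quant_id V)) => //= x.
  by rewrite mulr1.
- exists (eps / (1 + eps)).
    have h : 0 < 1 + eps by rewrite addr_gt0.
    by rewrite divr_gt0 //= ler_pdivrMr // mul1r lerDr ler01.
  move=> N X V T w _ _ h; apply: quant_le (h j).
  rewrite ler_pdivrMr ?addr_gt0 // mulrDr mulr1 lerDl.
  by rewrite mulr_ge0 // ltW.
- have e4 : 0 < eps / 4 by rewrite divr_gt0.
  have [d1 /andP[d10 d11] h1] := IH1 _ e4; have [d2 /andP[d20 d21] h2] := IH2 _ e4.
  exists (d1 * d2); first by rewrite mulr_gt0 //= mulr_ile1 // ltW.
  move=> N X V T w Vi hw hT.
  apply: (@quant_le _ _ _ _ _ _ (2 * (eps / 4) + 2 * (eps / 4))).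
    by rewrite le_eqVlt; apply/orP; left; apply/eqP; field.
  have H : quant V (fun s t => kev T e1 s t + kev T e2 s t)
     (fun x => iota (peval (w x) e1) + iota (peval (w x) e2))
     (2 * (eps / 4) + 2 * (eps / 4)).
    apply: quant_add; [apply: h1 => // j|apply: h2 => // j]; apply: quant_le (hT j).
      by rewrite ler_piMr // ltW.
    by rewrite ler_piMl // ltW.
  by apply: quant_ext H => // x; rewrite /= rmorphD.
- have [B1 B10 b1] := peval_bound e1; have [B2 B20 b2] := peval_bound e2.
  pose B := B1 + B2; have B0 : 0 <= B by rewrite addr_ge0.
  (* The summand [eps] gives [d <= 1], which [quant_mul] requires, while still
     [(4 + 6 * B) * d <= eps]. *)
  pose c := 4 + 6 * B + eps; have c0 : 0 < c.
    by rewrite ltr_wpDl // addr_ge0 ?mulr_ge0.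
  pose d := eps / c.
  have d0 : 0 < d by rewrite divr_gt0.
  have d1 : d <= 1.
    by rewrite ler_pdivrMr // mul1r lerDr addr_ge0 ?mulr_ge0.
  have [r1 /andP[r10 r11] h1] := IH1 _ d0; have [r2 /andP[r20 r21] h2] := IH2 _ d0.
  exists (r1 * r2); first by rewrite mulr_gt0 //= mulr_ile1 // ltW.
  move=> N X V T w Vi hw hT.
  have q1 : quant V (kev T e1) (fun x => iota (peval (w x) e1)) d.
    by apply: h1 => // j; apply: quant_le (hT j); rewrite ler_piMr // ltW.
  have q2 : quant V (kev T e2) (fun x => iota (peval (w x) e2)) d.
    by apply: h2 => // j; apply: quant_le (hT j); rewrite ler_piMl // ltW.
  have H : quant V (kmul (kev T e1) (kev T e2))
     (fun x => iota (peval (w x) e1) * iota (peval (w x) e2)) ((4 + 6 * B) * d).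
    apply: quant_mul => //; first by rewrite (ltW d0).
      by move=> x; apply: le_trans (b1 _ (hw x)) _; rewrite lerDl.
    by move=> x; apply: le_trans (b2 _ (hw x)) _; rewrite lerDr.
  apply: quant_ext (quant_le _ H) => //; first by move=> x; rewrite /= rmorphM.
  rewrite /d mulrA ler_pdivrMr // mulrC; apply: ler_wpM2l; first exact: ltW.
  by rewrite lerDl ltW.
Qed.

End OperatorPolynomials.

(** * The short-time Fourier model *)

Section Sites.
Variables (C : numClosedFieldType) (Y Q : finType) (m : nat) (V1 : Y -> Q -> C).

(** The columns of [W] are orthogonal with squared norms [D]. Tensor products keep this form, and
    such an operator is bounded by its longest column. *)
Definition gram (X N : finType) (W : X -> N -> C) (D : N -> C) : Prop :=
  forall n n', \sum_x (W x n)^* * W x n' = (n == n')%:R * D n.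

Lemma gram_sqn (X N : finType) (W : X -> N -> C) (D : N -> C) v :
  gram W D -> sqn (kapp W v) = \sum_n D n * `|v n| ^+ 2.
Proof.
move=> h; rewrite sqnE hip_kadj /hip; apply: eq_bigr => n _.
rewrite -kapp_mul /kapp (bigD1 n) //= [X in _ + X]big1; last first.
  move=> n' /negbTE n'n; rewrite /kmul /kadj.
  by rewrite h eq_sym n'n !mul0r.
rewrite addr0 /kmul /kadj h eqxx mul1r rmorphM /= normCK.
have Dr : (D n)^* = D n.
  have := h n n; rewrite eqxx mul1r => <-; rewrite rmorph_sum.
  by apply: eq_bigr => x _; rewrite rmorphM /= conjCK mulrC.
by rewrite Dr; ring.
Qed.

Local Notation N := {ffun 'I_m -> Q}.
Local Notation X := {ffun 'I_m -> Y}.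

Definition kprod (W : 'I_m -> Y -> Q -> C) : X -> N -> C :=
  fun x n => \prod_i W i (x i) (n i).
Definition ksite (i0 : 'I_m) (k : Q -> Q -> C) : N -> N -> C :=
  fun n n' => \prod_i (if i == i0 then k (n i) (n' i) else (n i == n' i)%:R).

Lemma gram_kprod W D : (forall i, gram (W i) (D i)) ->
  gram (kprod W) (fun n => \prod_i D i (n i)).
Proof.
move=> h n n'; rewrite /kprod.
transitivity (\prod_i \sum_y (W i y (n i))^* * W i y (n' i)).
  rewrite bigA_distr_bigA; apply: eq_bigr => x _.
  by rewrite rmorph_prod -big_split.
under eq_bigr do rewrite h.
rewrite big_split /=; congr (_ * _).
have [->|nn] := eqVneq n n'; first by rewrite big1 // => i _; rewrite eqxx.
have /existsP[i ni] : [exists i, n i != n' i].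
  apply: contraNT nn; rewrite negb_exists => /forallP e.
  by apply/eqP/ffunP => i; have /negPn/eqP := e i.
by rewrite (bigD1 i) //= (negbTE ni) mul0r.
Qed.

Definition kV : X -> N -> C := kprod (fun _ => V1).

Lemma kmul_kV_site i0 k x n :
  kmul kV (ksite i0 k) x n =
  kprod (fun i => if i == i0 then kmul V1 k else V1) x n.
Proof.
rewrite /kprod /kmul /kV.
transitivity (\prod_i \sum_a V1 (x i) a * (if i == i0 then k a (n i) else (a == n i)%:R)).
  rewrite bigA_distr_bigA; apply: eq_bigr => n' _.
  by rewrite /kprod /ksite -big_split.
apply: eq_bigr => i _; case: eqP => [_|_]; first by [].
rewrite (bigD1 (n i)) //= eqxx mulr1 big1 ?addr0 //.
by move=> a /negbTE ->; rewrite mulr0.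
Qed.

Hypothesis gV : gram V1 (fun _ => 1).

Lemma isometry_kV : isometry kV.
Proof.
move=> v; have gk : gram kV (fun n => \prod_(i < m) 1) by exact: (gram_kprod (D := fun _ _ => 1) (fun _ => gV)).
rewrite (gram_sqn _ gk).
by apply: eq_bigr => n _; rewrite big1_eq mul1r.
Qed.

Lemma quant1_site i0 k F D d :
  gram (fun y n => kmul V1 k y n - F y * V1 y n) D ->
  (forall n, D n <= d) ->
  quant1 kV (ksite i0 k) (fun x => F (x i0)) d.
Proof.
move=> gW Dd v.
pose W i := if i == i0 then (fun y n => kmul V1 k y n - F y * V1 y n) else V1.
pose DW i n := if i == i0 then D n else 1.
have gk : gram (kprod W) (fun n => \prod_i DW i (n i)).
  by apply: gram_kprod => i; rewrite /W /DW; case: eqP.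
have WE x n : kprod W x n = kmul kV (ksite i0 k) x n - F (x i0) * kV x n.
  rewrite kmul_kV_site /kV /kprod (bigD1 i0) //= [X in _ = X - _](bigD1 i0) //=.
  rewrite [X in _ = _ - _ * X](bigD1 i0) //= /W eqxx mulrBl mulrA.
  by congr (_ * _ - _ * _); apply: eq_bigr => i /negbTE ->.
rewrite (sqn_ext (w := kapp (kprod W) v)); last first.
  move=> x; rewrite -kapp_mul.
  rewrite [RHS](kapp_ext (l := fun x n => kmul kV (ksite i0 k) x n + (- F (x i0)) * kV x n) (w := v)) //.
    by rewrite kappDl; congr (_ + _); rewrite /kapp -mulNr mulr_sumr;
      apply: eq_bigr => n _; rewrite mulrA.
  by move=> y n; rewrite WE mulNr.
rewrite (gram_sqn _ gk) /sqn mulr_sumr; apply: ler_sum => n _.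
apply: ler_wpM2r; first exact: exprn_ge0.
rewrite (bigD1 i0) //= big1 ?mulr1 /DW ?eqxx ?Dd //.
by move=> i /negbTE ->.
Qed.

Lemma kadj_ksite i0 k n n' : kadj (ksite i0 k) n n' = ksite i0 (kadj k) n n'.
Proof.
rewrite /kadj /ksite rmorph_prod; apply: eq_bigr => i _.
by case: eqP => // _; rewrite rmorph_nat eq_sym.
Qed.

Lemma quant_site i0 k F D D' d :
  gram (fun y n => kmul V1 k y n - F y * V1 y n) D ->
  gram (fun y n => kmul V1 (kadj k) y n - (F y)^* * V1 y n) D' ->
  (forall n, D n <= d) -> (forall n, D' n <= d) ->
  quant kV (ksite i0 k) (fun x => F (x i0)) d.
Proof.
move=> g g' h h'; split; first exact: quant1_site g h.
apply: quant1_ext (quant1_site i0 g' h') => // s t.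
by rewrite kadj_ksite.
Qed.

End Sites.

(** * Weighted shifts in the short-time Fourier frame *)

Section Window.
Variables (C : numClosedFieldType) (R : realType) (iota : {rmorphism R -> C}).
Hypothesis iotaC : forall c, (iota c)^* = iota c.
Variables (q l : nat) (om : C).
Hypotheses (q0 : (0 < q)%N) (l0 : (0 < l)%N) (omP : q.-primitive_root om).
Local Notation Y := ('I_(q + l) * 'I_q)%type.

Definition win (a n : nat) : bool := (n <= a < n + l)%N.
Definition winR (a n : nat) : R := (win a n)%:R / Num.sqrt l%:R.
(* A short-time Fourier transform: with [y = (a, b)] the row of [V1] is the wave
   of frequency [b] cut off to the window [a - l < n <= a].  Over a window the
   weights of [raise1] and [num1] are almost constant, so in this frame the two
   operators are almost multiplications. *)
Definition wavelet (c : 'I_q -> C) (g : nat -> nat -> R) : Y -> 'I_q -> C :=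
  fun y n => c y.2 * iota (g y.1 n) * om ^+ (y.2 * n) / sqrtC q%:R.
Definition lev (a : nat) : R := (minn a q)%:R / q%:R.
(** The weight [x (1 - x)] at [x = i / q] vanishes for [i = 0] and for [i = q], so cutting the shift
    off to [q] levels creates no boundary error. *)
Definition amp (i : nat) : R := i%:R / q%:R * (1 - i%:R / q%:R).
Definition V1 : Y -> 'I_q -> C := wavelet (fun _ => 1) winR.
Definition raise1 : 'I_q -> 'I_q -> C :=
  fun i j => iota (amp i) * (i == j.+1 :> nat)%:R.
Definition num1 : 'I_q -> 'I_q -> C := fun i j => iota (i%:R / q%:R) * (i == j)%:R.

Lemma om_norm : `|om| = 1.
Proof.
have := prim_expr_order omP => /(congr1 Num.norm); rewrite normrX normr1 => /eqP.
by rewrite pexpr_eq1 // => /eqP.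
Qed.

Lemma omX_norm k : `|om ^+ k| = 1.
Proof. by rewrite normrX om_norm expr1n. Qed.

Lemma omX_conj k : (om ^+ k)^* * om ^+ k = 1.
Proof. by rewrite mulrC -normCK omX_norm expr1n. Qed.

Lemma om_sum (n n' : 'I_q) :
  \sum_(b < q) (om ^+ (b * n))^* * om ^+ (b * n') = (n == n')%:R * q%:R.
Proof.
have [<-|nn] := eqVneq n n'.
  by under eq_bigr do rewrite omX_conj; rewrite sumr_const card_ord mul1r.
rewrite mul0r.
pose z := (om ^+ n)^* * om ^+ n'.
have zE b : (om ^+ (b * n))^* * om ^+ (b * n') = z ^+ b.
  by rewrite /z exprMn -rmorphXn -!exprM ![(_ * b)%N]mulnC.
under eq_bigr do rewrite zE.
have z1 : z - 1 != 0.
  rewrite subr_eq0; apply: contra nn => /eqP /(congr1 ( *%R (om ^+ n))).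
  rewrite /z mulrA [_ * (_ ^*)]mulrC omX_conj mul1r mulr1 => /eqP.
  by rewrite (eq_prim_root_expr omP) /= !modn_small // eq_sym.
apply: (mulfI z1); rewrite -subrX1 mulr0; apply/eqP; rewrite subr_eq0; apply/eqP.
by rewrite /z exprMn -rmorphXn -!exprM ![(_ * q)%N]mulnC !exprM
  (prim_expr_order omP) !expr1n rmorph1 mulr1.
Qed.

(** The sum over the frequency is the orthogonality of characters and kills the terms with
    [n != n'], whatever the envelope [g]. *)
Lemma gram_wavelet c g : (forall b, `|c b| = 1) ->
  gram (wavelet c g) (fun n => iota (\sum_(a < q + l) g a n ^+ 2)).
Proof.
move=> c1 n n'.
have q0' : (sqrtC (q%:R : C)) != 0 by rewrite sqrtC_eq0 pnatr_eq0 -lt0n.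
have sqc : (sqrtC (q%:R : C))^* = sqrtC q%:R.
  by apply/CrealP; rewrite ger0_real // sqrtC_ge0 ler0n.
transitivity (\sum_(a < q + l) iota (g a n * g a n') * (q%:R^-1 *
   \sum_(b < q) (om ^+ (b * n))^* * om ^+ (b * n'))).
  under [in RHS]eq_bigr do rewrite mulrA mulr_sumr; rewrite pair_bigA /=.
  apply: eq_bigr => -[a b] _ /=; rewrite /wavelet /= !rmorphM /= fmorphV /= iotaC sqc.
  have -> : (q%:R : C)^-1 = (sqrtC q%:R)^-1 * (sqrtC q%:R)^-1.
    by rewrite -invfM -expr2 sqrtCK.
  transitivity (((c b)^* * c b) * (iota (g a n) * iota (g a n') * ((sqrtC q%:R)^-1 * (sqrtC q%:R)^-1) *
    ((om ^+ (b * n))^* * om ^+ (b * n')))); first by ring.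
  by rewrite [X in X * _ = _]mulrC -normCK c1 expr1n mul1r.
rewrite om_sum; have [->|_] := eqVneq n n'; last first.
  by rewrite mul0r mulr0 mul0r big1 // => a _; rewrite mulr0.
rewrite mul1r mulVf ?pnatr_eq0 -?lt0n // mul1r rmorph_sum; apply: eq_bigr => a _.
by rewrite mulr1 expr2.
Qed.

(** Letting [a] run up to [q + l] gives every position its full [l] windows, even at the right
    end. *)
Lemma win_count n : (n <= q)%N -> (\sum_(a < q + l) win a n = l)%N.
Proof.
move=> nq; rewrite -(big_mkord xpredT (fun a => win a n : nat)).
rewrite (big_cat_nat (n := n)) ?leq0n //=; last by rewrite (leq_trans nq) ?leq_addr.
rewrite big_nat_cond big1 ?add0n; last first.
  by move=> a /andP[/andP[_ h] _]; rewrite /win leqNgt h.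
rewrite (big_cat_nat (n := n + l)) ?leq_addr ?leq_add2r //=.
rewrite [X in (_ + X)%N]big_nat_cond [X in (_ + X)%N]big1 ?addn0; last first.
  by move=> a /andP[/andP[h _] _]; rewrite /win [(a < _)%N]ltnNge h andbF.
rewrite big_nat (eq_bigr (fun=> 1%N)); last by move=> a h; rewrite /win h.
by rewrite -big_nat sum_nat_const_nat muln1 addnC addnK.
Qed.

Lemma winR_sqr a n : winR a n ^+ 2 = (win a n)%:R / l%:R.
Proof.
rewrite /winR exprMn exprVn sqr_sqrtr ?ler0n //.
by case: (win a n); rewrite ?expr1n ?expr0n.
Qed.

Lemma gram_V1 : gram V1 (fun _ => 1).
Proof.
have := @gram_wavelet (fun _ => 1) winR (fun _ => normr1 _).
move=> h n n'; rewrite h; congr (_ * _).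
under eq_bigr do rewrite winR_sqr.
rewrite -mulr_suml -natr_sum win_count ?(ltnW (ltn_ord n)) //.
by rewrite divff ?rmorph1 // pnatr_eq0 -lt0n.
Qed.

Lemma frac01 i : (i <= q)%N -> 0 <= (i%:R : R) / q%:R <= (1 : R).
Proof.
move=> iq; have q0' : 0 < q%:R :> R by rewrite ltr0n.
by rewrite divr_ge0 ?ler0n //= ler_pdivrMr // mul1r ler_nat.
Qed.

Lemma amp01 i : (i <= q)%N -> 0 <= amp i <= 1.
Proof. by move=> /frac01; rewrite /amp; move: (_ / _) => x /andP[x0 x1]; nra. Qed.

Lemma amp_lip i j : (i <= q)%N -> (j <= q)%N ->
  (amp i - amp j) ^+ 2 <= (i%:R / q%:R - j%:R / q%:R) ^+ 2.
Proof.
move=> /frac01 + /frac01; rewrite /amp.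
move: (i%:R / _) (j%:R / _) => x y /andP[x0 x1] /andP[y0 y1].
have -> : x * (1 - x) - y * (1 - y) = (x - y) * (1 - x - y) by ring.
rewrite exprMn ler_piMr ?sqr_ge0 //; nra.
Qed.

Lemma frac_dist i j k : (i <= j + k)%N -> (j <= i + k)%N ->
  (i%:R / q%:R - j%:R / q%:R) ^+ 2 <= (k%:R / q%:R) ^+ 2 :> R.
Proof.
move=> h1 h2; rewrite -mulrBl !exprMn ler_wpM2r ?sqr_ge0 //.
have : (i%:R <= j%:R + k%:R :> R) by rewrite -natrD ler_nat.
have : (j%:R <= i%:R + k%:R :> R) by rewrite -natrD ler_nat.
by move: (i%:R) (j%:R) (k%:R) => x y z; nra.
Qed.

Definition werr : R := (l%:R / q%:R) ^+ 2 + 2 / l%:R.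

Lemma sum_delta c : \sum_(a < q + l) ((a : nat) == c)%:R <= 1 :> R.
Proof.
have [lt|ge] := ltnP c (q + l); last first.
  rewrite big1 ?ler01 // => a _; case: eqP => // e.
  by have := ltn_ord a; rewrite e ltnNge ge.
rewrite (bigD1 (Ordinal lt)) //= eqxx big1 ?addr0 // => a /negbTE.
by rewrite -val_eqE /= => ->.
Qed.

(** For neighbouring [i] and [j] the windows differ at [a = c] and [a = c + l] only, each at a cost
    of at most [1 / l]. In the windows containing both, the weight varies by at most [l / q] by
    [amp_lip]. These are the two terms of [werr]. *)
Lemma win_err i j k : (i <= j.+1)%N -> (j <= i.+1)%N -> (j <= q)%N -> (k <= q)%N ->
  (forall a, win a i -> win a j -> (k <= a + l)%N /\ (minn a q <= k + l)%N) ->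
  \sum_(a < q + l) (winR a i * amp k - amp (minn a q) * winR a j) ^+ 2 <= werr.
Proof.
move=> ij ji jq kq h.
have l0' : 0 < l%:R :> R by rewrite ltr0n.
pose c := minn i j.
have le (a : nat) : (winR a i * amp k - amp (minn a q) * winR a j) ^+ 2 <=
   (win a j)%:R * ((l%:R / q%:R) ^+ 2 / l%:R) + ((a == c)%:R + (a == c + l)%N%:R) / l%:R.
  have aq : (minn a q <= q)%N by rewrite geq_minr.
  have E (b : bool) : (b%:R / Num.sqrt l%:R) ^+ 2 = b%:R / l%:R :> R.
    rewrite exprMn exprVn sqr_sqrtr ?ler0n //.
    by case: b; rewrite ?expr1n ?expr0n.
  have [wi|wi] := boolP (win a i); have [wj|wj] := boolP (win a j).
  - rewrite /winR wi wj [_ * amp k]mulrC -mulrBl exprMn E !mul1r -mulrDl.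
    apply: ler_wpM2r; first by rewrite invr_ge0 ltW.
    have [h1 h2] := h a wi wj.
    apply: le_trans (amp_lip kq aq) _; apply: (le_trans (@frac_dist _ _ l _ h2)).
      by rewrite addn_minl leq_min h1 (leq_trans kq) ?leq_addr.
    by rewrite lerDl addr_ge0.
  - rewrite /winR wi (negbTE wj) mul0r mulr0 subr0 mul0r add0r exprMn E mul1r.
    have /andP[k0 k1] := amp01 kq.
    have e : (a == c) || (a == c + l)%N.
      move: wi wj; rewrite /win /c; case: (leqP i j) => ?; lia.
    apply: (@le_trans _ _ (1 / l%:R)).
      by rewrite mulrC mul1r ler_piMl ?invr_ge0 ?(ltW l0') // expr_le1.
    apply: ler_wpM2r; first by rewrite invr_ge0 ltW.
    by case/orP: e => ->; rewrite ?lerDl ?lerDr.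
  - rewrite /winR wj (negbTE wi) mul0r mul0r sub0r sqrrN exprMn E !mul1r.
    have /andP[k0 k1] := amp01 aq.
    have e : (a == c) || (a == c + l)%N.
      move: wi wj; rewrite /win /c; case: (leqP i j) => ?; lia.
    apply: (@le_trans _ _ (1 / l%:R)).
      by rewrite mul1r ler_piMl ?invr_ge0 ?(ltW l0') // expr_le1.
    rewrite -[X in X <= _]add0r; apply: lerD.
      by apply: divr_ge0; [exact: sqr_ge0 | exact: ltW].
    apply: ler_wpM2r; first by rewrite invr_ge0 ltW.
    by case/orP: e => ->; rewrite ?lerDl ?lerDr.
  - rewrite /winR (negbTE wi) (negbTE wj) !mul0r mulr0 subrr expr0n /= add0r.
    by rewrite divr_ge0 ?addr_ge0 // ltW.
apply: le_trans (ler_sum _ (fun (a : 'I_(q + l)) _ => le a)) _.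
rewrite big_split /= -!mulr_suml -natr_sum win_count // big_split /= /werr.
apply: lerD; first by rewrite mulrCA divff ?mulr1 // gt_eqF.
apply: ler_wpM2r; first by rewrite invr_ge0 ltW.
by rewrite (natrD _ 1 1); apply: lerD; exact: sum_delta.
Qed.

Definition zsym (y : Y) : C := iota (amp (minn y.1 q)) * om ^+ y.2.

(** A shift by one multiplies the wave of frequency [b] by [om ^+ b], so the error is again a
    wavelet and [gram_wavelet] applies. For [n + 1 = q] the missing term is consistent with
    [amp q = 0]. *)
Lemma raise_err y n : kmul V1 raise1 y n - zsym y * V1 y n =
  wavelet (fun b => om ^+ b)
    (fun a n => winR a n.+1 * amp n.+1 - amp (minn a q) * winR a n) y n.
Proof.
have -> : kmul V1 raise1 y n =
    om ^+ y.2 * iota (winR y.1 n.+1 * amp n.+1) * om ^+ (y.2 * n) / sqrtC q%:R.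
  have [lt|ge] := ltnP n.+1 q.
    rewrite /kmul (bigD1 (Ordinal lt)) //= big1 ?addr0; last first.
      by move=> i; rewrite -val_eqE /= /raise1 => /negbTE ->; rewrite !mulr0.
    rewrite /V1 /wavelet /raise1 /= eqxx mulr1 mul1r mulnS exprD rmorphM; ring.
  rewrite /kmul big1; last first.
    move=> i _; rewrite /raise1; case: eqP => e; last by rewrite !mulr0.
    by have := ltn_ord i; rewrite e ltnNge ge.
  have -> : amp n.+1 = 0.
    have -> : n.+1 = q by apply/eqP; rewrite eqn_leq ge ltn_ord.
    by rewrite /amp divff ?subrr ?mulr0 // pnatr_eq0 -lt0n.
  by rewrite mulr0 rmorph0 mulr0 !mul0r.
rewrite /zsym /V1 /wavelet rmorphB !rmorphM /= mul1r; ring.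
Qed.

Lemma lower_err y n : kmul V1 (kadj raise1) y n - (zsym y)^* * V1 y n =
  wavelet (fun b => (om ^+ b)^*)
    (fun a n => winR a n.-1 * amp n - amp (minn a q) * winR a n) y n.
Proof.
have -> : kmul V1 (kadj raise1) y n =
    (om ^+ y.2)^* * iota (winR y.1 n.-1 * amp n) * om ^+ (y.2 * n) / sqrtC q%:R.
  case: n => -[|n] lt /=.
    rewrite /kmul big1; last by move=> i _; rewrite /kadj /raise1 mulr0 conjC0 mulr0.
    by rewrite /amp mul0r mul0r mulr0 rmorph0 mulr0 !mul0r.
  rewrite /kmul (bigD1 (Ordinal (ltnW lt))) //= big1 ?addr0; last first.
    move=> i; rewrite -val_eqE /= /kadj /raise1 /= eqSS eq_sym => /negbTE ->.
    by rewrite mulr0 conjC0 mulr0.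
  rewrite /V1 /wavelet /kadj /raise1 /= eqxx mulr1 mul1r mulnS exprD rmorphM iotaC.
  rewrite -[LHS]mul1r -(omX_conj y.2); ring.
rewrite /zsym /V1 /wavelet rmorphB !rmorphM /= !iotaC mul1r; ring.
Qed.

Lemma num_err y n : kmul V1 num1 y n - iota (lev y.1) * V1 y n =
  wavelet (fun b => 1)
    (fun a n => winR a n * (n%:R / q%:R - lev a)) y n.
Proof.
have -> : kmul V1 num1 y n = V1 y n * iota (n%:R / q%:R).
  rewrite /kmul (bigD1 n) //= big1 ?addr0; last first.
    by move=> i /negbTE h; rewrite /num1 h !mulr0.
  by rewrite /num1 eqxx mulr1.
rewrite /V1 /wavelet !(rmorphM, rmorphB) /=; ring.
Qed.

Variable m : nat.
Definition Vm := kV (m := m) V1.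
Definition Am (i : 'I_m) := ksite i raise1.
Definition Nm (i : 'I_m) := ksite i num1.

Lemma isometry_Vm : isometry Vm.
Proof. exact: isometry_kV gram_V1. Qed.

Lemma quant_Am i : quant Vm (Am i) (fun x => zsym (x i)) (iota werr).
Proof.
have g : gram (fun y n => kmul V1 raise1 y n - zsym y * V1 y n) (fun n => iota
    (\sum_(a < q + l) (winR a n.+1 * amp n.+1 - amp (minn a q) * winR a n) ^+ 2)).
  move=> n n'; under eq_bigr do rewrite !raise_err.
  by apply: gram_wavelet => b; rewrite omX_norm.
have g' : gram (fun y n => kmul V1 (kadj raise1) y n - (zsym y)^* * V1 y n) (fun n => iota
    (\sum_(a < q + l) (winR a n.-1 * amp n - amp (minn a q) * winR a n) ^+ 2)).
  move=> n n'; under eq_bigr do rewrite !lower_err.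
  by apply: gram_wavelet => b; rewrite norm_conjC omX_norm.
apply: (quant_site gram_V1 _ g g').
- move=> n; apply: iota_le => //; apply: win_err => //; first by rewrite leqW.
    exact: ltnW.
  move=> a /andP[h1 h2] /andP[h3 h4].
  by split; [exact: leq_trans h1 (leq_addr _ _) | rewrite geq_min (ltnW h2)].
- move=> n; apply: iota_le => //; apply: win_err => //.
  + by rewrite (leq_trans (leq_pred _)).
  + exact: leqSpred.
  + exact: ltnW.
  + exact: ltnW.
  move=> a /andP[h1 h2] /andP[h3 h4].
  by split; [exact: leq_trans h3 (leq_addr _ _) | rewrite geq_min (ltnW h4)].
Qed.

Lemma quant_Nm i : quant Vm (Nm i) (fun x => iota (lev (x i).1)) (iota werr).
Proof.
have h (n : 'I_q) : iota (\sum_(a < q + l) (winR a n * (n%:R / q%:R - lev a)) ^+ 2)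
    <= iota werr.
  apply: iota_le => //; apply: (@le_trans _ _ ((l%:R / q%:R) ^+ 2)); last first.
    by rewrite lerDl divr_ge0.
  apply: (@le_trans _ _ (\sum_(a < q + l) (win a n)%:R * ((l%:R / q%:R) ^+ 2 / l%:R))).
    apply: ler_sum => a _; rewrite exprMn winR_sqr.
    have [w|_] := boolP (win a n); last by rewrite !mul0r.
    rewrite !mul1r mulrC; apply: ler_wpM2r; first by rewrite invr_ge0.
    have /andP[h1 h2] := w; apply: frac_dist.
      by rewrite addn_minl leq_min (leq_trans h1) ?leq_addr // (leq_trans (ltnW (ltn_ord n))) ?leq_addr.
    by rewrite geq_min (ltnW h2).
  rewrite -mulr_suml -natr_sum win_count ?(ltnW (ltn_ord n)) //.
  by rewrite mulrCA divff ?mulr1 // pnatr_eq0 -lt0n.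
have g : gram (fun y n => kmul V1 num1 y n - iota (lev y.1) * V1 y n)
    (fun n => iota (\sum_(a < q + l) (winR a n * (n%:R / q%:R - lev a)) ^+ 2)).
  move=> n n'; under eq_bigr do rewrite !num_err.
  by apply: gram_wavelet => b; rewrite normr1.
suff g' : gram (fun y n => kmul V1 (kadj num1) y n - (iota (lev y.1))^* * V1 y n)
    (fun n => iota (\sum_(a < q + l) (winR a n * (n%:R / q%:R - lev a)) ^+ 2)).
  exact: (quant_site gram_V1 _ g g' h h).
move=> n n'; rewrite -g; apply: eq_bigr => y _.
have E (k : 'I_q) : kmul V1 (kadj num1) y k - (iota (lev y.1))^* * V1 y k =
    kmul V1 num1 y k - iota (lev y.1) * V1 y k.
  rewrite iotaC; congr (_ - _); apply: eq_bigr => j _; congr (_ * _).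
  by rewrite /kadj /num1 rmorphM /= iotaC rmorph_nat eq_sym; case: eqP => [->|] //; rewrite !mulr0.
by rewrite !E.
Qed.

End Window.

(** * The Koszul operator of the shifts *)

Section Clifford.
Variables (C : numClosedFieldType) (m : nat).
Local Notation F := {ffun 'I_m -> bool}.

Definition fflip (l : 'I_m) (f : F) : F := [ffun i => if i == l then ~~ f i else f i].
(* The Jordan-Wigner sign, which makes distinct flips anticommute. *)
Definition kappa (l : 'I_m) (f : F) : C := \prod_(i < m | (i < l)%N) (-1) ^+ f i.
Definition fsign (f : F) : C := \prod_(i < m) (-1) ^+ f i.

Lemma fflipK l : involutive (fflip l).
Proof. by move=> f; apply/ffunP => i; rewrite !ffunE; case: eqP => // _; rewrite negbK. Qed.

Lemma fflipC l l' f : fflip l (fflip l' f) = fflip l' (fflip l f).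
Proof.
apply/ffunP => i; rewrite !ffunE.
by case: (i == l); case: (i == l').
Qed.

Lemma fflip_at l f : fflip l f l = ~~ f l.
Proof. by rewrite ffunE eqxx. Qed.

Lemma fflip_out l i f : i != l -> fflip l f i = f i.
Proof. by move=> /negbTE n; rewrite ffunE n. Qed.

Lemma fflip_neq l f : fflip l f != f.
Proof. by apply/eqP => /ffunP/(_ l); rewrite fflip_at; case: (f l). Qed.

Lemma signb_neg (b : bool) : (-1) ^+ (~~ b) = - (-1) ^+ b :> C.
Proof. by case: b; rewrite ?expr0 ?expr1 ?opprK. Qed.

Lemma signb_sqr (b : bool) : (-1) ^+ b * (-1) ^+ b = 1 :> C.
Proof. by case: b; rewrite ?mulrNN mulr1. Qed.

Lemma signb_conj (b : bool) : ((-1) ^+ b)^* = (-1) ^+ b :> C.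
Proof. by case: b; rewrite ?expr0 ?expr1 ?rmorphN rmorph1. Qed.

Lemma kappa_flip l l' f :
  kappa l (fflip l' f) = if (l' < l)%N then - kappa l f else kappa l f.
Proof.
rewrite /kappa; case: ifP => h.
  rewrite (bigD1 l') //= [in RHS](bigD1 l') //= fflip_at signb_neg mulNr.
  by congr (- (_ * _)); apply: eq_bigr => i /andP[_ n]; rewrite fflip_out.
apply: eq_bigr => i il; rewrite fflip_out //; apply/eqP => e.
by rewrite -e il in h.
Qed.

Lemma kappa_sqr l f : kappa l f * kappa l f = 1.
Proof. by rewrite /kappa -big_split big1 // => i _; exact: signb_sqr. Qed.

Lemma kappa_conj l f : (kappa l f)^* = kappa l f.
Proof. by rewrite /kappa rmorph_prod; apply: eq_bigr => i _; exact: signb_conj. Qed.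

Lemma kappa_anti l l' f : l != l' ->
  kappa l f * kappa l' (fflip l f) = - (kappa l' f * kappa l (fflip l' f)).
Proof.
move=> n; rewrite !kappa_flip.
case: (ltngtP l l') => [lt|lt|e]; last by rewrite (val_inj e) eqxx in n.
- by ring.
- by ring.
Qed.

Lemma fsign_flip l f : fsign (fflip l f) = - fsign f.
Proof.
rewrite /fsign (bigD1 l) //= [in RHS](bigD1 l) //= fflip_at signb_neg mulNr.
by congr (- (_ * _)); apply: eq_bigr => i n; rewrite fflip_out.
Qed.

Lemma fsign_sqr f : fsign f * fsign f = 1.
Proof. by rewrite /fsign -big_split big1 // => i _; exact: signb_sqr. Qed.

Lemma fsign_conj f : (fsign f)^* = fsign f.
Proof. by rewrite /fsign rmorph_prod; apply: eq_bigr => i _; exact: signb_conj. Qed.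

(** The terms with [l != l'] cancel in pairs by anticommutation. The flips are abstract because both
    the symbol [csym] and the operator [ck] are squared in this way. *)
Lemma clifford_sqr (T : finType) (fl : 'I_m -> T -> T) (c r : 'I_m -> T -> C) (w : T -> C) t :
  (forall l l' t, fl l (fl l' t) = fl l' (fl l t)) ->
  (forall l l' t, l != l' -> c l t * c l' (fl l t) = - (c l' t * c l (fl l' t))) ->
  (forall l t, c l t * (c l (fl l t) * w (fl l (fl l t))) = r l t * w t) ->
  \sum_l c l t * (\sum_l' c l' (fl l t) * w (fl l' (fl l t))) = (\sum_l r l t) * w t.
Proof.
move=> flC canti csq.
pose b l l' := if l == l' then 0 else c l t * (c l' (fl l t) * w (fl l' (fl l t))).
transitivity (\sum_l (r l t * w t + \sum_l' b l l')).
  apply: eq_bigr => l _; rewrite mulr_sumr (bigD1 l) //= csq.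
  congr (_ + _); rewrite [in RHS](bigD1 l) //= /b eqxx add0r.
  by apply: eq_bigr => l' /negbTE n; rewrite eq_sym n.
rewrite big_split /= -mulr_suml -[RHS]addr0; congr (_ + _).
have e : \sum_l \sum_l' b l l' = - (\sum_l \sum_l' b l l').
  rewrite [in RHS]exchange_big -sumrN; apply: eq_bigr => l _.
  rewrite -sumrN; apply: eq_bigr => l' _; rewrite /b [l' == l]eq_sym.
  case: eqVneq => [_|n]; first by rewrite oppr0.
  by rewrite !mulrA (canti _ _ _ n) (flC l' l) mulNr.
have two : (2 : C) != 0 by rewrite pnatr_eq0.
by apply: (mulfI two); rewrite mulr0 mulr_natl mulr2n {1}e addNr.
Qed.

(** Clifford multiplication by [z] on the exterior algebra, whose basis is indexed by subsets. Its
    square is the scalar [|z|^2], so it is invertible wherever [z] is not 0. *)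
Definition csym (z : 'I_m -> C) (f f' : F) : C :=
  \sum_l kappa l f * ((if f l then (z l)^* else z l) * (f' == fflip l f)%:R).

Lemma csym_app z w f : kapp (csym z) w f =
  \sum_l kappa l f * (if f l then (z l)^* else z l) * w (fflip l f).
Proof.
rewrite /kapp; under eq_bigr do rewrite mulr_suml.
rewrite exchange_big; apply: eq_bigr => l _.
rewrite (bigD1 (fflip l f)) //= eqxx mulr1 big1 ?addr0 //.
by move=> f' /negbTE ->; rewrite !mulr0 mul0r.
Qed.

Lemma csym_sqr z w f : kapp (csym z) (kapp (csym z) w) f =
  (\sum_l `|z l| ^+ 2) * w f.
Proof.
rewrite csym_app (eq_bigr (fun l => kappa l f * (if f l then (z l)^* else z l) *
  (\sum_l' kappa l' (fflip l f) * (if fflip l f l' then (z l')^* else z l') *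
    w (fflip l' (fflip l f))))); last by move=> l _; rewrite csym_app.
apply: (clifford_sqr (fl := fflip) (r := fun l _ => `|z l| ^+ 2)
  (c := fun l f => kappa l f * (if f l then (z l)^* else z l))).
- exact: fflipC.
- move=> l l' g n; rewrite (fflip_out g n) fflip_out 1?eq_sym // .
  rewrite mulrACA [in RHS]mulrACA kappa_anti // mulNr; congr (- (_ * _)).
  by rewrite mulrC.
- move=> l g; rewrite fflipK fflip_at kappa_flip ltnn normCK /=.
  have e a b : a * b = z l * (z l)^* ->
      kappa l g * a * (kappa l g * b * w g) = z l * (z l)^* * w g.
    move=> <-; transitivity (kappa l g * kappa l g * (a * b) * w g); first by ring.
    by rewrite kappa_sqr mul1r.
  by apply: e; case: (g l); rewrite //= mulrC.
Qed.

Lemma csym_herm z : herm (csym z).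
Proof.
move=> f f'; rewrite /csym rmorph_sum; apply: eq_bigr => l _.
rewrite rmorphM rmorphM /= kappa_conj rmorph_nat.
have -> : (f == fflip l f') = (f' == fflip l f).
  by apply/eqP/eqP => ->; rewrite fflipK.
have [->|_] := eqVneq f' (fflip l f); last by rewrite !mulr0.
rewrite kappa_flip ltnn fflip_at !mulr1; congr (_ * _).
by case: (f l); rewrite /= ?conjCK.
Qed.

Lemma csym_sign z f f' : fsign f * csym z f f' * fsign f' = - csym z f f'.
Proof.
rewrite /csym mulr_sumr mulr_suml -sumrN; apply: eq_bigr => l _.
have [->|_] := eqVneq f' (fflip l f); last by rewrite !mulr0 mul0r oppr0.
rewrite fsign_flip; have := fsign_sqr f; move: (fsign f) (kappa _ _) (if _ then _ else _).
move=> s a b ss; rewrite mulr1; transitivity (- (s * s) * (a * b)); first by ring.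
by rewrite ss; ring.
Qed.

End Clifford.

(** * Exact inertia of the Koszul operator with mass *)

Section Oscillator.
Variables (C : numClosedFieldType) (R : realType) (iota : {rmorphism R -> C}).
Hypothesis iotaC : forall c, (iota c)^* = iota c.
Variables (m q : nat).
Hypothesis q0 : (0 < q)%N.
Local Notation F := {ffun 'I_m -> bool}.
Local Notation N := {ffun 'I_m -> 'I_q}.
Local Notation Am := (Am iota (q := q) (m := m)).
Local Notation amp := (amp R q).
Implicit Types (t : N * F) (l : 'I_m).

(* The level [n_l + f_l] is invariant under [nflip], so that the square of [Bk] is
   diagonal. *)
Definition jlev t l : nat := (t.1 l + t.2 l)%N.
(** The default of [insubd], staying in place, occurs only for a raised position that reaches [q],
    where the weight [amp] vanishes. *)
Definition move1 (b : bool) (i : 'I_q) : 'I_q := insubd i (if b then i.+1 else i.-1).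
Definition nflip l t : N * F :=
  ([ffun i => if i == l then move1 (t.2 i) (t.1 i) else t.1 i], fflip l t.2).
Definition interior t l : bool := (0 < jlev t l < q)%N.

Lemma jlev_le t l : (jlev t l <= q)%N.
Proof. by rewrite /jlev; have := ltn_ord (t.1 l); case: (t.2 l) => /=; lia. Qed.

Lemma amp_boundary t l : ~~ interior t l -> amp (jlev t l) = 0.
Proof.
have := jlev_le t l; rewrite /interior /amp; case: (jlev t l) => [|j] /= h1 h2.
  by rewrite mul0r mul0r.
have -> : j.+1 = q by lia.
by rewrite divff ?subrr ?mulr0 // pnatr_eq0 -lt0n.
Qed.

Lemma amp_interior t l : interior t l -> 0 < amp (jlev t l).
Proof.
move=> /andP[h1 h2]; have q0' : 0 < q%:R :> R by rewrite ltr0n.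
rewrite /amp mulr_gt0 //; first by rewrite divr_gt0 // ltr0n.
by rewrite subr_gt0 ltr_pdivrMr // mul1r ltr_nat.
Qed.

Lemma move1E t l : interior t l ->
  (move1 (t.2 l) (t.1 l) : nat) = (if t.2 l then (t.1 l).+1 else (t.1 l).-1).
Proof.
rewrite /interior /jlev /move1 => /andP[h1 h2]; rewrite val_insubd.
by move: h1 h2 (ltn_ord (t.1 l)); case: (t.2 l) => /= h1 h2 h3; case: ifP => //; lia.
Qed.

Lemma jlev_out l l' t : l' != l -> jlev (nflip l t) l' = jlev t l'.
Proof. by move=> n; rewrite /jlev /nflip /= ffunE (negbTE n) fflip_out. Qed.

Lemma jlev_at l t : interior t l -> jlev (nflip l t) l = jlev t l.
Proof.
move=> h; rewrite /jlev /nflip /= ffunE eqxx fflip_at move1E //.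
by move: h; rewrite /interior /jlev; case: (t.2 l) => /=; lia.
Qed.

Lemma jlev_flip l l' t : interior t l -> jlev (nflip l t) l' = jlev t l'.
Proof. by move=> h; have [->|n] := eqVneq l' l; [exact: jlev_at | exact: jlev_out]. Qed.

Lemma interior_flip l l' t : interior t l -> interior (nflip l t) l' = interior t l'.
Proof. by move=> h; rewrite /interior jlev_flip. Qed.

Lemma nflipK l t : interior t l -> nflip l (nflip l t) = t.
Proof.
move=> h; have h' : interior (nflip l t) l by rewrite interior_flip.
rewrite [RHS]surjective_pairing; congr (_, _); last exact: fflipK.
apply/ffunP => i; rewrite !ffunE; case: eqP => // ->; apply: val_inj => /=.
have := move1E h'; rewrite /nflip /= !ffunE eqxx => ->.
by rewrite move1E //; move: h; rewrite /interior /jlev; case: (t.2 l) => /=; lia.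
Qed.

Lemma nflipC l l' t : nflip l (nflip l' t) = nflip l' (nflip l t).
Proof.
rewrite /nflip /=; congr (_, _); last exact: fflipC.
apply/ffunP => i; rewrite !ffunE.
have [->|n] := eqVneq i l; have [e|n'] := eqVneq _ l' => //.
Qed.

Definition nsign (n : N) : C := \prod_i (-1) ^+ n i.

Lemma nsign_flip l t : interior t l -> nsign (nflip l t).1 = - nsign t.1.
Proof.
move=> h; rewrite /nsign (bigD1 l) //= [in RHS](bigD1 l) //= ffunE eqxx move1E //.
rewrite -mulNr; congr (_ * _).
  by move: h; rewrite /interior /jlev; case: (t.2 l); case: (t.1 l) => -[|k] //= _ _;
     rewrite !exprS ?mulN1r ?opprK.
by apply: eq_bigr => i /negbTE n; rewrite ffunE n.
Qed.

Lemma signn_sqr k : (-1) ^+ k * (-1) ^+ k = 1 :> C.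
Proof. by rewrite -expr2 sqrr_sign. Qed.

Lemma nsign_sqr n : nsign n * nsign n = 1.
Proof. by rewrite /nsign -big_split big1 // => i _; exact: signn_sqr. Qed.

Lemma nsign_conj n : (nsign n)^* = nsign n.
Proof.
rewrite /nsign rmorph_prod; apply: eq_bigr => i _.
by rewrite rmorphXn rmorphN1.
Qed.

Lemma ksiteE (Q : finType) l (k : Q -> Q -> C) (n n' : {ffun 'I_m -> Q}) :
  ksite l k n n' = k (n l) (n' l) * [forall i, (i != l) ==> (n i == n' i)]%:R.
Proof.
rewrite /ksite (bigD1 l) //= eqxx; congr (_ * _).
have [/forallP h|] := boolP [forall i, (i != l) ==> (n i == n' i)].
  by rewrite big1 // => i n1; rewrite (negbTE n1) (implyP (h i) n1).
move=> /forallPn[i]; rewrite negb_imply => /andP[n1 n2].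
by rewrite (bigD1 i) //= (negbTE n1) (negbTE n2) mul0r.
Qed.

Definition cterm l t t' : C :=
  (if t.2 l then kadj (Am l) else Am l) t.1 t'.1 * (t'.2 == fflip l t.2)%:R.

Lemma raise_at t (n' : N) l : (if t.2 l then kadj (raise1 iota (q := q)) else raise1 iota (q := q)) (t.1 l) (n' l)
   = iota (amp (jlev t l)) * (interior t l && (n' l == move1 (t.2 l) (t.1 l)))%:R.
Proof.
have [h|h] := boolP (interior t l); last first.
  rewrite (amp_boundary h) rmorph0 mul0r; move: h; rewrite /interior /jlev.
  case: (t.2 l) => /= h; rewrite /kadj /raise1.
    case: eqP => [e|_]; last by rewrite mulr0 conjC0.
    by have := ltn_ord (n' l); move: h (ltn_ord (t.1 l)); rewrite e; lia.
  have -> : (t.1 l : nat) = 0%N by have := ltn_ord (t.1 l); lia.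
  by rewrite mulr0.
rewrite andTb -val_eqE /= move1E //; move: h; rewrite /interior /jlev.
case: (t.2 l) => /= h; rewrite /kadj /raise1 ?addn1 ?addn0.
  case: eqP => [->|_]; last by rewrite !mulr0 conjC0.
  by rewrite rmorphM /= iotaC rmorph1.
congr (_ * _%:R); congr (nat_of_bool _); apply/eqP/eqP => e; first by rewrite e.
by rewrite e prednK //; lia.
Qed.

(** The shift, used where [f l] is false, and its adjoint, used where [f l] is true, both carry the
    weight [amp] at the level [n l + f l]. Each term is therefore a weighted flip whose weight is
    constant along its orbits. *)
Lemma ctermE l t t' : cterm l t t' = iota (amp (jlev t l)) * (t' == nflip l t)%:R.
Proof.
have [h|h] := boolP (interior t l); last first.
  rewrite (amp_boundary h) rmorph0 mul0r /cterm.
  have -> : (if t.2 l then kadj (Am l) else Am l) t.1 t'.1 = 0; last by rewrite mul0r.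
  have := raise_at t t'.1 l; rewrite (negbTE h) /= mulr0.
  by case: (t.2 l) => e; rewrite ?kadj_ksite /Am ksiteE e mul0r.
have e : (if t.2 l then kadj (Am l) else Am l) t.1 t'.1 =
    iota (amp (jlev t l)) * (t'.1 == (nflip l t).1)%:R.
  have -> : (if t.2 l then kadj (Am l) else Am l) t.1 t'.1 =
     (if t.2 l then kadj (raise1 iota (q := q)) else raise1 iota (q := q)) (t.1 l) (t'.1 l) *
     [forall i, (i != l) ==> (t.1 i == t'.1 i)]%:R.
    by case: (t.2 l); rewrite ?kadj_ksite /Am ksiteE.
  rewrite raise_at h andTb -mulrA -natrM mulnb; congr (_ * _%:R); congr (nat_of_bool _).
  apply/andP/eqP => [[/eqP h1 /forallP h2]|->].
    apply/ffunP => i; rewrite ffunE; case: eqP => [->|/eqP n]; first by rewrite h1.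
    by have /implyP/(_ n)/eqP -> := h2 i.
  rewrite ffunE eqxx; split=> //; apply/forallP => i; apply/implyP => /negbTE n.
  by rewrite ffunE n.
rewrite /cterm e -mulrA -natrM mulnb; congr (_ * _%:R); congr (nat_of_bool _).
Qed.

Definition ck t t' : C := \sum_l kappa C l t.2 * cterm l t t'.
(** The mass is taken at [n + f] instead of [n]. It is then constant along the flips, so that the
    mass term anticommutes with [ck] exactly and not only on symbols. *)
Definition muj t : R := 2^-1 - \sum_l (jlev t l)%:R / q%:R.
Definition lam t : R := \sum_l amp (jlev t l) ^+ 2 + muj t ^+ 2.
Definition Bk t t' : C := ck t t' + iota (muj t) * fsign C t.2 * (t == t')%:R.

Lemma kapp_delta (T : finType) (c : T -> C) (f : T -> T) (v : T -> C) (x : T) :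
  kapp (fun x y : T => c x * (y == f x)%:R) v x = c x * v (f x).
Proof.
rewrite /kapp (bigD1 (f x)) //= eqxx mulr1 big1 ?addr0 //.
by move=> y /negbTE ->; rewrite mulr0 mul0r.
Qed.

Lemma ck_app v t : kapp ck v t =
  \sum_l kappa C l t.2 * iota (amp (jlev t l)) * v (nflip l t).
Proof.
rewrite /kapp /ck; under eq_bigr do rewrite mulr_suml.
rewrite exchange_big; apply: eq_bigr => l _ /=.
rewrite -(kapp_delta (fun t => kappa C l t.2 * iota (amp (jlev t l))) (nflip l) v t).
by apply: eq_bigr => t' _; rewrite ctermE mulrA.
Qed.

Lemma Bk_app v t : kapp Bk v t =
  kapp ck v t + iota (muj t) * fsign C t.2 * v t.
Proof.
rewrite /Bk kappDl; congr (_ + _).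
rewrite -(kapp_delta (fun t => iota (muj t) * fsign C t.2) id v t).
by apply: kapp_ext => // s s'; rewrite eq_sym.
Qed.

Lemma ck_sqr v t : kapp ck (kapp ck v) t = (\sum_l iota (amp (jlev t l) ^+ 2)) * v t.
Proof.
rewrite ck_app (eq_bigr (fun l => kappa C l t.2 * iota (amp (jlev t l)) *
  (\sum_l' kappa C l' (nflip l t).2 * iota (amp (jlev (nflip l t) l')) *
    v (nflip l' (nflip l t))))); last by move=> l _; rewrite ck_app.
apply: (clifford_sqr (fl := nflip) (r := fun l t => iota (amp (jlev t l) ^+ 2))
  (c := fun l t => kappa C l t.2 * iota (amp (jlev t l)))).
- exact: nflipC.
- move=> l l' s n; rewrite (jlev_out _ n) jlev_out 1?eq_sym //.
  rewrite mulrACA [in RHS]mulrACA /= kappa_anti // mulNr; congr (- (_ * _)).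
  by rewrite mulrC.
- move=> l s; have [h|h] := boolP (interior s l); last first.
    by rewrite (amp_boundary h) expr0n rmorph0 mulr0 !mul0r.
  rewrite nflipK // jlev_flip // /= kappa_flip ltnn rmorphXn /=.
  transitivity (kappa C l s.2 * kappa C l s.2 * iota (amp (jlev s l)) ^+ 2 * v s); first by ring.
  by rewrite kappa_sqr mul1r.
Qed.

Lemma muj_flip l t : interior t l -> muj (nflip l t) = muj t.
Proof. by move=> h; rewrite /muj; congr (_ - _); apply: eq_bigr => i _; rewrite jlev_flip. Qed.

Lemma Bk_sqr v t : kapp Bk (kapp Bk v) t = iota (lam t) * v t.
Proof.
rewrite Bk_app (kapp_ext (fun _ _ => erefl (ck _ _)) (Bk_app v)) kappD ck_sqr Bk_app mulrDr.
rewrite addrACA [X in _ + X = _]addrC addrACA [X in _ + X](_ : _ = 0) ?addr0; last first.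
  rewrite !ck_app mulr_sumr -big_split big1 // => l _ /=.
  have [h|h] := boolP (interior t l); last first.
    by rewrite (amp_boundary h) rmorph0 mulr0 !mul0r mulr0 addr0.
  by rewrite muj_flip // fsign_flip; ring.
rewrite /lam rmorphD rmorph_sum mulrDl; congr (_ + _).
transitivity (fsign C t.2 * fsign C t.2 * (iota (muj t) ^+ 2 * v t)); first by ring.
by rewrite fsign_sqr mul1r rmorphXn.
Qed.

(** An interior level contributes a positive weight. Without one every level is 0 or [q], and the
    mass is 1/2 minus an integer. *)
Lemma lam_gt0 t : 0 < lam t.
Proof.
have s0 : 0 <= \sum_l amp (jlev t l) ^+ 2 by apply: sumr_ge0 => l _; exact: sqr_ge0.
have [/existsP[l h]|] := boolP [exists l, interior t l].
  apply: ltr_wpDr; first exact: sqr_ge0.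
  rewrite (bigD1 l) //=; apply: ltr_wpDr; first by apply: sumr_ge0 => i _; exact: sqr_ge0.
  by rewrite exprn_gt0 // amp_interior.
rewrite negb_exists => /forallP h; apply: ltr_wpDl => //.
rewrite lt_def sqr_ge0 andbT sqrf_eq0 /muj.
have -> : \sum_l (jlev t l)%:R / q%:R = (\sum_l (jlev t l == q))%N%:R :> R.
  rewrite natr_sum; apply: eq_bigr => l _; have := h l; have := jlev_le t l.
  rewrite /interior; case: eqP => [->|n] h1 h2.
    by rewrite divff // pnatr_eq0 -lt0n.
  have -> : jlev t l = 0%N by lia.
  by rewrite mul0r.
case: (\sum_l _)%N => [|k]; first by rewrite subr0 invr_eq0 pnatr_eq0.
rewrite subr_eq0 eq_sym; apply/negP => /eqP e.
have : (1 : R) <= k.+1%:R by rewrite ler1n.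
rewrite e => h1; suff : (2^-1 : R) < 1 by rewrite ltNge h1.
by rewrite invf_lt1 // ltr1n.
Qed.

Definition csign t : C := nsign t.1 * fsign C t.2.
Definition Rc t t' : C := csign t * Bk t t'.

Lemma csign_sqr t : csign t * csign t = 1.
Proof. by rewrite /csign mulrACA nsign_sqr fsign_sqr mulr1. Qed.

Lemma csign_conj t : (csign t)^* = csign t.
Proof. by rewrite /csign rmorphM /= nsign_conj fsign_conj. Qed.

Lemma csign_flip l t : interior t l -> csign (nflip l t) = csign t.
Proof. by move=> h; rewrite /csign nsign_flip //= fsign_flip mulrNN. Qed.

Lemma Bk_csign t t' : csign t * Bk t t' * csign t' = Bk t t'.
Proof.
rewrite /Bk mulrDr mulrDl; congr (_ + _); last first.
  have [->|_] := eqVneq t t'; last by rewrite !mulr0 mul0r.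
  by rewrite mulrAC csign_sqr mul1r.
rewrite /ck mulr_sumr mulr_suml; apply: eq_bigr => l _; rewrite ctermE.
have [h|h] := boolP (interior t l); last first.
  by rewrite (amp_boundary h) rmorph0 !mul0r !mulr0 mul0r.
have [->|_] := eqVneq t' (nflip l t); last by rewrite !mulr0 mul0r.
by rewrite csign_flip // mulrAC csign_sqr mul1r.
Qed.

Lemma cterm_herm l t t' : kappa C l t'.2 * cterm l t' t = (kappa C l t.2 * cterm l t t')^*.
Proof.
have cM (x y : C) : (x * y)^* = x^* * y^* by rewrite rmorphM.
rewrite !ctermE !cM kappa_conj iotaC rmorph_nat.
have [h|h] := boolP (interior t l).
  have [->|n] := eqVneq t' (nflip l t).
    by rewrite jlev_flip // nflipK // eqxx /= kappa_flip ltnn.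
  have [h'|h'] := boolP (interior t' l).
    have [e|_] := eqVneq t (nflip l t'); last by rewrite !mulr0.
    by rewrite e nflipK // eqxx in n.
  by rewrite (amp_boundary h') rmorph0 !mul0r !mulr0.
rewrite (amp_boundary h) rmorph0 !mul0r !mulr0.
have [e|_] := eqVneq t (nflip l t'); last by rewrite !mulr0.
have [h'|h'] := boolP (interior t' l).
  by rewrite e interior_flip // h' in h.
by rewrite (amp_boundary h') rmorph0 !mul0r !mulr0.
Qed.

Lemma Bk_herm : herm Bk.
Proof.
have cD (x y : C) : (x + y)^* = x^* + y^* by rewrite rmorphD.
move=> t t'; rewrite /Bk cD; congr (_ + _).
  by rewrite /ck rmorph_sum; apply: eq_bigr => l _; rewrite cterm_herm.
have cM (x y : C) : (x * y)^* = x^* * y^* by rewrite rmorphM.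
rewrite !cM iotaC fsign_conj rmorph_nat eq_sym.
by case: eqVneq => [->|_] //; rewrite !mulr0.
Qed.

Lemma Rc_herm : herm Rc.
Proof.
move=> t t'; rewrite /Rc rmorphM /= csign_conj -Bk_herm.
rewrite -[in RHS](Bk_csign t' t).
transitivity (csign t * csign t * (csign t' * Bk t' t)); last by ring.
by rewrite csign_sqr mul1r.
Qed.

Lemma Bk_diag t : Bk t t = iota (muj t) * fsign C t.2.
Proof.
rewrite /Bk eqxx mulr1 /ck big1 ?add0r // => l _; rewrite ctermE.
case: eqP => [/(congr1 snd) /eqP|_]; last by rewrite !mulr0.
by rewrite /= eq_sym (negbTE (fflip_neq l _)).
Qed.

Lemma lam_flip l t : interior t l -> lam (nflip l t) = lam t.
Proof.
move=> h; rewrite /lam muj_flip //; congr (_ + _).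
by apply: eq_bigr => i _; rewrite jlev_flip.
Qed.

Hypotheses (m0 : (0 < m)%N) (qe : ~~ odd q).

(* An involution commuting with [lam] and reversing the sign of the diagonal of
   [Rc]: in the trace of the sign of [Rc] only the fixed points, the corners,
   survive. *)
Definition first_flip t : N * F :=
  if [pick l | interior t l] is Some l then nflip l t else t.

Lemma pick_flip l t : interior t l ->
  [pick i | interior (nflip l t) i] = [pick i | interior t i].
Proof. by move=> h; apply: eq_pick => i; exact: interior_flip. Qed.

Lemma first_flipP t : [exists l, interior t l] ->
  exists2 l, interior t l & first_flip t = nflip l t.
Proof.
rewrite /first_flip; case: pickP => [l h _|h /existsP[l]]; first by exists l.
by rewrite h.
Qed.

Lemma first_flipK : involutive first_flip.
Proof.
move=> t; case e : [pick l | interior t l] => [l|].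
  have h : interior t l by move: e; case: pickP => // i hi [<-].
  have -> : first_flip t = nflip l t by rewrite /first_flip e.
  by rewrite /first_flip pick_flip // e nflipK.
have e' : first_flip t = t by rewrite /first_flip e.
by rewrite !e'.
Qed.

Definition corner (f : F) : N * F :=
  ([ffun l => if f l then insubd (Ordinal q0) q.-1 else Ordinal q0], f).

Lemma cornerE f l : ((corner f).1 l : nat) = if f l then q.-1 else 0%N.
Proof. by rewrite /corner ffunE; case: ifP => //; rewrite val_insubd prednK // leqnn. Qed.

Lemma jlev_corner f l : jlev (corner f) l = (q * f l)%N.
Proof.
rewrite /jlev cornerE /=; case: (f l); rewrite ?muln1 ?muln0 //=.
by rewrite addn1 prednK.
Qed.

Lemma corner_interior f l : interior (corner f) l = false.
Proof. by rewrite /interior jlev_corner; case: (f l); rewrite ?muln1 ?muln0 ?ltnn ?andbF. Qed.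

Lemma corner_surj t : ~~ [exists l, interior t l] -> corner t.2 = t.
Proof.
rewrite negb_exists => /forallP h; rewrite [RHS]surjective_pairing.
congr (_, _); apply/ffunP => l; apply: val_inj; rewrite -[LHS]/(nat_of_ord ((corner t.2).1 l)) cornerE.
have := h l; have := ltn_ord (t.1 l); rewrite /interior /jlev.
by case: (t.2 l) => /=; lia.
Qed.

Lemma nsign_corner f : nsign (corner f).1 = fsign C f.
Proof.
apply: eq_bigr => l _; rewrite cornerE; case: (f l) => //.
by rewrite -signr_odd; have -> : odd q.-1 = true by move: q0 qe; case: (q) => //= k _; rewrite negbK.
Qed.

Lemma muj_corner f : muj (corner f) = 2^-1 - (\sum_l f l)%N%:R.
Proof.
rewrite /muj; congr (_ - _); rewrite natr_sum; apply: eq_bigr => l _.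
by rewrite jlev_corner natrM mulrAC divff ?mul1r // pnatr_eq0 -lt0n.
Qed.

Lemma lam_corner f : lam (corner f) = muj (corner f) ^+ 2.
Proof.
rewrite /lam big1 ?add0r // => l _.
by rewrite amp_boundary ?corner_interior // expr0n.
Qed.

Lemma sgn_corner f : muj (corner f) / Num.sqrt (lam (corner f)) =
  if [forall l, ~~ f l] then 1 else -1.
Proof.
have h := lam_gt0 (corner f); rewrite lam_corner sqrtr_sqr in h *.
have n0 : muj (corner f) != 0 by apply: contraTneq h => ->; rewrite expr0n ltxx.
case: ifP => [/forallP a|/negbT].
  rewrite gtr0_norm ?divff // muj_corner big1 ?subr0 ?invr_gt0 //.
  by move=> l _; rewrite (negbTE (a l)).
move=> /forallPn[l]; rewrite negbK => fl.
rewrite ltr0_norm ?invrN ?mulrN ?divff // muj_corner subr_lt0.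
apply: (@lt_le_trans _ _ 1); first by rewrite invf_lt1 // ltr1n.
by rewrite ler1n (bigD1 l) //= fl.
Qed.

Lemma fsign_sum : \sum_(f : F) fsign C f = 0.
Proof.
transitivity (\prod_(l < m) \sum_(b : bool) (-1) ^+ b : C).
  by rewrite bigA_distr_bigA.
by rewrite (bigD1 (Ordinal m0)) //= big_bool /= expr1 expr0 addNr mul0r.
Qed.

(** This is the trace of the sign of [Rc]. At a corner the mass is [1/2 - |f|], positive only for
    the empty subset, and [nsign] equals [fsign] because [q - 1] is odd. What remains is 2 minus the
    sum of all [fsign f], and that sum is 0 since [m > 0]. *)
Lemma trace_sum :
  \sum_t nsign t.1 * iota (muj t / Num.sqrt (lam t)) = 2.
Proof.
rewrite (bigID (fun t => [exists l, interior t l])) /=.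
set S := \sum_(t | _) _; have -> : S = 0.
  have e : S = - S.
    rewrite {1}/S (reindex_inj (inv_inj first_flipK)) -sumrN; apply: eq_big => t.
      apply/existsP/existsP => -[l h].
        have [|l' h' e] := @first_flipP (first_flip t); first by apply/existsP; exists l.
        move: e h; rewrite first_flipK => e.
        have h2 : interior (nflip l' (first_flip t)) l' by rewrite interior_flip.
        by rewrite -e in h2; exists l'.
      have [|l' h' ->] := @first_flipP t; first by apply/existsP; exists l.
      by exists l'; rewrite interior_flip.
    move=> /existsP[l h].
    have [|l' h' e] := @first_flipP (first_flip t); first by apply/existsP; exists l.
    rewrite first_flipK in e; move: (first_flip t) h' e => s h' ->.
    by rewrite nsign_flip // muj_flip // lam_flip // mulNr opprK.
  have two : (2 : C) != 0 by rewrite pnatr_eq0.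
  by apply: (mulfI two); rewrite mulr0 mulr_natl mulr2n {1}e addNr.
rewrite add0r (reindex_onto corner snd) /=; last by move=> t; exact: corner_surj.
transitivity (\sum_(f : F) (2 * (f == [ffun=> false])%:R - fsign C f)).
  apply: eq_big => f.
    rewrite eqxx andbT; apply/negP => /existsP[l].
    by rewrite corner_interior.
  move=> _; rewrite nsign_corner sgn_corner.
  have -> : [forall l, ~~ f l] = (f == [ffun=> false]).
    apply/forallP/eqP => [h|-> l]; last by rewrite ffunE.
    by apply/ffunP => l; rewrite ffunE; apply: negbTE.
  case: eqP => [->|_]; last by rewrite mulr0 sub0r rmorphN1 mulrN1.
  rewrite rmorph1 !mulr1 /fsign big1 ?mulr2n ?addrK //.
  by move=> l _; rewrite ffunE expr0.
rewrite sumrB fsign_sum subr0 -mulr_sumr (bigD1 [ffun=> false]) //= eqxx big1 ?addr0 ?mulr1 //.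
by move=> f /negbTE ->.
Qed.

(** [Rc] squares to the diagonal [lam] and commutes with it. Congruence by [lam^(-1/4)] turns it
    into an involution of the same inertia, whose trace 2 is the excess of positive over negative
    eigenvalues. *)
Lemma Rc_inertia : exists p, inertia Rc p p.+2.
Proof.
pose d t : C := iota (Num.sqrt (Num.sqrt (lam t)))^-1.
have dC t : (d t)^* = d t by rewrite /d iotaC.
have s0 t : 0 < Num.sqrt (lam t) by rewrite sqrtr_gt0 lam_gt0.
have d2 t : d t * d t = iota (Num.sqrt (lam t))^-1.
  rewrite /d -rmorphM -expr2 exprVn sqr_sqrtr //; exact: ltW.
have d4 t : d t * d t * (d t * d t) * iota (lam t) = 1.
  rewrite !d2 -!rmorphM -[X in _ * X](sqr_sqrtr (ltW (lam_gt0 t))) expr2.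
  have := lt0r_neq0 (s0 t); move: (Num.sqrt (lam t)) => x x0.
  by rewrite (_ : _ * _ = 1) ?rmorph1 //; field.
pose K s t := (d s)^* * Rc s t * d t.
have cM (x y : C) : (x * y)^* = x^* * y^* by rewrite rmorphM.
have hK : herm K by move=> s t; rewrite /K Rc_herm; move: (Rc s t) => r; rewrite !cM !dC; ring.
have Rapp v t : kapp Rc v t = csign t * kapp Bk v t.
  by rewrite /Rc /kapp mulr_sumr; apply: eq_bigr => s _; rewrite mulrA.
have RR v t : kapp Rc (kapp Rc v) t = iota (lam t) * v t.
  rewrite Rapp -Bk_sqr.
  transitivity (kapp Bk (kapp Bk v) t) => //.
  rewrite /kapp mulr_sumr; apply: eq_bigr => s _.
  rewrite -/(kapp Rc v s) Rapp -/(kapp Bk v s).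
  transitivity (csign t * Bk t s * csign s * kapp Bk v s); first by ring.
  by rewrite Bk_csign.
have Bd s t : lam s != lam t -> Bk s t = 0.
  move=> n; rewrite /Bk; have [e|_] := eqVneq s t; first by rewrite e eqxx in n.
  rewrite mulr0 addr0 /ck big1 // => l _; rewrite ctermE.
  have [h|h] := boolP (interior s l); last by rewrite (amp_boundary h) rmorph0 !mul0r mulr0.
  have [e|_] := eqVneq t (nflip l s); last by rewrite !mulr0.
  by rewrite e lam_flip // eqxx in n.
have Rd s t : Rc s t * (d t * d t) = d s * d s * Rc s t.
  have [e|/Bd e] := eqVneq (lam s) (lam t); first by rewrite !d2 e mulrC.
  by rewrite /Rc e mulr0 mul0r mulr0.
have Kapp v t : kapp K v t = d t * kapp Rc (fun s => d s * v s) t.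
  rewrite /kapp mulr_sumr; apply: eq_bigr => s _; rewrite /K dC; ring.
have KK v t : kapp K (kapp K v) t = v t.
  rewrite Kapp (kapp_ext (w := fun s => d s * d s * kapp Rc (fun s => d s * v s) s) (fun _ _ => erefl (Rc _ _))); last first.
    by move=> s; rewrite Kapp mulrA.
  have -> : kapp Rc (fun s => d s * d s * kapp Rc (fun s => d s * v s) s) t =
     d t * d t * kapp Rc (kapp Rc (fun s => d s * v s)) t.
    rewrite {1 3}/kapp mulr_sumr; apply: eq_bigr => s _.
    by rewrite mulrA Rd -!mulrA.
  rewrite RR; transitivity (d t * d t * (d t * d t) * iota (lam t) * v t); first by ring.
  by rewrite d4 mul1r.
have gK v : 1 ^+ 2 * sqn v <= sqn (kapp K v).
  by rewrite expr1n mul1r !sqnE -herm_hip // /hip (eq_bigr _ (fun t _ => congr1 _ (KK v t))).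
have [p [p' iK]] := inertia_exists hK ltr01 gK.
have iR := inertia_scale (fun s t => erefl (K s t)) iK.
have := inertia_trace hK KK iK.
have -> : \sum_t K t t = 2.
  rewrite -trace_sum; apply: eq_bigr => t _.
  rewrite /K dC /Rc Bk_diag /csign rmorphM -d2.
  transitivity (fsign C t.2 * fsign C t.2 * (nsign t.1 * (iota (muj t) * (d t * d t)))); first by ring.
  by rewrite fsign_sqr mul1r.
move=> /eqP; rewrite eq_sym subr_eq -natrD eqr_nat => /eqP e.
by exists p; rewrite e in iR.
Qed.

End Oscillator.

(** * The two homotopic operators *)

Section Symbols.
Variable C : numClosedFieldType.

Lemma hip_anticomm (T : finType) (k l : T -> T -> C) (w : T -> C) :
  herm k -> herm l -> (forall t, kapp k (kapp l w) t = - kapp l (kapp k w) t) ->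
  hip (kapp k w) (kapp l w) + hip (kapp l w) (kapp k w) = 0.
Proof.
move=> hk hl h; rewrite -!herm_hip // -hipDr /hip big1 // => t _.
by rewrite h addNr mulr0.
Qed.

(** The images of a vector under anticommuting Hermitian operators have inner products with zero
    real part, so Pythagoras applies to real combinations. *)
Lemma sqn_anticomm3 (T : finType) (k1 k2 k3 : T -> T -> C) (w : T -> C) a b c :
  herm k1 -> herm k2 -> herm k3 ->
  (forall t, kapp k1 (kapp k2 w) t = - kapp k2 (kapp k1 w) t) ->
  (forall t, kapp k1 (kapp k3 w) t = - kapp k3 (kapp k1 w) t) ->
  (forall t, kapp k2 (kapp k3 w) t = - kapp k3 (kapp k2 w) t) ->
  a \is Num.real -> b \is Num.real -> c \is Num.real ->
  sqn (fun t => a * kapp k1 w t + b * kapp k2 w t + c * kapp k3 w t) =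
  a ^+ 2 * sqn (kapp k1 w) + b ^+ 2 * sqn (kapp k2 w) + c ^+ 2 * sqn (kapp k3 w).
Proof.
move=> h1 h2 h3 c12 c13 c23 ar br cr.
have := hip_anticomm h1 h2 c12; have := hip_anticomm h1 h3 c13.
have := hip_anticomm h2 h3 c23.
set x23 := hip (kapp k2 w) (kapp k3 w); set x13 := hip (kapp k1 w) (kapp k3 w).
set x12 := hip (kapp k1 w) (kapp k2 w) => e23 e13 e12.
rewrite sqnD sqnD !sqnZ !real_normK // hipDl hipDr !hipZl !hipZr.
rewrite !(CrealP ar) !(CrealP br) !(CrealP cr) -/x12 -/x13 -/x23.
move/eqP: e12; rewrite addrC addr_eq0 => /eqP ->.
move/eqP: e13; rewrite addrC addr_eq0 => /eqP ->.
move/eqP: e23; rewrite addrC addr_eq0 => /eqP ->.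
by ring.
Qed.

Variable K : nat.
Local Notation G := (bool * 'I_K)%type.
Definition gsign (g : G) : C := (-1) ^+ g.1.

Definition offdiag (A : Type) (z : A) (p p' : 'I_K -> 'I_K -> A) (g g' : G) : A :=
  if g.1 then (if g'.1 then z else p g.2 g'.2)
  else (if g'.1 then p' g.2 g'.2 else z).
Definition phis (p : 'I_K -> 'I_K -> C) : G -> G -> C :=
  offdiag 0 p (fun i j => (p j i)^*).

Lemma gsign_sqr g : gsign g * gsign g = 1.
Proof. exact: signb_sqr. Qed.

Lemma gsign_conj g : (gsign g)^* = gsign g.
Proof. exact: signb_conj. Qed.

Lemma gsign_norm g : `|gsign g| = 1.
Proof. exact: normr_sign. Qed.

Lemma phis_herm p : herm (phis p).
Proof. by move=> [[] i] [[] j]; rewrite /phis /offdiag /= ?conjCK ?conjC0. Qed.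

Lemma phis_gsign p g g' : gsign g * phis p g g' * gsign g' = - phis p g g'.
Proof.
case: g g' => [[] i] [[] j]; rewrite /phis /offdiag /gsign /= ?expr1 ?expr0;
  by rewrite ?mulr0 ?mul0r ?oppr0 // ?mulN1r ?mul1r ?mulr1 ?mulrN1.
Qed.

Lemma sum_G (F : G -> C) : \sum_g F g = \sum_i F (true, i) + \sum_i F (false, i).
Proof.
rewrite (eq_bigr (fun g => F (g.1, g.2))); last by case.
by rewrite -(pair_bigA _ (fun b i => F (b, i))) /= big_bool.
Qed.

Lemma phis_app_true p w i :
  kapp (phis p) w (true, i) = kapp p (fun j => w (false, j)) i.
Proof.
rewrite /kapp sum_G /phis /offdiag /= big1 ?add0r // => j _.
by rewrite mul0r.
Qed.

Lemma phis_app_false p w i :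
  kapp (phis p) w (false, i) = kapp (kadj p) (fun j => w (true, j)) i.
Proof.
rewrite /kapp sum_G /phis /offdiag /= [X in _ + X]big1 ?addr0 // => j _.
by rewrite mul0r.
Qed.

Lemma phis_gap p (d : C) w :
  (forall v, d * sqn v <= sqn (kapp p v)) ->
  (forall v, d * sqn v <= sqn (kapp (kadj p) v)) ->
  d * sqn w <= sqn (kapp (phis p) w).
Proof.
move=> h h'.
have -> : sqn (kapp (phis p) w) = sqn (kapp p (fun j => w (false, j))) +
    sqn (kapp (kadj p) (fun j => w (true, j))).
  rewrite {1}/sqn sum_G; congr (_ + _); apply: eq_bigr => i _.
    by rewrite phis_app_true.
  by rewrite phis_app_false.
by rewrite {1}/sqn sum_G mulrDr addrC; apply: lerD; [exact: h | exact: h'].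
Qed.

Variable m : nat.
Local Notation F := {ffun 'I_m -> bool}.
Local Notation E := (G * F)%type.
(** As tensor products on [G] and the exterior algebra, [phiE] is phi times 1, [cE] is gamma times c
    and [gE] is gamma times gamma'. The factor gamma in [cE] is what makes it anticommute with
    [phiE]. *)
Definition phiE (p : 'I_K -> 'I_K -> C) : E -> E -> C :=
  fun e e' => (e.2 == e'.2)%:R * phis p e.1 e'.1.
Definition cE (z : 'I_m -> C) : E -> E -> C :=
  fun e e' => (e.1 == e'.1)%:R * (gsign e.1 * csym z e.2 e'.2).
Definition gE : E -> E -> C := fun e e' => (e == e')%:R * (gsign e.1 * fsign C e.2).

Lemma kapp_pair_r (S T : finType) (k : S -> S -> C) (w : S * T -> C) e :
  kapp (fun e e' => (e.2 == e'.2)%:R * k e.1 e'.1) w e = kapp k (fun s => w (s, e.2)) e.1.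
Proof.
rewrite /kapp (eq_bigr (fun e' => (e.2 == e'.2)%:R * k e.1 e'.1 * w (e'.1, e'.2))); last by move=> [].
rewrite -(pair_bigA _ (fun s t => (e.2 == t)%:R * k e.1 s * w (s, t))) /=.
apply: eq_bigr => s _; rewrite (bigD1 e.2) //= eqxx mul1r big1 ?addr0 // => t.
by rewrite eq_sym => /negbTE ->; rewrite !mul0r.
Qed.

Lemma kapp_pair_l (S T : finType) (k : S -> T -> T -> C) (w : S * T -> C) e :
  kapp (fun e e' => (e.1 == e'.1)%:R * k e.1 e.2 e'.2) w e =
  kapp (k e.1) (fun t => w (e.1, t)) e.2.
Proof.
rewrite /kapp (eq_bigr (fun e' => (e.1 == e'.1)%:R * k e.1 e.2 e'.2 * w (e'.1, e'.2))); last by move=> [].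
rewrite -(pair_bigA _ (fun s t => (e.1 == s)%:R * k e.1 e.2 t * w (s, t))) /= exchange_big.
apply: eq_bigr => t _; rewrite (bigD1 e.1) //= eqxx mul1r big1 ?addr0 // => s.
by rewrite eq_sym => /negbTE ->; rewrite !mul0r.
Qed.

Lemma phiE_app p w e : kapp (phiE p) w e = kapp (phis p) (fun g => w (g, e.2)) e.1.
Proof. exact: kapp_pair_r. Qed.

Lemma cE_app z w e : kapp (cE z) w e = gsign e.1 * kapp (csym z) (fun f => w (e.1, f)) e.2.
Proof.
rewrite (kapp_pair_l (fun g f f' => gsign g * csym z f f')) /kapp mulr_sumr.
by apply: eq_bigr => f _; rewrite mulrA.
Qed.

Lemma gE_app w e : kapp gE w e = gsign e.1 * fsign C e.2 * w e.
Proof.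
rewrite /kapp (bigD1 e) //= /gE eqxx mul1r big1 ?addr0 //.
by move=> e'; rewrite eq_sym => /negbTE ->; rewrite !mul0r.
Qed.

Lemma phiE_herm p : herm (phiE p).
Proof. by move=> e e'; rewrite /phiE rmorphM rmorph_nat /= -phis_herm eq_sym. Qed.

Lemma cE_herm z : herm (cE z).
Proof.
move=> e e'; rewrite /cE rmorphM rmorphM rmorph_nat /= gsign_conj -csym_herm eq_sym.
by case: eqP => [->|]; rewrite ?mul0r.
Qed.

Lemma gE_herm : herm gE.
Proof.
move=> e e'; rewrite /gE rmorphM rmorphM rmorph_nat /= gsign_conj fsign_conj eq_sym.
by case: eqP => [->|]; rewrite ?mul0r.
Qed.

Lemma kapp_sign_flip (T : finType) (k : T -> T -> C) (s : T -> C) w t :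
  (forall t, s t * s t = 1) -> (forall t u, s t * k t u * s u = - k t u) ->
  kapp k (fun u => s u * w u) t = - (s t * kapp k w t).
Proof.
move=> ss h; rewrite /kapp mulr_sumr -sumrN; apply: eq_bigr => u _.
rewrite -[k t u in LHS]opprK -h.
transitivity (- (s t * k t u * (s u * s u) * w u)); first by ring.
by rewrite ss; ring.
Qed.

Lemma phiE_cE p z w e : kapp (phiE p) (kapp (cE z) w) e = - kapp (cE z) (kapp (phiE p) w) e.
Proof.
rewrite phiE_app cE_app.
rewrite (kapp_ext (fun _ _ => erefl (phis p _ _)) (fun g => cE_app z w (g, e.2))) /=.
rewrite (kapp_sign_flip _ _ gsign_sqr (phis_gsign p)); congr (- (_ * _)).
rewrite (kapp_ext (w := fun f => kapp (phis p) (fun g => w (g, f)) e.1) (fun _ _ => erefl (csym z _ _))); last first.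
  by move=> f; rewrite phiE_app.
rewrite /kapp; under eq_bigr do rewrite mulr_sumr.
rewrite exchange_big /=; apply: eq_bigr => f _; rewrite mulr_sumr.
by apply: eq_bigr => g _; rewrite mulrCA.
Qed.

Lemma phiE_gE p w e : kapp (phiE p) (kapp gE w) e = - kapp gE (kapp (phiE p) w) e.
Proof.
rewrite phiE_app gE_app phiE_app.
rewrite (kapp_ext (w := fun g => gsign g * (fsign C e.2 * w (g, e.2))) (fun _ _ => erefl (phis p _ _))); last first.
  by move=> g; rewrite gE_app mulrA.
by rewrite (kapp_sign_flip _ _ gsign_sqr (phis_gsign p)) kappZ mulrA.
Qed.

Lemma cE_gE z w e : kapp (cE z) (kapp gE w) e = - kapp gE (kapp (cE z) w) e.
Proof.
rewrite cE_app gE_app cE_app.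
rewrite (kapp_ext (w := fun f => fsign C f * (gsign e.1 * w (e.1, f))) (fun _ _ => erefl (csym z _ _))); last first.
  by move=> f; rewrite gE_app; ring.
rewrite (kapp_sign_flip _ _ (@fsign_sqr _ _) (csym_sign z)) kappZ; ring.
Qed.

Lemma cE_sqn z w : sqn (kapp (cE z) w) = (\sum_l `|z l| ^+ 2) * sqn w.
Proof.
have h e : kapp (cE z) (kapp (cE z) w) e = (\sum_l `|z l| ^+ 2) * w e.
  rewrite cE_app (kapp_ext (w := fun f => gsign e.1 * kapp (csym z) (fun f => w (e.1, f)) f)
    (fun _ _ => erefl (csym z _ _))); last by move=> f; rewrite cE_app.
  by rewrite kappZ csym_sqr mulrA gsign_sqr mul1r; case: e.
rewrite !sqnE -herm_hip; last exact: cE_herm.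
rewrite /hip mulr_sumr; apply: eq_bigr => e _.
by rewrite h mulrCA.
Qed.

Lemma gE_sqn w : sqn (kapp gE w) = sqn w.
Proof.
apply: eq_bigr => e _; rewrite gE_app normrM normrM gsign_norm mul1r.
have -> : `|fsign C e.2| = 1.
  by rewrite /fsign normr_prod big1 // => i _; exact: normr_sign.
by rewrite mul1r.
Qed.

(* [phiE], [cE] and [gE] anticommute, so the square of any real combination of
   [sym0] and [sym1] is the sum of the squares. *)
Definition sym0 (p : 'I_K -> 'I_K -> C) (mu : C) : E -> E -> C :=
  fun e e' => phiE p e e' + mu * gE e e'.
Definition sym1 (z : 'I_m -> C) (mu : C) : E -> E -> C :=
  fun e e' => cE z e e' + mu * gE e e'.

Lemma sym_sqn p z mu u w : mu \is Num.real -> u \is Num.real ->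
  sqn (fun e => (1 - u) * kapp (sym0 p mu) w e + u * kapp (sym1 z mu) w e) =
  (1 - u) ^+ 2 * sqn (kapp (phiE p) w) + u ^+ 2 * ((\sum_l `|z l| ^+ 2) * sqn w)
    + mu ^+ 2 * sqn w.
Proof.
move=> mr ur; have ur' : 1 - u \is Num.real by rewrite rpredB ?rpred1.
rewrite -cE_sqn -[X in _ = _ + _ * X]gE_sqn.
rewrite -(sqn_anticomm3 (phiE_herm p) (cE_herm z) gE_herm (phiE_cE p z w)
  (phiE_gE p w) (cE_gE z w) ur' ur mr).
apply: sqn_ext => e; rewrite /sym0 /sym1 !kappDl !kappZl; ring.
Qed.

Lemma phiE_gap p (d : C) w :
  (forall v, d * sqn v <= sqn (kapp p v)) ->
  (forall v, d * sqn v <= sqn (kapp (kadj p) v)) ->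
  d * sqn w <= sqn (kapp (phiE p) w).
Proof.
move=> h h'; rewrite !sqn_pair mulr_sumr; apply: ler_sum => f _.
rewrite [X in _ <= X](sqn_ext (w := kapp (phis p) (fun g => w (g, f)))); last first.
  by move=> g; rewrite phiE_app.
exact: phis_gap.
Qed.

(** The summand of [sym0] along one basis vector of the exterior algebra is this operator, with mass
    [mu] or [- mu] according to [fsign]. *)
Definition symG (p : 'I_K -> 'I_K -> C) (mu : C) : G -> G -> C :=
  fun g g' => phis p g g' + mu * ((g == g')%:R * gsign g).

Lemma symG_app p mu w g : kapp (symG p mu) w g = kapp (phis p) w g + mu * (gsign g * w g).
Proof.
rewrite /symG kappDl kappZl; congr (_ + _ * _).
rewrite /kapp (bigD1 g) //= eqxx mul1r big1 ?addr0 //.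
by move=> g'; rewrite eq_sym => /negbTE ->; rewrite !mul0r.
Qed.

Lemma symG_sqn p mu w : mu \is Num.real ->
  sqn (kapp (symG p mu) w) = sqn (kapp (phis p) w) + mu ^+ 2 * sqn w.
Proof.
move=> mr; rewrite (sqn_ext (symG_app p mu w)).
rewrite sqnD sqnZ real_normK // hipZl hipZr (CrealP mr) -mulrDr.
have -> : sqn (fun g => gsign g * w g) = sqn w.
  by apply: eq_bigr => g _; rewrite normrM gsign_norm mul1r.
have -> : hip (kapp (phis p) w) (fun g => gsign g * w g) =
    - hip (fun g => gsign g * w g) (kapp (phis p) w).
  rewrite -herm_hip; last exact: phis_herm.
  rewrite /hip -sumrN; apply: eq_bigr => g _.
  rewrite (kapp_sign_flip _ _ gsign_sqr (phis_gsign p)) rmorphM /= gsign_conj; ring.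
by rewrite addNr mulr0 addr0.
Qed.

End Symbols.

(** In characteristic 0 the polynomial [X^n - 1] is separable, so it has [n] distinct roots, and a
    finite group of roots of unity is cyclic. *)
Lemma prim_root_exists (C : numClosedFieldType) n : (0 < n)%N ->
  exists z : C, n.-primitive_root z.
Proof.
move=> n0; have [r rE] := closed_field_poly_normal ('X^n - 1 : {poly C}).
have {}rE : 'X^n - 1 = \prod_(z <- r) ('X - z%:P).
  by rewrite [LHS]rE (monicP (monicXnsubC 1 n0)) scale1r.
have nr : all n.-unity_root r.
  by apply/allP => z; rewrite -root_prod_XsubC -rE.
have ur : uniq r.
  by rewrite -separable_prod_XsubC -rE separable_Xn_sub_1 // pnatr_eq0 -lt0n.
have szr : (n <= size r)%N.
  by rewrite -ltnS -(size_prod_XsubC r id) -rE size_XnsubC.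
by have /hasP[z _ zP] := has_prim_root n0 nr ur szr; exists z.
Qed.

(** * Coordinates, mass and substituted polynomials *)

Section Operators.
Variables (C : numClosedFieldType) (R : realType) (iota : {rmorphism R -> C}).
Hypothesis iotaC : forall c, (iota c)^* = iota c.
Variable re : C -> R.
Hypothesis reP : forall z, iota (re z) = (z + z^*) / 2.
Variable m : nat.
Local Notation J := ('I_m + 'I_m + unit)%type.
Local Notation F := {ffun 'I_m -> bool}.

Lemma real_iota z : z \is Num.real -> z = iota (re z).
Proof. by move=> zr; rewrite reP (CrealP zr); field. Qed.

Lemma iota_arch (x : C) : x \is Num.real -> exists n : nat, x <= n%:R.
Proof.
move=> /real_iota ->; exists (Num.truncn (re x)).+1.
by rewrite -(rmorph_nat iota) iota_le // ltW // truncnS_gt.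
Qed.

(** The imaginary part is expressed as [re (- 'i * z)], so that a single lemma, [quant_re],
    quantizes both kinds of coordinates. *)
Definition ucoord (z : 'I_m -> C) (tau : R) (j : J) : R :=
  match j with
  | inl (inl l) => re (z l)
  | inl (inr l) => re (- 'i * z l)
  | inr _ => tau
  end.

Lemma re_le z : iota `|re z| <= `|z|.
Proof.
rewrite -iota_norm // reP normrM normfV (ger0_norm (ler0n _ 2)).
rewrite ler_pdivrMr // mulr_natr mulr2n.
by apply: le_trans (ler_normD _ _) _; rewrite norm_conjC.
Qed.

Lemma iota_le_inv x y : iota x <= iota y -> x <= y.
Proof. by case: (leP x y) => // h; rewrite lt_geF // iota_lt. Qed.

Lemma ucoord_cube z tau : (forall l, `|z l| <= 1) -> `|tau| <= 1 -> incube (ucoord z tau).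
Proof.
move=> hz ht [[l|l]|[]] //=; apply: iota_le_inv; rewrite rmorph1.
  exact: le_trans (re_le _) (hz l).
apply: le_trans (re_le _) _.
by rewrite normrM normrN normCi mul1r.
Qed.

Lemma ucoord_large (z : 'I_m -> C) tau l r : 0 <= r -> iota (2 * r) <= `|z l| ->
  exists j, r <= `|ucoord z tau j|.
Proof.
move=> r0 h.
have [h1|h1] := leP r `|re (z l)|; first by exists (inl (inl l)).
have [h2|h2] := leP r `|re (- 'i * z l)|; first by exists (inl (inr l)).
exfalso; move: h; apply/negP; rewrite -real_ltNge ?normr_real //; last first.
  exact: iota_real.
have zE : z l = iota (re (z l)) + 'i * iota (re (- 'i * z l)).
  rewrite !reP rmorphM rmorphN /= conjCi opprK.
  have i2 : 'i * 'i = -1 :> C by rewrite -expr2 sqrCi.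
  transitivity ((z l + (z l)^* - ('i * 'i) * (z l - (z l)^*)) / 2); last by ring.
  by rewrite i2; field.
rewrite zE; apply: le_lt_trans (ler_normD _ _) _.
rewrite normrM normCi mul1r !iota_norm // mulr_natl rmorphMn mulr2n.
by apply: ltrD; apply: iota_lt.
Qed.

Section Mass.
Definition mass_exp : pexp R 'I_m :=
  PA (PC 2^-1) (psum [seq PM (PC (-1)) (PX l) | l <- enum 'I_m]).

Lemma peval_mass nu : peval nu mass_exp = 2^-1 - \sum_l nu l.
Proof.
rewrite /= peval_psum big_map big_enum -sumrN; congr (_ + _).
by apply: eq_bigr => l _ /=; rewrite mulN1r.
Qed.

(* Where the mass is small some coordinate is far from both ends of its range. *)
Lemma mass_dichotomy (nu : 'I_m -> R) : (forall l, 0 <= nu l <= 1) ->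
  8^-1 <= `|2^-1 - \sum_l nu l| \/
  exists l, (9 / (64 * m%:R)) <= nu l * (1 - nu l).
Proof.
move=> h; case: (leP 8^-1 `|2^-1 - \sum_l nu l|) => s; first by left.
right; move: s; rewrite ltr_norml => /andP[s1 s2].
have ge l : nu l <= \sum_i nu i.
  by rewrite (bigD1 l) //= lerDl sumr_ge0 // => i _; case/andP: (h i).
have S1 : 3 / 8 < \sum_i nu i by lra.
have S2 : \sum_i nu i < 5 / 8 by lra.
have m0 : 0 < m%:R :> R.
  rewrite ltr0n lt0n; apply: contraTneq S1 => m0.
  by rewrite big1 -?leNgt ?divr_ge0 // => i; have := ltn_ord i; rewrite [in X in (_ < X)%N]m0.
have [l hl] : exists l, 3 / (8 * m%:R) <= nu l.
  apply: contrapT => /forallNP no.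
  suff : \sum_i nu i <= 3 / 8 by rewrite leNgt S1.
  have -> : 3 / 8 = \sum_(i < m) 3 / (8 * m%:R) :> R.
    rewrite sumr_const card_ord -[RHS]mulr_natr; field.
    by rewrite gt_eqF.
  by apply: ler_sum => i _; have /negP := no i; rewrite -ltNge => /ltW.
exists l; have l2 : 3 / 8 <= 1 - nu l by have := ge l; lra.
have -> : 9 / (64 * m%:R) = 3 / (8 * m%:R) * (3 / 8) :> R by field; rewrite gt_eqF.
by apply: ler_pM => //; apply: divr_ge0 => //; apply: mulr_ge0 => //; exact: ltW.
Qed.
End Mass.

Lemma kev_psum (N J' : finType) (X : J' -> N -> N -> C) s n n' :
  kev iota X (psum s) n n' = \sum_(e <- s) kev iota X e n n'.
Proof.
by elim: s => [|e s IH]; rewrite ?big_nil ?big_cons /= ?rmorph0 ?mul0r // IH.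
Qed.

Lemma quant_pexp_family (J' I : finType) (P : I -> pexp R J') (eps : C) : 0 < eps ->
  exists2 eps' : C, 0 < eps' <= 1 &
  forall (N X : finType) (V : X -> N -> C) (T : J' -> N -> N -> C) (w : X -> J' -> R),
    isometry V -> (forall x, incube (w x)) ->
    (forall j, quant V (T j) (fun x => iota (w x j)) eps') ->
    forall i, quant V (kev iota T (P i)) (fun x => iota (peval (w x) (P i))) eps.
Proof.
move=> e0; have /fin_all_exists2 [d d01 hd] := fun i => quant_pexp iotaC (P i) e0.
exists (\prod_i d i).
  apply/andP; split; first by apply: prodr_gt0 => i _; case/andP: (d01 i).
  by apply: prodr_ile1 => i _; case/andP: (d01 i) => /ltW -> ->.
move=> N X V T w Vi hw hT i; apply: hd => // j; apply: quant_le (hT j).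
have /andP[di0 di1] := d01 i.
rewrite (bigD1 i) //= ler_piMr ?(ltW di0) // prodr_ile1 // => k _.
by case/andP: (d01 k) => /ltW -> ->.
Qed.

Lemma quant1_sum (X N I : finType) (V : X -> N -> C) (T : I -> N -> N -> C) (S : I -> X -> C) e :
  (forall i, quant1 V (T i) (S i) e) ->
  quant1 V (fun s t => \sum_i T i s t) (fun x => \sum_i S i x) (#|I|%:R ^+ 2 * e).
Proof.
move=> h v.
rewrite (sqn_ext (w := fun x => \sum_i (kapp V (kapp (T i) v) x - S i x * kapp V v x))); last first.
  move=> x; rewrite sumrB -mulr_suml; congr (_ - _).
  rewrite (kapp_ext (w := fun n => \sum_i kapp (T i) v n) (fun _ _ => erefl (V _ _))).
    rewrite /kapp; under eq_bigr do rewrite mulr_sumr.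
    by rewrite exchange_big.
  move=> n; rewrite /kapp; under eq_bigr do rewrite mulr_suml.
  by rewrite exchange_big.
apply: le_trans (ler_sum _ (fun x _ => sqr_sum_le _)) _.
rewrite -mulr_sumr exchange_big /= expr2 -!mulrA; apply: ler_wpM2l; first exact: ler0n.
rewrite [X in _ <= X]mulr_natl -sumr_const; apply: ler_sum => i _; exact: h.
Qed.

Lemma quant1_scale1 (X N : finType) (V : X -> N -> C) (T : N -> N -> C) S e a :
  0 <= e -> `|a| <= 1 -> quant1 V T S e ->
  quant1 V (fun s t => a * T s t) (fun x => a * S x) e.
Proof.
move=> e0 a1 h; apply: quant1_le (quant1_scale a h).
by rewrite ler_piMl // exprn_ile1.
Qed.

Lemma quant_re (X N : finType) (V : X -> N -> C) (A : N -> N -> C) z e c :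
  `|c| = 1 -> quant V A z e ->
  quant V (fun n n' => 2^-1 * (c * A n n' + c^* * kadj A n n'))
    (fun x => iota (re (c * z x))) e.
Proof.
move=> c1 h.
have H := quant_scale 2^-1 (quant_add (quant_scale c h) (quant_scale c^* (quant_adj h))).
have le : `|2^-1 : C| ^+ 2 * (2 * (`|c| ^+ 2 * e) + 2 * (`|c^*| ^+ 2 * e)) <= e.
  rewrite norm_conjC c1 expr1n !mul1r normfV (ger0_norm (ler0n _ 2)).
  by rewrite le_eqVlt; apply/orP; left; apply/eqP; field.
by apply: quant_ext (quant_le le H) => // x; rewrite reP rmorphM /= mulrC.
Qed.

End Operators.

(** * Lower bounds for the symbols *)

Section Quantized.
Variables (C : numClosedFieldType) (R : realType) (iota : {rmorphism R -> C}).
Hypothesis iotaC : forall c, (iota c)^* = iota c.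
Variable re : C -> R.
Hypothesis reP : forall z, iota (re z) = (z + z^*) / 2.
Variables (m K : nat).
Hypothesis m0 : (0 < m)%N.
Local Notation J := ('I_m + 'I_m + unit)%type.
Local Notation F := {ffun 'I_m -> bool}.
Local Notation G := (bool * 'I_K)%type.
Variables (pe : 'I_K -> 'I_K -> pexp R J) (b : 'I_K -> bool).
Definition Psym i j := psym (b i) (pe i j).
Definition Pmat (u : J -> R) : 'I_K -> 'I_K -> C := fun i j => iota (peval u (Psym i j)).
(* By [mass_dichotomy], where the mass is below 1/8 some [`|z l|] is at least
   9 / (64 m), so its real or imaginary part is at least half of that. *)
Definition rad : R := 9 / (128 * m%:R).
Variable del : R.
Hypothesis del0 : 0 < del.
Hypothesis PmatP : forall u, incube u -> (exists j, rad <= `|u j|) -> forall v,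
  iota (del ^+ 2) * sqn v <= sqn (kapp (Pmat u) v) /\
  iota (del ^+ 2) * sqn v <= sqn (kapp (kadj (Pmat u)) v).

(** [del] comes from the matrix, [rad] from the [z_l], and 1/16 from the mass in [symG_gap], which
    is at least 1/8 times a factor at least 1/2. The division by 4 in [gapa] leaves room for the
    quantization error. *)
Definition gapc : R := Num.min del (Num.min 16^-1 rad).
Definition gapa : C := iota (gapc / 4).

Lemma rad_gt0 : 0 < rad.
Proof. by rewrite divr_gt0 // mulr_gt0 // ltr0n. Qed.

Lemma gapc_gt0 : 0 < gapc.
Proof. by rewrite !lt_min del0 rad_gt0 invr_gt0 ltr0n. Qed.

Lemma gapa_gt0 : 0 < gapa.
Proof. by rewrite -(rmorph0 iota) iota_lt // divr_gt0 // gapc_gt0. Qed.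

Lemma gapc_le : [/\ gapc <= del, gapc <= 16^-1 & gapc <= rad].
Proof. by rewrite /gapc !ge_min !lexx !orbT; split. Qed.

Section Gap.
Variables (z : 'I_m -> C) (nu : 'I_m -> R).
Hypothesis nu01 : forall l, 0 <= nu l <= 1.
Hypothesis zE : forall l, `|z l| = iota (nu l * (1 - nu l)).

Let mu : R := 2^-1 - \sum_l nu l.

Lemma z_le1 l : `|z l| <= 1.
Proof.
rewrite zE -(rmorph1 iota); apply: iota_le => //.
by have := nu01 l; move: (nu l) => x /andP[x0 x1]; nra.
Qed.

Lemma gap_cases : 8^-1 <= `|mu| \/
  iota ((2 * rad) ^+ 2) <= \sum_l `|z l| ^+ 2 /\ forall tau, `|tau| <= 1 -> forall v,
    iota (del ^+ 2) * sqn v <= sqn (kapp (Pmat (ucoord re z tau)) v) /\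
    iota (del ^+ 2) * sqn v <= sqn (kapp (kadj (Pmat (ucoord re z tau))) v).
Proof.
have [h|[l h]] := mass_dichotomy nu01; [by left | right].
have r2 : iota (2 * rad) <= `|z l|.
  rewrite zE; apply: iota_le => //; apply: le_trans h.
  rewrite le_eqVlt; apply/orP; left; apply/eqP; rewrite /rad; field.
  by rewrite gt_eqF // ltr0n.
split=> [|tau t1].
  rewrite (bigD1 l) //= rmorphXn -[X in X <= _]addr0; apply: lerD.
    rewrite ler_pXn2r ?nnegrE //; apply: iota_ge0 => //.
    by rewrite mulr_ge0 // ltW // rad_gt0.
  by apply: sumr_ge0 => i _; exact: exprn_ge0.
apply: PmatP; first by apply: ucoord_cube => //; exact: z_le1.
exact: (ucoord_large iotaC reP tau (ltW rad_gt0) r2).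
Qed.

(** By anticommutation three squares add up. A mass of at least 1/8 suffices alone. Otherwise the
    matrix and [z] are both bounded below, and [(1 - t)^2 + t^2] is at least 1/2. *)
Lemma sym_gap u w : 0 <= u <= 1 -> 4 * gapa ^+ 2 * sqn w <=
  sqn (fun e => (1 - u) * kapp (sym0 (m := m) (Pmat (ucoord re z 0)) (iota mu)) w e
              + u * kapp (sym1 (K := K) z (iota mu)) w e).
Proof.
move=> /andP[u0 u1]; have ur := ger0_real u0.
have mr : iota mu \is Num.real by exact: iota_real.
rewrite sym_sqn //; have := real_iota reP ur; move: (re u) => t ut.
have [c1 c2 c3] := gapc_le; have c0 := gapc_gt0.
have -> : 4 * gapa ^+ 2 = iota (gapc ^+ 2 / 4).
  rewrite /gapa -rmorphXn -(rmorph_nat iota 4) -rmorphM; congr (iota _); by field.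
have ge0' (x : C) : x \is Num.real -> 0 <= x ^+ 2 by move=> xr; apply: real_exprn_even_ge0.
have zz0 : 0 <= \sum_l `|z l| ^+ 2 by apply: sumr_ge0 => i _; exact: exprn_ge0.
have u1r : 1 - u \is Num.real by rewrite rpredB ?rpred1.
have [h|[hz hp]] := gap_cases.
  rewrite -[X in X <= _]add0r; apply: lerD.
    by rewrite addr_ge0 // mulr_ge0 ?ge0' ?mulr_ge0 ?sqn_ge0.
  apply: ler_wpM2r; first exact: sqn_ge0.
  rewrite -rmorphXn; apply: iota_le => //.
  by rewrite -[mu ^+ 2]real_normK ?num_real //; move: (`|mu|) h => x h; nra.
rewrite -[X in X <= _]addr0; apply: lerD; last by rewrite mulr_ge0 ?ge0' ?sqn_ge0.
have := phiE_gap (m := m) w (fun v => (hp 0 (ltac:(by rewrite normr0 ler01)) v).1)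
  (fun v => (hp 0 (ltac:(by rewrite normr0 ler01)) v).2).
move=> /(ler_wpM2l (ge0' _ u1r)) hp'.
have [r gr hr] : exists2 r : R, gapc ^+ 2 <= r & iota r <= \sum_l `|z l| ^+ 2.
  exists ((2 * rad) ^+ 2) => //.
  have rp := rad_gt0; have rp2 : 0 <= 2 * rad by lra.
  by rewrite ler_pXn2r ?nnegrE ?(ltW c0) //; lra.
have hz' : u ^+ 2 * (iota r * sqn w) <= u ^+ 2 * ((\sum_l `|z l| ^+ 2) * sqn w).
  by apply: ler_wpM2l; [exact: ge0' | apply: ler_wpM2r => //; exact: sqn_ge0].
apply: le_trans (lerD hp' hz'); rewrite !mulrA -mulrDl.
apply: ler_wpM2r; first exact: sqn_ge0.
have gd : gapc ^+ 2 <= del ^+ 2 by rewrite ler_pXn2r ?nnegrE // ltW.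
have := sqr_ge0 gapc; move: (gapc ^+ 2) (del ^+ 2) gd gr => g d gd gr g0.
rewrite ut -(rmorph1 iota) -rmorphB -!rmorphXn -!rmorphM -rmorphD; apply: iota_le => //.
apply: (@le_trans _ _ ((1 - t) ^+ 2 * g + t ^+ 2 * g)); last first.
  by apply: lerD; [apply: (ler_wpM2l _ gd) | apply: (ler_wpM2l _ gr)]; exact: sqr_ge0.
by have := sqr_ge0 (2 * t - 1); nra.
Qed.

(** Where some [z_l] is large, or where [tau >= rad], the matrix is invertible, [tau] being its last
    argument. In the remaining region [1 - tau >= 1/2] and the mass is at least 1/8. This is why the
    mass may be switched off while [tau] grows. *)
Lemma symG_gap tau w : 0 <= tau <= 1 -> 16 * gapa ^+ 2 * sqn w <=
  sqn (kapp (symG (Pmat (ucoord re z tau)) (iota ((1 - tau) * mu))) w).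
Proof.
move=> /andP[t0 t1]; have mr : iota ((1 - tau) * mu) \is Num.real by exact: iota_real.
rewrite symG_sqn //.
have [c1 c2 c3] := gapc_le; have c0 := gapc_gt0.
have -> : 16 * gapa ^+ 2 = iota (gapc ^+ 2).
  rewrite /gapa -rmorphXn -(rmorph_nat iota 16) -rmorphM; congr (iota _); by field.
have t1' : `|tau| <= 1 by rewrite ger0_norm.
have d2 : iota (gapc ^+ 2) <= iota (del ^+ 2).
  by apply: iota_le => //; rewrite ler_pXn2r ?nnegrE // ltW.
have big (hp : forall v, iota (del ^+ 2) * sqn v <= sqn (kapp (Pmat (ucoord re z tau)) v) /\
    iota (del ^+ 2) * sqn v <= sqn (kapp (kadj (Pmat (ucoord re z tau))) v)) :
    iota (gapc ^+ 2) * sqn w <= sqn (kapp (phis (Pmat (ucoord re z tau))) w) +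
     iota ((1 - tau) * mu) ^+ 2 * sqn w.
  rewrite -[X in X <= _]addr0; apply: lerD; last first.
    by rewrite mulr_ge0 ?sqn_ge0 // real_exprn_even_ge0.
  apply: le_trans (ler_wpM2r (sqn_ge0 w) d2) _.
  exact: phis_gap (fun v => (hp v).1) (fun v => (hp v).2).
have [h|[hz hp]] := gap_cases; last exact: big (hp _ t1').
have [tr|tr] := leP rad tau.
  apply: big; apply: PmatP; first by apply: ucoord_cube => //; exact: z_le1.
  by exists (inr tt); rewrite /= ger0_norm.
rewrite -[X in X <= _]add0r; apply: lerD; first exact: sqn_ge0.
apply: ler_wpM2r; first exact: sqn_ge0.
rewrite -rmorphXn; apply: iota_le => //; rewrite exprMn -[mu ^+ 2]real_normK ?num_real //.
have r2 : rad <= 2^-1.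
  rewrite /rad ler_pdivrMr ?mulr_gt0 ?ltr0n //.
  have : (1 : R) <= m%:R by rewrite ler1n.
  by lra.
have m2 : 64^-1 <= `|mu| ^+ 2 by move: (`|mu|) h => x h; nra.
have t2 : 4^-1 <= (1 - tau) ^+ 2 by nra.
apply: (@le_trans _ _ (4^-1 * 64^-1)); first by nra.
by apply: ler_pM => //; rewrite invr_ge0.
Qed.
End Gap.

End Quantized.

(** * The operators, their symmetries and their inertias *)

Section Hamiltonians.
Variables (C : numClosedFieldType) (R : realType) (iota : {rmorphism R -> C}).
Hypothesis iotaC : forall c, (iota c)^* = iota c.
Variable re : C -> R.
Hypothesis reP : forall z, iota (re z) = (z + z^*) / 2.
Variables (m K : nat).
Hypothesis m0 : (0 < m)%N.
Local Notation J := ('I_m + 'I_m + unit)%type.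
Local Notation F := {ffun 'I_m -> bool}.
Local Notation G := (bool * 'I_K)%type.
Variables (pe : 'I_K -> 'I_K -> pexp R J) (b : 'I_K -> bool).
Variables (q l : nat) (om : C).
Hypotheses (q0 : (0 < q)%N) (l0 : (0 < l)%N) (qe : ~~ odd q) (omP : q.-primitive_root om).
Local Notation N := {ffun 'I_m -> 'I_q}.
Local Notation X := {ffun 'I_m -> 'I_(q + l) * 'I_q}.
Local Notation V := (Vm iota (l := l) om (m := m) : X -> N -> C).
Local Notation A := (Am iota (q := q) (m := m)).
Local Notation Pm := (Pmat iota pe b).

Definition zx (x : X) (i : 'I_m) : C := zsym iota om (x i).
Definition nux (x : X) (i : 'I_m) : R := lev R q (x i).1.
Definition mux (x : X) : R := 2^-1 - \sum_i nux x i.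

Definition Xop (tau : R) (j : J) : N -> N -> C :=
  match j with
  | inl (inl i) => fun n n' => 2^-1 * (1 * A i n n' + 1^* * kadj (A i) n n')
  | inl (inr i) => fun n n' => 2^-1 * (- 'i * A i n n' + (- 'i)^* * kadj (A i) n n')
  | inr _ => fun n n' => iota tau * (n == n')%:R
  end.
Definition Top tau i j : N -> N -> C := kev iota (Xop tau) (Psym pe b i j).
Definition muop : N -> N -> C := kev iota (Nm iota (q := q) (m := m)) (mass_exp R m).

Lemma nux01 x i : 0 <= nux x i <= 1.
Proof. by apply: frac01 => //; exact: geq_minr. Qed.

Lemma zx_norm x i : `|zx x i| = iota (nux x i * (1 - nux x i)).
Proof.
rewrite /zx /zsym normrM (omX_norm q0 omP) mulr1 iota_norm // ger0_norm //.
by have /andP[] := amp01 R q0 (geq_minr (x i).1 q).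
Qed.

Lemma quant_Xop tau j e : iota (werr R q l) <= e ->
  quant V (Xop tau j) (fun x => iota (ucoord re (zx x) tau j)) e.
Proof.
move=> le; case: j => [[i|i]|[]] /=.
- have h := quant_re reP (normr1 _) (quant_Am iotaC q0 l0 omP i).
  by apply: quant_ext (quant_le le h) => // x; rewrite mul1r.
- have n1 : `|- 'i : C| = 1 by rewrite normrN normCi.
  exact: quant_le le (quant_re reP n1 (quant_Am iotaC q0 l0 omP i)).
- apply: (@quant_le _ _ _ _ _ _ (`|iota tau| ^+ 2 * 0)).
    rewrite mulr0; apply: le_trans le; apply: iota_ge0 => //.
    by rewrite addr_ge0 ?sqr_ge0 // divr_ge0.
  by apply: quant_ext (quant_scale (iota tau) (quant_id V)) => // x; rewrite mulr1.
Qed.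

Lemma muopE n n' : muop n n' = (n == n')%:R * iota (2^-1 - \sum_i (n i)%:R / q%:R).
Proof.
rewrite /muop /mass_exp /= kev_psum big_map big_enum /=.
have e i : kmul (fun s t : N => iota (-1) * (s == t)%:R) (Nm iota i) n n' =
    (n == n')%:R * - iota ((n i)%:R / q%:R).
  rewrite kev_PC_mul rmorphN1 mulN1r /Nm ksiteE /num1.
  have -> : (n == n') = (n i == n' i) && [forall i0, (i0 != i) ==> (n i0 == n' i0)].
    apply/eqP/andP => [->|[/eqP h1 /forallP h2]].
      by split=> //; apply/forallP => k; apply/implyP.
    apply/ffunP => k; have [->//|nk] := eqVneq k i.
    exact/eqP/(implyP (h2 k)).
  by rewrite -mulnb natrM; ring.
under eq_bigr do rewrite e.
by rewrite -mulr_sumr mulrC -mulrDr sumrN rmorphB rmorph_sum.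
Qed.

Lemma A_sign i n n' : nsign C n * A i n n' * nsign C n' = - A i n n'.
Proof.
pose f : F := [ffun=> false].
have := ctermE iotaC q0 i (n, f) (n', fflip i f).
rewrite /cterm /= ffunE eqxx mulr1 => ->.
have [h|h] := boolP (interior (n, f) i); last first.
  by rewrite (amp_boundary R q0 h) rmorph0 mul0r mulr0 mul0r oppr0.
have [e|_] := eqVneq (n', fflip i f) (nflip i (n, f)); last by rewrite !mulr0 mul0r oppr0.
have -> : n' = (nflip i (n, f)).1 by rewrite -e.
by rewrite nsign_flip // mulrN mulrAC nsign_sqr mul1r.
Qed.

(** The shifts change the parity of the levels, but the scalar [tau] commutes with [nsign]. Only at
    [tau = 0] does conjugation by [nsign] act as [u |-> - u]. *)
Lemma Xop_sign j n n' : nsign C n * Xop 0 j n n' * nsign C n' = - Xop 0 j n n'.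
Proof.
have Aadj i : nsign C n * kadj (A i) n n' * nsign C n' = - kadj (A i) n n'.
  have := A_sign i n' n => /(congr1 Num.conj); rewrite !rmorphM rmorphN /= !nsign_conj => <-.
  by rewrite /kadj; ring.
case: j => [[i|i]|[]] /=; last by rewrite rmorph0 !mul0r mulr0 mul0r oppr0.
- transitivity (2^-1 * (1 * (nsign C n * A i n n' * nsign C n') +
     1^* * (nsign C n * kadj (A i) n n' * nsign C n'))); first by ring.
  by rewrite A_sign Aadj; ring.
- transitivity (2^-1 * (- 'i * (nsign C n * A i n n' * nsign C n') +
     (- 'i)^* * (nsign C n * kadj (A i) n n' * nsign C n'))); first by ring.
  by rewrite A_sign Aadj; ring.
Qed.

Lemma Top_sign i j n n' :
  nsign C n * Top 0 i j n n' * nsign C n' = (-1) ^+ b i * Top 0 i j n n'.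
Proof. exact: (kev_psym iota (@nsign_sqr _ _ _) Xop_sign). Qed.

Definition Pt tau (g g' : G) : N -> N -> C :=
  offdiag (fun _ _ => 0) (Top tau) (fun i j => kadj (Top tau j i)) g g'.

Lemma Pt_herm tau g g' n n' : Pt tau g' g n' n = (Pt tau g g' n n')^*.
Proof.
by case: g g' => [[] i] [[] j]; rewrite /Pt /offdiag /kadj /= ?conjCK ?conjC0.
Qed.

Lemma Pt_gsign tau g g' n n' : gsign C g * Pt tau g g' n n' * gsign C g' = - Pt tau g g' n n'.
Proof.
case: g g' => [[] i] [[] j]; rewrite /Pt /offdiag /gsign /= ?expr1 ?expr0;
  by rewrite ?mulr0 ?mul0r ?oppr0 // ?mulN1r ?mul1r ?mulr1 ?mulrN1.
Qed.

(** The rows of the matrix are the indices [(true, i)] and carry its parities; the columns are the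
    indices [(false, j)], on which the parity is trivial. *)
Definition piE (g : G) : C := if g.1 then (-1) ^+ b g.2 else 1.

Lemma piE_sqr g : piE g * piE g = 1.
Proof. by rewrite /piE; case: (g.1); rewrite ?mulr1 ?signb_sqr. Qed.
Lemma piE_conj g : (piE g)^* = piE g.
Proof. by rewrite /piE; case: (g.1); rewrite ?conjC1 ?signb_conj. Qed.

Lemma Pt_sign g g' n n' :
  (nsign C n * piE g) * Pt 0 g g' n n' * (nsign C n' * piE g') = Pt 0 g g' n n'.
Proof.
have h i j (s s' : N) : nsign C s * (-1) ^+ b i * Top 0 i j s s' * nsign C s' = Top 0 i j s s'.
  transitivity ((-1) ^+ b i * (nsign C s * Top 0 i j s s' * nsign C s')); first by ring.
  by rewrite Top_sign mulrA signb_sqr mul1r.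
case: g g' => [[] i] [[] j]; rewrite /Pt /offdiag /piE /= ?mulr0 ?mul0r // !mulr1.
  exact: h.
rewrite /kadj -[in RHS]h !rmorphM /= !nsign_conj signb_conj; ring.
Qed.

Section Reduced.
(* At [tau = 0] this is [Rphi] up to the grading; at [tau = 1] the mass is gone and
   the operator is odd, so its spectrum is symmetric. *)
Definition LGb tau (g g' : G) : N -> N -> C := fun n n' =>
  Pt tau g g' n n' + (g == g')%:R * gsign C g * (iota (1 - tau) * muop n n').
Definition LG tau : N * G -> N * G -> C := kblock (LGb tau).

Lemma muop_herm n n' : muop n' n = (muop n n')^*.
Proof.
rewrite !muopE rmorphM rmorph_nat /= iotaC eq_sym.
by case: eqP => [->|]; rewrite ?mul0r.
Qed.

Lemma LG_herm tau : herm (LG tau).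
Proof.
move=> [n g] [n' g']; rewrite /LG /kblock /LGb /= !(rmorphD (@Num.conj C)) /= -Pt_herm; congr (_ + _).
have cM (x y : C) : (x * y)^* = x^* * y^* by rewrite rmorphM.
rewrite !cM iotaC -muop_herm gsign_conj rmorph_nat eq_sym.
by case: eqP => [->|]; rewrite ?mul0r.
Qed.

Definition Sg (s : N * G) : C := nsign C s.1 * piE s.2.

Lemma Sg_sqr s : Sg s * Sg s = 1.
Proof. by rewrite /Sg mulrACA nsign_sqr piE_sqr mulr1. Qed.
Lemma Sg_conj s : (Sg s)^* = Sg s.
Proof. by rewrite /Sg rmorphM /= nsign_conj piE_conj. Qed.

Lemma LG_sign s t : Sg s * LG 0 s t * Sg t = LG 0 s t.
Proof.
case: s t => [n g] [n' g']; rewrite /LG /kblock /LGb /= mulrDr mulrDl Pt_sign; congr (_ + _).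
have [->|_] := eqVneq g g'; last by rewrite !mul0r mulr0 mul0r.
rewrite muopE; have [->|_] := eqVneq n n'; last by rewrite !mul0r !mulr0 mul0r.
by rewrite mulrAC Sg_sqr mul1r.
Qed.

Lemma herm_sign (T : finType) (L : T -> T -> C) (s : T -> C) :
  herm L -> (forall t, (s t)^* = s t) -> (forall t, s t * s t = 1) ->
  (forall t u, s t * L t u * s u = L t u) -> herm (fun t u => s t * L t u).
Proof.
move=> hL sC s2 h t u; rewrite rmorphM /= sC -hL -[in RHS](h u t).
transitivity ((s t * s t) * (s u * L u t)); first by rewrite s2 mul1r.
by ring.
Qed.

Definition Rphi : N * G -> N * G -> C := fun s t => Sg s * LG 0 s t.

Lemma Rphi_herm : herm Rphi.
Proof. exact: herm_sign (LG_herm 0) Sg_conj Sg_sqr LG_sign. Qed.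

Lemma Rphi_sqn v : sqn (kapp Rphi v) = sqn (kapp (LG 0) v).
Proof.
apply: eq_bigr => s _.
have -> : kapp Rphi v s = Sg s * kapp (LG 0) v s.
  by rewrite /kapp mulr_sumr; apply: eq_bigr => t _; rewrite mulrA.
have -> : `|Sg s * kapp (LG 0) v s| = `|Sg s| * `|kapp (LG 0) v s| by rewrite normrM.
suff -> : `|Sg s| = 1 by rewrite mul1r.
have /(congr1 Num.norm) := Sg_sqr s; rewrite normrM normr1 => /eqP.
by rewrite -expr2 pexpr_eq1 // => /eqP.
Qed.
End Reduced.

Section Full.
Local Notation E := (G * F)%type.
Definition L0b (e e' : E) : N -> N -> C := fun n n' =>
  (e.2 == e'.2)%:R * Pt 0 e.1 e'.1 n n' +
  (e == e')%:R * (gsign C e.1 * fsign C e.2) * muop n n'.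
Definition L0 : N * E -> N * E -> C := kblock L0b.
Definition L1 : N * E -> N * E -> C := fun s t =>
  (s.2.1 == t.2.1)%:R * (gsign C s.2.1 * Bk iota (s.1, s.2.2) (t.1, t.2.2)).
Definition Pi (s : N * E) : C := nsign C s.1 * piE s.2.1 * fsign C s.2.2.

Lemma Pi_sqr s : Pi s * Pi s = 1.
Proof.
rewrite /Pi; transitivity ((nsign C s.1 * nsign C s.1) * (piE s.2.1 * piE s.2.1) *
  (fsign C s.2.2 * fsign C s.2.2)); first by ring.
by rewrite nsign_sqr piE_sqr fsign_sqr !mulr1.
Qed.
Lemma Pi_conj s : (Pi s)^* = Pi s.
Proof. by rewrite /Pi !rmorphM /= nsign_conj piE_conj fsign_conj. Qed.
Lemma Pi_norm s : `|Pi s| = 1.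
Proof.
have /(congr1 Num.norm) := Pi_sqr s; rewrite normrM normr1 => /eqP.
by rewrite -expr2 pexpr_eq1 // => /eqP.
Qed.

Lemma L0_herm : herm L0.
Proof.
have cM (x y : C) : (x * y)^* = x^* * y^* by rewrite rmorphM.
move=> [n [g f]] [n' [g' f']]; rewrite /L0 /kblock /L0b /= !(rmorphD (@Num.conj C)) /=.
rewrite !cM -Pt_herm -muop_herm gsign_conj fsign_conj !rmorph_nat [f' == f]eq_sym.
congr (_ + _); rewrite [(g', f') == _]eq_sym.
by case: eqP => [[-> ->]|]; rewrite ?mul0r.
Qed.

Lemma L0_sign s t : Pi s * L0 s t * Pi t = L0 s t.
Proof.
case: s t => [n [g f]] [n' [g' f']]; rewrite /L0 /kblock /L0b /= mulrDr mulrDl; congr (_ + _).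
  have [->|_] := eqVneq f f'; last by rewrite !mul0r mulr0 mul0r.
  rewrite /Pi /=; transitivity ((fsign C f' * fsign C f') *
    (nsign C n * piE g * Pt 0 g g' n n' * (nsign C n' * piE g'))); first by ring.
  by rewrite Pt_sign fsign_sqr.
have [[-> ->]|_] := eqVneq (g, f) (g', f'); last by rewrite !mul0r mulr0 mul0r.
rewrite muopE; have [->|_] := eqVneq n n'; last by rewrite !mul0r !mulr0 mul0r.
by rewrite mulrAC Pi_sqr mul1r.
Qed.

Lemma L1_herm : herm L1.
Proof.
have cM (x y : C) : (x * y)^* = x^* * y^* by rewrite rmorphM.
move=> [n [g f]] [n' [g' f']]; rewrite /L1 /= !cM -Bk_herm // gsign_conj rmorph_nat eq_sym.
by case: eqP => [->|]; rewrite ?mul0r.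
Qed.

Lemma L1_sign s t : Pi s * L1 s t * Pi t = L1 s t.
Proof.
case: s t => [n [g f]] [n' [g' f']]; rewrite /L1 /=.
have [->|_] := eqVneq g g'; last by rewrite !mul0r mulr0 mul0r.
rewrite /Pi /=; transitivity ((piE g' * piE g') * gsign C g' *
  (csign C (n, f) * Bk iota (n, f) (n', f') * csign C (n', f'))).
  rewrite /csign /=; ring.
by rewrite Bk_csign // piE_sqr; ring.
Qed.

Lemma PiL0_herm : herm (fun s t => Pi s * L0 s t).
Proof. exact: herm_sign L0_herm Pi_conj Pi_sqr L0_sign. Qed.
Lemma PiL1_herm : herm (fun s t => Pi s * L1 s t).
Proof. exact: herm_sign L1_herm Pi_conj Pi_sqr L1_sign. Qed.

(** [Pi L1] splits over [G] into copies of [Rc] with sign [piE g * gsign g]. The sign is -1 exactly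
    at the even rows of the matrix, where the inertia [(p, p + 2)] is reversed. *)
Lemma inertia_L1 : exists2 p, (p + p.+2 = (q * 2) ^ m)%N &
  exists r, inertia (fun s t => Pi s * L1 s t)
    (K * p + \sum_i (if b i then p else p.+2))%N r.
Proof.
have [p hp] := Rc_inertia iotaC q0 m0 qe.
exists p.
  by case: hp => _ _ ->; rewrite card_prod !card_ffun card_bool !card_ord expnMn.
pose eta (g : G) := if g.1 && ~~ b g.2 then true else false.
pose ks (g : G) := fun s t : N * F => (piE g * gsign C g) * Rc iota s t.
have hks g : inertia (ks g) (if eta g then p.+2 else p) (if eta g then p else p.+2).
  have e : piE g * gsign C g = if eta g then -1 else 1.
    rewrite /piE /gsign /eta; case: g => [[] i] /=; rewrite ?mulr1 //.
    by case: (b i); rewrite /= ?expr0 expr1 ?mul1r ?mulrNN ?mulr1.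
  rewrite /ks e; case: (eta g).
    by apply: inertia_ext (inertia_opp hp) => s t; rewrite /kopp mulN1r.
  by apply: inertia_ext hp => s t; rewrite mul1r.
pose f (p : (N * F) * G) : N * E := (p.1.1, (p.2, p.1.2)).
pose g (s : N * E) : (N * F) * G := ((s.1, s.2.2), s.2.1).
have fK : cancel f g by case=> [[]].
have gK : cancel g f by case=> [n []].
exists (\sum_g (if eta g then p else p.+2))%N.
have -> : (K * p + \sum_i (if b i then p else p.+2) = \sum_g (if eta g then p.+2 else p))%N.
  rewrite (eq_bigr (fun g => if eta (g.1, g.2) then p.+2 else p)); last by case.
  rewrite -(pair_bigA _ (fun x i => if eta (x, i) then p.+2 else p)) /= big_bool /= addnC.
  rewrite /eta /= sum_nat_const card_ord; congr (_ + _)%N.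
  by apply: eq_bigr => i _; case: (b i).
apply: (inertia_sum fK gK _ hks) => -[n f1] g1 [n' f'] g'.
rewrite /f /L1 /Pi /ks /Rc /csign /=; have [->|_] := eqVneq g1 g'; last by rewrite !mul0r mulr0.
ring.
Qed.

(** [Pi L0] splits over the subsets [f]. When [fsign f = -1], conjugation by the grading reverses
    the off-diagonal part and keeps the mass, so all [2 ^ m] summands have the inertia of [Rphi]. *)
Lemma inertia_L0 p r : inertia Rphi p r ->
  inertia (fun s t => Pi s * L0 s t) (2 ^ m * p) (2 ^ m * r).
Proof.
move=> hp.
pose ks (f : F) := fun s t : N * G => Sg s *
  (fsign C f * Pt 0 s.2 t.2 s.1 t.1 + (s.2 == t.2)%:R * gsign C s.2 * muop s.1 t.1).
have hks f : inertia (ks f) p r.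
  have [e|e] : fsign C f = 1 \/ fsign C f = -1.
    have /eqP := fsign_sqr C f; rewrite -expr2 sqrf_eq1.
    by case/orP => /eqP; [left|right].
    apply: inertia_ext hp => -[n g] [n' g'].
    by rewrite /ks /Rphi /LG /kblock /LGb /= e mul1r subr0 rmorph1 mul1r.
  apply: (inertia_scale (d := fun s => gsign C s.2) (l := Rphi) _ hp) => -[n g] [n' g'].
  rewrite /ks /Rphi /LG /kblock /LGb /= e gsign_conj subr0 rmorph1 mul1r.
  transitivity (Sg (n, g) * (- (gsign C g * Pt 0 g g' n n' * gsign C g') +
    (gsign C g * gsign C g) * ((g == g')%:R * gsign C g' * muop n n'))); last by ring.
  rewrite Pt_gsign opprK gsign_sqr mul1r.
  by have [->|_] := eqVneq g g'; rewrite ?mul0r.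
pose f (p : (N * G) * F) : N * E := (p.1.1, (p.1.2, p.2)).
pose g (s : N * E) : (N * G) * F := ((s.1, s.2.1), s.2.2).
have fK : cancel f g by case=> [[]].
have gK : cancel g f by case=> [n []].
have c k : (2 ^ m * k = \sum_(f : F) k)%N.
  by rewrite sum_nat_const card_ffun card_bool card_ord.
rewrite !c; apply: (inertia_sum fK gK _ hks) => -[n g1] f1 [n' g'] f'.
rewrite /f /L0 /kblock /L0b /Pi /ks /Sg /= xpair_eqE.
have [->|_] := eqVneq f1 f'; last by rewrite andbF !mul0r addr0 mulr0.
rewrite andbT !mul1r.
transitivity (nsign C n * piE g1 * (fsign C f' * Pt 0 g1 g' n n' + (fsign C f' * fsign C f') * ((g1 == g')%:R * gsign C g1 * muop n n'))); first by ring.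
by rewrite fsign_sqr mul1r.
Qed.

End Full.
End Hamiltonians.

(** * Comparison of the inertias *)

Section PexpLipschitz.
Variables (R : realType) (J : finType).
Implicit Type e : pexp R J.

Lemma peval_le e : exists2 B : R, 0 <= B &
  forall u : J -> R, incube u -> `|peval u e| <= B.
Proof.
elim: e => [c|j|e1 [B1 b1 h1] e2 [B2 b2 h2]|e1 [B1 b1 h1] e2 [B2 b2 h2]].
- by exists `|c|.
- by exists 1 => // u; exact.
- exists (B1 + B2) => [|u hu]; first exact: addr_ge0.
  by apply: le_trans (ler_normD _ _) _; apply: lerD; [exact: h1 | exact: h2].
- exists (B1 * B2) => [|u hu]; first exact: mulr_ge0.
  by rewrite /= normrM; apply: ler_pM => //; [exact: h1 | exact: h2].
Qed.

Lemma peval_lipschitz e : exists2 L : R, 0 <= L &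
  forall u v d, incube u -> incube v -> (forall j, `|u j - v j| <= d) ->
    `|peval u e - peval v e| <= L * d.
Proof.
elim: e => [c|j|e1 [L1 l1 h1] e2 [L2 l2 h2]|e1 [L1 l1 h1] e2 [L2 l2 h2]].
- by exists 0 => // u v d _ _ _; rewrite /= subrr normr0 mul0r.
- by exists 1 => // u v d _ _ h; rewrite mul1r; exact: h.
- exists (L1 + L2) => [|u v d hu hv h]; first exact: addr_ge0.
  rewrite /= opprD addrACA mulrDl; apply: le_trans (ler_normD _ _) _.
  by apply: lerD; [exact: h1 | exact: h2].
- have [B1 b1 k1] := peval_le e1; have [B2 b2 k2] := peval_le e2.
  exists (L1 * B2 + B1 * L2) => [|u v d hu hv h]; first by rewrite addr_ge0 ?mulr_ge0.
  have -> : peval u (PM e1 e2) - peval v (PM e1 e2) =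
    (peval u e1 - peval v e1) * peval u e2 + peval v e1 * (peval u e2 - peval v e2).
    by rewrite /=; ring.
  rewrite [X in _ <= X]mulrDl; apply: le_trans (ler_normD _ _) _; apply: lerD; rewrite normrM.
    rewrite mulrAC; apply: ler_pM => //; [exact: h1 | exact: k2].
  by rewrite -mulrA; apply: ler_pM => //; [exact: k1 | exact: h2].
Qed.

Lemma peval_lipschitz_family (I : finType) (P : I -> pexp R J) : exists2 L : R, 0 <= L &
  forall i u v d, incube u -> incube v -> 0 <= d -> (forall j, `|u j - v j| <= d) ->
    `|peval u (P i) - peval v (P i)| <= L * d.
Proof.
have /fin_all_exists2 [L L0 hL] := fun i => peval_lipschitz (P i).
exists (\sum_i L i) => [|i u v d hu hv d0 h]; first exact: sumr_ge0.
apply: le_trans (hL i u v d hu hv h) _; apply: ler_wpM2r => //.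
by rewrite (bigD1 i) //= lerDl sumr_ge0.
Qed.
End PexpLipschitz.

Section Obstruction.
Variables (C : numClosedFieldType) (R : realType) (iota : {rmorphism R -> C}).
Hypothesis iotaC : forall c, (iota c)^* = iota c.
Variable re : C -> R.
Hypothesis reP : forall z, iota (re z) = (z + z^*) / 2.
Variables (m K : nat).
Hypothesis m0 : (0 < m)%N.
Local Notation J := ('I_m + 'I_m + unit)%type.
Local Notation F := {ffun 'I_m -> bool}.
Local Notation G := (bool * 'I_K)%type.
Local Notation E := (G * F)%type.
Variables (pe : 'I_K -> 'I_K -> pexp R J) (b : 'I_K -> bool).
Local Notation Pm := (Pmat iota pe b).
Variable del : R.
Hypothesis del0 : 0 < del.
Hypothesis PmatP : forall u, incube u -> (exists j, rad R m <= `|u j|) -> forall v,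
  iota (del ^+ 2) * sqn v <= sqn (kapp (Pm u) v) /\
  iota (del ^+ 2) * sqn v <= sqn (kapp (kadj (Pm u)) v).
Local Notation a := (gapa iota m del).

Section Model.
Variables (q l : nat) (om : C).
Hypotheses (q0 : (0 < q)%N) (l0 : (0 < l)%N) (qe : ~~ odd q) (omP : q.-primitive_root om).
Local Notation N := {ffun 'I_m -> 'I_q}.
Local Notation X := {ffun 'I_m -> 'I_(q + l) * 'I_q}.
Local Notation V := (Vm iota (l := l) om (m := m) : X -> N -> C).
Local Notation A := (Am iota (q := q) (m := m)).
Local Notation zx := (zx iota om).
Local Notation muo := (@muop C R iota m q).
Local Notation Top := (Top iota pe b).
Variable e0 : C.
Hypothesis e00 : 0 <= e0.
Hypothesis HT : forall tau, 0 <= tau <= 1 -> forall i j,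
  quant V (Top tau i j) (fun x => Pm (ucoord re (zx x) tau) i j) e0.
Hypothesis HM : quant V (muo) (fun x => iota (mux R x)) e0.
Hypothesis HA : forall i, quant V (A i) (fun x => zx x i) e0.
Hypothesis Hsh : forall f : F, `|iota ((\sum_i f i)%N%:R / q%:R)| ^+ 2 <= e0.

Let Viso : isometry V := isometry_Vm iotaC q0 l0 omP (m := m).

Lemma quant_Pt tau g g' : 0 <= tau <= 1 ->
  quant1 V (Pt iota pe b tau g g') (fun x => phis (Pm (ucoord re (zx x) tau)) g g') e0.
Proof.
move=> t01; case: g g' => [[] i] [[] j]; rewrite /Pt /phis /offdiag /=.
- move=> v; rewrite /sqn big1 ?mulr_ge0 ?sqn_ge0 // => x _.
  rewrite mul0r subr0 /kapp big1 ?normr0 ?expr0n // => n _.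
  by rewrite big1 ?mulr0 // => n' _; rewrite mul0r.
- by have [] := HT t01 i j.
- by have [] := HT t01 j i.
- move=> v; rewrite /sqn big1 ?mulr_ge0 ?sqn_ge0 // => x _.
  rewrite mul0r subr0 /kapp big1 ?normr0 ?expr0n // => n _.
  by rewrite big1 ?mulr0 // => n' _; rewrite mul0r.
Qed.

Lemma norm_nat_bool_mul (c : bool) (s : C) : `|s| <= 1 -> `|c%:R * s| <= 1.
Proof. by case: c => h; rewrite ?mul1r ?mul0r ?normr0 ?ler01. Qed.

Lemma fsign_norm (f : F) : `|fsign C f| = 1.
Proof. by rewrite /fsign normr_prod big1 // => i _; exact: normr_sign. Qed.

Lemma quantE_L0 : quantE V (L0 iota pe b (q := q))
  (fun x => sym0 (Pm (ucoord re (zx x) 0)) (iota (mux R x))) (#|{: E}|%:R ^+ 2 * (4 * e0)).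
Proof.
apply: (@quant_blocks _ _ _ _ _ (L0b iota pe b (q := q))) => e e'.
have h1 := quant1_scale1 (a := (e.2 == e'.2)%:R) e00 _ (quant_Pt e.1 e'.1 (tau := 0) _).
have h2 := quant1_scale1 (a := (e == e')%:R * (gsign C e.1 * fsign C e.2)) e00 _ HM.1.
have t0 : 0 <= (0 : R) <= 1 by apply/andP; split; [exact: lexx | exact: ler01].
have c1 : `|(e.2 == e'.2)%:R : C| <= 1 by case: (e.2 == _); rewrite ?normr1 ?normr0.
have c2 : `|(e == e')%:R * (gsign C e.1 * fsign C e.2)| <= 1.
  by apply: norm_nat_bool_mul; rewrite normrM gsign_norm fsign_norm mulr1.
have -> : 4 * e0 = 2 * e0 + 2 * e0 by ring.
apply: quant1_ext (quant1_add (h1 c1 t0) (h2 c2)) => // x.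
by rewrite /sym0 /phiE /gE mulrC; ring.
Qed.

Lemma quantE_LG tau : 0 <= tau <= 1 -> quantE V (LG iota pe b (q := q) tau)
  (fun x => symG (Pm (ucoord re (zx x) tau)) (iota ((1 - tau) * mux R x)))
  (#|{: G}|%:R ^+ 2 * (4 * e0)).
Proof.
move=> t01; apply: (@quant_blocks _ _ _ _ _ (LGb iota pe b (q := q) tau)) => g g'.
have h1 := quant_Pt g g' t01.
have h2 := quant1_scale1 (a := (g == g')%:R * (gsign C g * iota (1 - tau))) e00 _ HM.1.
have c2 : `|(g == g')%:R * (gsign C g * iota (1 - tau))| <= 1.
  apply: norm_nat_bool_mul; rewrite normrM gsign_norm mul1r iota_norm //.
  rewrite -(rmorph1 iota) iota_le //; move: t01 => /andP[t0 t1].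
  by rewrite ger0_norm ?subr_ge0 // lerBlDr lerDl.
have -> : 4 * e0 = 2 * e0 + 2 * e0 by ring.
apply: quant1_ext (quant1_add h1 (h2 c2)) => [s t|x].
  by rewrite /LGb; congr (_ + _); ring.
have -> : iota ((1 - tau) * mux R x) = iota (1 - tau) * iota (mux R x) by rewrite rmorphM.
by rewrite /symG; congr (_ + _); ring.
Qed.

Lemma quantE_ext (E' : finType) L L' (S S' : X -> E' -> E' -> C) r :
  (forall s t, L s t = L' s t) -> (forall x e e', S x e e' = S' x e e') ->
  quantE V L S r -> quantE V L' S' r.
Proof.
move=> hL hS h v; apply: le_trans (h v); rewrite le_eqVlt; apply/orP; left; apply/eqP.
apply: sqn_ext => p; rewrite /klift /symapp; congr (_ - _).
  by apply: kapp_ext => // n; exact: kapp_ext.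
exact: kapp_ext.
Qed.

(** This absorbs the difference between the mass of [L1], taken at [n + f], and [muop], taken at
    [n]: for each [f] it is a scalar of size at most [m / q]. *)
Lemma quant1_shift T S c : quant1 V T S e0 -> `|c| ^+ 2 <= e0 ->
  quant1 V (fun s t => T s t + c * (s == t)%:R) S (4 * e0).
Proof.
move=> h ce.
have hc : quant1 V (fun s t => c * (s == t)%:R) (fun _ => 0) e0.
  move=> v; rewrite (sqn_ext (w := fun x => c * kapp V v x)) ?sqnZ ?Viso.
    by apply: ler_wpM2r => //; exact: sqn_ge0.
  move=> x; rewrite mul0r subr0 -kappZ; apply: kapp_ext => // n.
  rewrite kappZl; congr (_ * _); rewrite /kapp (bigD1 n) //= eqxx mul1r big1 ?addr0 //.
  by move=> n' /negbTE nn; rewrite eq_sym nn mul0r.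
have -> : 4 * e0 = 2 * e0 + 2 * e0 by ring.
by apply: quant1_ext (quant1_add h hc) => // x; rewrite addr0.
Qed.

Definition L1b (e e' : E) : N -> N -> C := fun n n' =>
  (e.1 == e'.1)%:R * gsign C e.1 *
    \sum_i (kappa C i e.2 * (e'.2 == fflip i e.2)%:R) *
      (if e.2 i then kadj (A i) else A i) n n' +
  (e == e')%:R * (gsign C e.1 * fsign C e.2) *
    (muo n n' + - iota ((\sum_i e.2 i)%N%:R / q%:R) * (n == n')%:R).

Lemma L1bE s t : kblock L1b s t = L1 iota (m := m) (K := K) (q := q) s t.
Proof.
case: s t => [n [g f]] [n' [g' f']]; rewrite /kblock /L1b /L1 /Bk /=.
have [->|gg] := eqVneq g g'; last by rewrite xpair_eqE (negbTE gg) !mul0r addr0.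
rewrite !mul1r [in RHS]mulrDr; congr (_ + _).
  congr (_ * _); apply: eq_bigr => i _; rewrite /cterm /=; ring.
rewrite !xpair_eqE eqxx /=; have [_|_] := eqVneq f f'; last first.
  by rewrite andbF !mul0r !mulr0.
rewrite andbT mul1r muopE; have [_|_] := eqVneq n n'; last by rewrite !mul0r !mulr0 addr0 mulr0.
rewrite !mul1r !mulr1 -rmorphB mulrAC -mulrA; congr (_ * (_ * _)); congr (iota _).
rewrite /muj natr_sum mulr_suml -addrA -opprD -big_split /=; congr (_ - _).
by apply: eq_bigr => i _; rewrite /jlev /= natrD mulrDl.
Qed.

Lemma quantE_L1 : quantE V (L1 iota (m := m) (K := K) (q := q))
  (fun x => sym1 (K := K) (zx x) (iota (mux R x)))
  (#|{: E}|%:R ^+ 2 * ((2 * m%:R ^+ 2 + 8) * e0)).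
Proof.
apply: (quantE_ext L1bE (fun _ _ _ => erefl _)).
apply: (@quant_blocks _ _ _ _ _ L1b) => e e'.
have h2 := quant1_shift HM.1 (c := - iota ((\sum_i e.2 i)%N%:R / q%:R)).
have {}h2 := h2 (ltac:(by rewrite normrN)).
have e4 : 0 <= 4 * e0 by rewrite mulr_ge0.
have c2 : `|(e == e')%:R * (gsign C e.1 * fsign C e.2)| <= 1.
  by apply: norm_nat_bool_mul; rewrite normrM gsign_norm fsign_norm mulr1.
have {}h2 := quant1_scale1 e4 c2 h2.
have h1 i : quant1 V (fun n n' => (kappa C i e.2 * (e'.2 == fflip i e.2)%:R) *
      (if e.2 i then kadj (A i) else A i) n n')
    (fun x => (kappa C i e.2 * (e'.2 == fflip i e.2)%:R) *
      (if e.2 i then (zx x i)^* else zx x i)) e0.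
  apply: quant1_scale1 => //.
    rewrite mulrC; apply: norm_nat_bool_mul.
    by rewrite /kappa normr_prod big1 // => k _; exact: normr_sign.
  by have [] := HA i; case: (e.2 i).
have {}h1 := quant1_sum h1.
have em : 0 <= #|'I_m|%:R ^+ 2 * e0 by rewrite mulr_ge0 // exprn_ge0.
have c1 : `|(e.1 == e'.1)%:R * gsign C e.1| <= 1.
  by apply: norm_nat_bool_mul; rewrite gsign_norm.
have {}h1 := quant1_scale1 em c1 h1.
have -> : (2 * m%:R ^+ 2 + 8) * e0 = 2 * (#|'I_m|%:R ^+ 2 * e0) + 2 * (4 * e0).
  by rewrite card_ord; ring.
apply: quant1_ext (quant1_add h1 h2) => // x.
rewrite /sym1 /cE /gE /csym -mulrA; congr (_ * (_ * _) + _); last by ring.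
by apply: eq_bigr => i _; rewrite -mulrA [X in _ * X]mulrC.
Qed.

Hypothesis HrE : #|{: E}|%:R ^+ 2 * ((2 * m%:R ^+ 2 + 8) * e0) <= a ^+ 2 / 4.
Hypothesis HrG : #|{: G}|%:R ^+ 2 * (4 * e0) <= a ^+ 2 / 4.
Local Notation LGt := (LG iota pe b (q := q)).
Local Notation Rph := (Rphi iota pe b (q := q)).

Let a0 : 0 < a := gapa_gt0 iotaC m0 del0.
Let r00 : 0 <= a ^+ 2 / 4 <= a ^+ 2 / 4.
Proof. by rewrite lexx andbT divr_ge0 // exprn_ge0 // ltW. Qed.

Let FG tau (x : X) : G -> G -> C :=
  symG (Pm (ucoord re (zx x) tau)) (iota ((1 - tau) * mux R x)).

Lemma FG_gap tau x w : 0 <= tau <= 1 -> 16 * a ^+ 2 * sqn w <= sqn (kapp (FG tau x) w).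
Proof.
exact: (symG_gap iotaC reP m0 del0 PmatP (nux01 R q0 x) (zx_norm iotaC q0 omP x)).
Qed.

Lemma LG_quant tau : 0 <= tau <= 1 -> quantE V (LGt tau) (FG tau) (a ^+ 2 / 4).
Proof. by move=> t01; apply: (quantE_le HrG); exact: quantE_LG. Qed.

Lemma LG_gap tau v : 0 <= tau <= 1 -> a ^+ 2 * sqn v <= sqn (kapp (LGt tau) v).
Proof.
move=> t01; have h := LG_quant t01.
have u01 : 0 <= (0 : C) <= 1 by apply/andP; split; [exact: lexx | exact: ler01].
have key x w : 4 * a ^+ 2 * sqn w <=
    sqn (fun g => (1 - 0) * kapp (FG tau x) w g + 0 * kapp (FG tau x) w g).
  rewrite [X in _ <= X](sqn_ext (w := kapp (FG tau x) w)); last first.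
    by move=> g; rewrite subr0 mul1r mul0r addr0.
  apply: le_trans (FG_gap x w t01); apply: ler_wpM2r; first exact: sqn_ge0.
  by apply: ler_wpM2r; [rewrite exprn_ge0 // ltW | rewrite ler_nat].
have := quantE_gap Viso h h u01 a0 r00 key v; congr (_ <= _).
by apply: sqn_ext => t; rewrite subr0 mul1r mul0r addr0.
Qed.

(** On symbols, [16 a^2] is at most [2 S + 2 (4 a^2)], where [S] is the squared norm along the
    segment, all relative to that of [w]. This leaves the [4 a^2] that [quantE_inertia] asks for. *)
Lemma LG_step tau tau' p r : 0 <= tau <= 1 -> 0 <= tau' <= 1 ->
  (forall x w, sqn (fun g => kapp (FG tau' x) w g - kapp (FG tau x) w g)
     <= 4 * a ^+ 2 * sqn w) ->
  inertia (LGt tau) p r -> inertia (LGt tau') p r.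
Proof.
move=> t01 t01' hd hp.
suff h : inertia (fun s t => 1 * LGt tau' s t) p r.
  by apply: inertia_ext h => s t; rewrite mul1r.
apply: (quantE_inertia Viso (sg := fun _ => 1) (iota_arch iotaC reP) (LG_quant t01)
  (LG_quant t01') a0 r00).
- move=> u x w /andP[u0 u1].
  set S := (X in _ <= X).
  have h := FG_gap x w t01.
  have e : sqn (kapp (FG tau x) w) <= 2 * S + 2 * (4 * a ^+ 2 * sqn w).
    rewrite (sqn_ext (w := fun g => ((1 - u) * kapp (FG tau x) w g + u * kapp (FG tau' x) w g)
       + - u * (kapp (FG tau' x) w g - kapp (FG tau x) w g))); last by move=> g; ring.
    apply: le_trans (sqn_add_le _ _) _; apply: lerD; first exact: lexx.
    apply: ler_wpM2l => //; rewrite sqnZ; apply: le_trans (hd x w); apply: ler_piMl; first exact: sqn_ge0.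
    by rewrite normrN ger0_norm // exprn_ile1.
  have := le_trans h e; rewrite -lerBlDr.
  have -> : 16 * a ^+ 2 * sqn w - 2 * (4 * a ^+ 2 * sqn w) = 2 * (4 * a ^+ 2 * sqn w) by ring.
  by rewrite ler_pM2l.
- by move=> s; rewrite normr1.
- by move=> s t; rewrite !mul1r LG_herm.
- by move=> s t; rewrite !mul1r LG_herm.
- by apply: inertia_ext hp => s t; rewrite mul1r.
Qed.

(** Only the last coordinate and the factor of the mass move with [tau], so the constant is uniform
    in [x]. In [#|G|^3] one factor comes from Cauchy-Schwarz and two count the entries. *)
Lemma FG_lipschitz : exists2 L : R, 0 <= L & forall tau tau', 0 <= tau <= 1 -> 0 <= tau' <= 1 ->
  forall x w, sqn (fun g => kapp (FG tau' x) w g - kapp (FG tau x) w g)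
     <= iota (L * (tau' - tau) ^+ 2) * sqn w.
Proof.
have [L L0 hL] := peval_lipschitz_family (fun ij : 'I_K * 'I_K => Psym pe b ij.1 ij.2).
pose M := L + (m%:R + 1).
have M0 : 0 <= M by rewrite !addr_ge0.
exists (#|{: G}|%:R ^+ 3 * M ^+ 2); first by rewrite mulr_ge0 ?exprn_ge0 ?sqr_ge0.
move=> tau tau' t01 t01' x w; set d := tau' - tau.
pose D g g' := FG tau' x g g' + - FG tau x g g'.
rewrite (sqn_ext (w := kapp D w)); last first.
  by move=> g; rewrite /D (kappDl (FG tau' x)) kappNl.
have abs1 (t : R) : 0 <= t <= 1 -> `|t| <= 1 by move=> /andP[h1 h2]; rewrite ger0_norm.
have cube t : 0 <= t <= 1 -> incube (ucoord re (zx x) t).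
  move=> ht; apply: (ucoord_cube iotaC reP _ (abs1 _ ht)) => i.
  exact: (z_le1 iotaC (nux01 R q0 x) (zx_norm iotaC q0 omP x)).
have hP i j : `|Pm (ucoord re (zx x) tau') i j - Pm (ucoord re (zx x) tau) i j|
    <= iota (L * `|d|).
  rewrite -rmorphB iota_norm //; apply: iota_le => //.
  apply: (hL (i, j)) => //; try exact: cube.
  by case=> [[k|k]|[]] /=; rewrite ?subrr ?normr0.
have hphi g g' : `|phis (Pm (ucoord re (zx x) tau')) g g' - phis (Pm (ucoord re (zx x) tau)) g g'|
    <= iota (L * `|d|).
  have z0 : 0 <= iota (L * `|d|) by apply: iota_ge0 => //; rewrite mulr_ge0.
  case: g g' => [[] i] [[] j]; rewrite /phis /offdiag /= ?subrr ?normr0 //.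
  by rewrite -rmorphB norm_conjC; exact: hP.
have hmu : `|mux R x| <= m%:R + 1.
  have h : `|\sum_i nux R x i| <= m%:R.
    apply: le_trans (ler_norm_sum _ _ _) _.
    rewrite -[X in _ <= X%:R]card_ord -sumr_const; apply: ler_sum => i _.
    exact: abs1 (nux01 R q0 x i).
  rewrite /mux; apply: le_trans (ler_normB _ _) _; rewrite addrC; apply: lerD => //.
  by rewrite ger0_norm ?invr_ge0 // invf_le1 // ler1n.
have hD g g' : `|D g g'| ^+ 2 <= iota (M ^+ 2 * d ^+ 2).
  have h : `|D g g'| <= iota (M * `|d|).
    have -> : D g g' = (phis (Pm (ucoord re (zx x) tau')) g g' - phis (Pm (ucoord re (zx x) tau)) g g')
        + ((g == g')%:R * gsign C g) * iota (- d * mux R x).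
      rewrite /D /FG /symG.
      have -> : - d * mux R x = (1 - tau') * mux R x - (1 - tau) * mux R x by rewrite /d; ring.
      by rewrite rmorphB /=; ring.
    rewrite mulrDl rmorphD; apply: le_trans (ler_normD _ _) _; apply: lerD; first exact: hphi.
    rewrite normrM -[X in _ <= X]mul1r; apply: ler_pM => //.
      by apply: norm_nat_bool_mul; rewrite gsign_norm.
    rewrite iota_norm //; apply: iota_le => //.
    by rewrite normrM normrN mulrC; apply: ler_wpM2r.
  rewrite -[d ^+ 2]real_normK ?num_real // -exprMn rmorphXn.
  by rewrite ler_pXn2r ?nnegrE //; apply: iota_ge0 => //; rewrite mulr_ge0.
apply: le_trans (kapp_bounded _ _) _; apply: ler_wpM2r; first exact: sqn_ge0.
apply: (@le_trans _ _ (#|{: G}|%:R * \sum_(g : G) \sum_(g' : G) iota (M ^+ 2 * d ^+ 2))).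
  by apply: ler_wpM2l => //; apply: ler_sum => g _; apply: ler_sum => g' _; exact: hD.
have sumc (z : C) : \sum_(g : G) z = #|{: G}|%:R * z by rewrite sumr_const mulr_natl.
rewrite !sumc -[in X in _ <= X]mulrA (rmorphM iota (_ ^+ 3)) (rmorphXn iota) rmorph_nat.
by rewrite le_eqVlt; apply/orP; left; apply/eqP; ring.
Qed.

(** The polynomials need not be affine in [tau], so the straight segment between the two ends could
    meet singular operators. The path is instead followed in short pieces. *)
Lemma LG_chain p r : inertia (LGt 0) p r -> inertia (LGt 1) p r.
Proof.
move=> hp; have [L L0 hL] := FG_lipschitz.
have a4 : 0 < 4 * a ^+ 2 by rewrite mulr_gt0 // exprn_gt0.
have [n hn] := iota_arch iotaC reP (ger0_real (divr_ge0 (iota_ge0 iotaC L0) (ltW a4))).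
pose n1 : R := n.+1%:R; have n10 : 0 < n1 by rewrite ltr0n.
have tk k : (k <= n.+1)%N -> 0 <= k%:R / n1 <= 1.
  by move=> h; rewrite divr_ge0 ?(ltW n10) //= ler_pdivrMr // mul1r ler_nat.
have step k : (k <= n.+1)%N -> inertia (LGt (k%:R / n1)) p r.
  elim: k => [_|k IH lt]; first by rewrite mul0r.
  apply: LG_step (tk _ (ltnW lt)) (tk _ lt) _ (IH (ltnW lt)) => x w.
  apply: le_trans (hL _ _ (tk _ (ltnW lt)) (tk _ lt) x w) _.
  apply: ler_wpM2r; first exact: sqn_ge0.
  have -> : k.+1%:R / n1 - k%:R / n1 = n1^-1 by rewrite -natr1 -mulrBl addrC addKr mul1r.
  rewrite rmorphM /= mulrC -ler_pdivlMl; last first.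
    by rewrite -(rmorph0 iota) iota_lt // exprn_gt0 // invr_gt0.
  rewrite ler_pdivrMr // in hn; apply: le_trans hn _.
  rewrite mulrC [X in _ <= X]mulrC; apply: ler_wpM2l; first exact: ltW.
  rewrite -fmorphV exprVn invrK -(rmorph_nat iota n); apply: iota_le => //.
  by rewrite /n1 -natrX ler_nat (leq_trans (leqnSn n)) // -mulnn leq_pmulr.
by have := step n.+1 (leqnn _); rewrite divff // gt_eqF.
Qed.

(** Without mass, the grading conjugates the operator to its opposite. *)
Lemma LG1_balanced p r : inertia (LGt 1) p r -> p = r.
Proof.
move=> h; suff h' : inertia (LGt 1) r p by have [] := inertia_unique h h'.
apply: (inertia_scale (d := fun s => gsign C s.2) _ (inertia_opp h)) => -[n g] [n' g'].
rewrite /kopp /LG /kblock /LGb /= subrr rmorph0 !mul0r !mulr0 !addr0 gsign_conj.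
by rewrite Pt_gsign.
Qed.

Lemma det_mxk_diag (T : finType) (c : T -> C) :
  \det (mxk (fun s t => (s == t)%:R * c s)) = \prod_t c t.
Proof.
have -> : mxk (fun s t => (s == t)%:R * c s) = diag_mx (\row_i c (enum_val i)).
  apply/matrixP => i j; rewrite !mxE (inj_eq enum_val_inj).
  by case: eqP => _; rewrite ?mul1r ?mul0r.
rewrite det_diag [RHS](reindex (@enum_val T predT)) /=; last first.
  by apply: onW_bij; exact: enum_val_bij.
by apply: eq_bigr => i _; rewrite mxE.
Qed.

(** The sign of the determinant of [Rphi] is [(-1)^p]. The signs [Sg] multiply to 1 because [q ^ m]
    is even, and [LG 0] has positive determinant because its inertia is [(p0, p0)] with
    [p0 = q ^ m * K] even. *)
Lemma Rphi_even p r : inertia Rph p r -> ~~ odd p.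
Proof.
move=> hp.
have t0 : 0 <= (0 : R) <= 1 by apply/andP; split; [exact: lexx | exact: ler01].
have g0 v := LG_gap v t0.
have gR v : a ^+ 2 * sqn v <= sqn (kapp Rph v) by rewrite Rphi_sqn.
have dR := inertia_det (Rphi_herm iotaC pe b q0) a0 gR hp.
have [p0 [p1 h0]] := inertia_exists (LG_herm iotaC pe b 0) a0 g0.
have d0 := inertia_det (LG_herm iotaC pe b 0) a0 g0 h0.
have ep : p0 = p1 by apply: LG1_balanced; exact: LG_chain.
have ep0 : ~~ odd p0.
  have : (p0 + p0 = #|{: N * G}|)%N by case: h0 => _ _ <-; rewrite -ep.
  rewrite !card_prod card_ffun card_bool !card_ord => h.
  have -> : p0 = (q ^ m * K)%N.
    by apply: double_inj; rewrite -addnn h mulnCA mul2n.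
  by rewrite oddM oddX (negbTE qe) orbF gtn_eqF.
rewrite -signr_odd (negbTE ep0) expr0 mul1r in d0.
have RE : mxk Rph = mxk (fun s t => (s == t)%:R * Sg C b s) *m mxk (LGt 0).
  rewrite -mxk_mul; congr mxk; apply/funext => s; apply/funext => t.
  rewrite /kmul (bigD1 s) //= eqxx mul1r big1 ?addr0 //.
  by move=> u /negbTE n; rewrite eq_sym n !mul0r.
have dS : \prod_(s : N * G) Sg C b s = 1.
  rewrite (eq_bigr (fun s => nsign C s.1 * piE C b s.2)) //.
  rewrite (eq_bigr (fun s : N * G => nsign C (s.1, s.2).1 * piE C b (s.1, s.2).2)); last by case.
  rewrite -(pair_bigA _ (fun n g => nsign C n * piE C b g)) /=.
  pose c := \prod_g piE C b g.
  have c2 : c ^+ 2 = 1 by rewrite expr2 -big_split big1 // => g _; exact: piE_sqr.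
  rewrite (eq_bigr (fun=> c)).
    rewrite prodr_const card_ffun !card_ord -[(q ^ m)%N]odd_double_half oddX (negbTE qe) orbF.
    by rewrite gtn_eqF // add0n -mul2n exprM c2 expr1n.
  move=> n _; rewrite big_split prodr_const card_prod card_bool card_ord exprM expr2.
  by rewrite nsign_sqr expr1n /= mul1r.
rewrite RE det_mulmx det_mxk_diag dS mul1r in dR.
move: dR; rewrite -signr_odd; case: (odd p) => //.
by rewrite expr1 mulN1r oppr_gt0 lt_gtF.
Qed.

Lemma model_dvdn : (2 ^ m %| #|[pred i | b i]|)%N.
Proof.
have t0 : 0 <= (0 : R) <= 1 by apply/andP; split; [exact: lexx | exact: ler01].
have gR v : a ^+ 2 * sqn v <= sqn (kapp Rph v).
  by rewrite Rphi_sqn; exact: LG_gap.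
have [p [r hp]] := inertia_exists (Rphi_herm iotaC pe b q0) a0 gR.
have ev := Rphi_even hp.
have h0 := inertia_L0 hp.
have q1 : quantE V (L0 iota pe b (q := q))
    (fun x => sym0 (Pm (ucoord re (zx x) 0)) (iota (mux R x))) (a ^+ 2 / 4).
  apply: quantE_le quantE_L0; apply: le_trans HrE; apply: ler_wpM2l.
    by rewrite exprn_ge0.
  apply: ler_wpM2r => //; rewrite -[X in X <= _]add0r; apply: lerD.
    by rewrite mulr_ge0 // exprn_ge0.
  by rewrite ler_nat.
have q2 := quantE_le HrE quantE_L1.
have gap u (x : X) w : 0 <= u <= 1 -> 4 * a ^+ 2 * sqn w <=
    sqn (fun e => (1 - u) * kapp (sym0 (Pm (ucoord re (zx x) 0)) (iota (mux R x))) w e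
                + u * kapp (sym1 (zx x) (iota (mux R x))) w e).
  exact: (sym_gap iotaC reP m0 del0 PmatP (nux01 R q0 x) (zx_norm iotaC q0 omP x)).
have h1 := quantE_inertia Viso (iota_arch iotaC reP) q1 q2 a0 r00 gap (@Pi_norm _ _ _ b _)
  (PiL0_herm iotaC pe b q0) (PiL1_herm iotaC b q0) h0.
have [p' e [r' h1']] := inertia_L1 (K := K) iotaC m0 b q0 qe.
have [e2 _] := inertia_unique h1 h1'.
have cb : (\sum_i (if b i then p' else p'.+2) + 2 * #|[pred i | b i]| = K * p'.+2)%N.
  rewrite -sum1_card big_distrr /= [X in (_ + X)%N]big_mkcond -big_split /=.
  transitivity (\sum_(i < K) p'.+2)%N; last by rewrite sum_nat_const card_ord.
  by apply: eq_bigr => i _; rewrite inE; case: (b i); rewrite ?addn0 // muln1 addn2.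
have {e2}e3 : (2 ^ m * p + 2 * #|[pred i | b i]| = K * (2 ^ m * q ^ m))%N.
  rewrite e2 -addnA cb -mulnDr -expnMn; congr (_ * _)%N.
  by rewrite e mulnC.
(* Both [p] and [q ^ m] are even; halving them removes the factor 2 in front of the number of odd
   rows. *)
move: e3; rewrite -(odd_double_half p) (negbTE ev) add0n -(odd_double_half (q ^ m)).
rewrite oddX (negbTE qe) orbF gtn_eqF // add0n -!mul2n => e3.
have : (2 * (2 ^ m * p./2 + #|[pred i | b i]|) = 2 * (2 ^ m * (K * (q ^ m)./2)))%N.
  by rewrite mulnDr mulnCA e3; lia.
move/eqP; rewrite eqn_mul2l /= => /eqP e4.
have := dvdn_mulr (K * (q ^ m)./2) (dvdnn (2 ^ m)); rewrite -e4.
by rewrite dvdn_addr // dvdn_mulr.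
Qed.

End Model.
End Obstruction.

(** * Choice of the tolerances and of the model *)

Section PolynomialObstruction.
Variables (C : numClosedFieldType) (R : realType) (iota : {rmorphism R -> C}).
Hypothesis iotaC : forall c, (iota c)^* = iota c.
Variable re : C -> R.
Hypothesis reP : forall z, iota (re z) = (z + z^*) / 2.
Variables (m K : nat).
Hypothesis m0 : (0 < m)%N.
Local Notation J := ('I_m + 'I_m + unit)%type.
Local Notation F := {ffun 'I_m -> bool}.
Local Notation G := (bool * 'I_K)%type.
Local Notation E := (G * F)%type.
Variables (pe : 'I_K -> 'I_K -> pexp R J) (b : 'I_K -> bool).
Variable del : R.
Hypothesis del0 : 0 < del.
Hypothesis PmatP : forall u, incube u -> (exists j, rad R m <= `|u j|) -> forall v,
  iota (del ^+ 2) * sqn v <= sqn (kapp (Pmat iota pe b u) v) /\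
  iota (del ^+ 2) * sqn v <= sqn (kapp (kadj (Pmat iota pe b u)) v).

Theorem polynomial_obstruction : (2 ^ m %| #|[pred i | b i]|)%N.
Proof.
pose a := gapa iota m del; have a0 : 0 < a := gapa_gt0 iotaC m0 del0.
pose cE : C := #|{: E}|%:R ^+ 2 * (2 * m%:R ^+ 2 + 8).
pose cG : C := #|{: G}|%:R ^+ 2 * 4.
have cE0 : 0 <= cE by rewrite mulr_ge0 ?addr_ge0 ?mulr_ge0 ?exprn_ge0.
have cG0 : 0 <= cG by rewrite mulr_ge0 ?exprn_ge0.
(* Both [cE * e0] and [cG * e0] have to stay below [a ^+ 2 / 4]; the summand 1 keeps [d]
   positive. *)
pose d := cE + cG + 1; have d0 : 0 < d by rewrite ltr_wpDl // addr_ge0.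
pose e0 := a ^+ 2 / 4 / d.
have a4 : 0 < a ^+ 2 / 4 by rewrite divr_gt0 // exprn_gt0.
have e00 : 0 < e0 by rewrite divr_gt0.
have [e1 /andP[e10 e11] h1] :=
  quant_pexp_family iotaC (fun ij : 'I_K * 'I_K => Psym pe b ij.1 ij.2) e00.
have [e2 /andP[e20 e21] h2] := quant_pexp_family iotaC (fun _ : unit => mass_exp R m) e00.
(* This is below [e0] and below 1, so that the product [c] is at most each of [e1], [e2] and
   [e0]. *)
pose e3 := e0 / (1 + e0).
have o0 : 0 < 1 + e0 by rewrite addr_gt0.
have e30 : 0 < e3 by rewrite divr_gt0.
have e31 : e3 <= 1 by rewrite ler_pdivrMr // mul1r lerDr ler01.
have e3e : e3 <= e0 by rewrite ler_pdivrMr // mulrDr mulr1 lerDl mulr_ge0 // ltW.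
pose c := e1 * e2 * e3.
have c0 : 0 < c by rewrite /c mulr_gt0 // mulr_gt0.
have c1 : c <= e1.
  by rewrite /c -mulrA ler_piMr ?(ltW e10) // mulr_ile1 ?(ltW e20) ?(ltW e30).
have c2 : c <= e2.
  by rewrite /c mulrAC ler_piMl ?(ltW e20) // mulr_ile1 ?(ltW e10) ?(ltW e30).
have c3 : c <= e0.
  by apply: le_trans e3e; rewrite /c ler_piMl ?(ltW e30) // mulr_ile1 ?(ltW e10) ?(ltW e20).
have cR := real_iota reP (gtr0_real c0).
have rc0 : 0 < re c.
  by rewrite ltNge; apply/negP => /(iota_le iotaC); rewrite -cR rmorph0 (lt_geF c0).
(* With [q = 2 l^2], which is even, [l / q = 1 / (2 l)] and [werr <= 3 / l]. The term [m^2] pays for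
   the level shift [(m / q)^2]. *)
pose l := (Num.truncn ((3 + m%:R ^+ 2) / re c)).+1.
pose q := (2 * (l * l))%N.
have l0 : (0 < l)%N by [].
have q0 : (0 < q)%N by rewrite muln_gt0 muln_gt0 l0.
have qe : ~~ odd q by rewrite /q oddM.
have [om omP] := prim_root_exists C q0.
have lr : 0 < l%:R :> R by rewrite ltr0n.
have l1 : 1 <= l%:R :> R by rewrite ler1n.
have big : 3 + m%:R ^+ 2 <= re c * l%:R.
  by rewrite mulrC -ler_pdivrMr //; apply: ltW; exact: truncnS_gt.
have qE : q%:R = 2 * (l%:R * l%:R) :> R by rewrite /q !natrM.
have w1 : werr R q l <= re c.
  rewrite /werr qE.
  have -> : l%:R / (2 * (l%:R * l%:R)) = (2 * l%:R)^-1 :> R by field; rewrite gt_eqF.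
  have sl : (2 * l%:R)^-1 ^+ 2 <= l%:R^-1 :> R.
    by rewrite exprVn lef_pV2 ?posrE ?exprn_gt0 ?mulr_gt0 //; nra.
  apply: (@le_trans _ _ (3 / l%:R)); first by lra.
  by rewrite ler_pdivrMr //; apply: le_trans big; rewrite lerDl sqr_ge0.
have w2 : (m%:R / q%:R) ^+ 2 <= re c.
  rewrite qE exprMn exprVn ler_pdivrMr ?exprn_gt0 ?mulr_gt0 //.
  have h3 : l%:R <= (2 * (l%:R * l%:R)) ^+ 2 :> R.
    have : l%:R <= l%:R * l%:R :> R by rewrite ler_peMr // ltW.
    by move: (_ * _) l1 => y x1 xy; nra.
  apply: (@le_trans _ _ (re c * l%:R)); first by apply: le_trans big; lra.
  by apply: ler_wpM2l => //; exact: ltW.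
have wc : iota (werr R q l) <= c by rewrite cR; exact: iota_le.
apply: (@model_dvdn _ _ _ iotaC _ reP m K m0 pe b _ del0 PmatP q l om q0 l0 qe omP e0).
- exact: ltW.
- move=> tau /andP[t0 t1] i j.
  apply: (h1 _ _ _ (Xop iota tau) (fun x => ucoord re (zx iota om x) tau) _ _ _ (i, j)).
  + exact: isometry_Vm.
  + move=> x; apply: (ucoord_cube iotaC reP); last by rewrite ger0_norm.
    by move=> k; exact: (z_le1 iotaC (nux01 R q0 x) (zx_norm iotaC q0 omP x)).
  + by move=> k; apply: (quant_Xop iotaC reP) => //; exact: le_trans wc c1.
- have h := h2 _ _ _ (Nm iota (q := q) (m := m)) (fun x => nux R x) (isometry_Vm iotaC q0 l0 omP (m := m)) _ _ tt.
  apply: quant_ext (h _ _) => // [x|x i|i].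
  + by rewrite peval_mass.
  + by have /andP[n0 n1] := nux01 R q0 x i; rewrite ger0_norm.
  + exact: quant_le (le_trans wc c2) (quant_Nm iotaC q0 l0 omP i).
- by move=> i; exact: quant_le (le_trans wc c3) (quant_Am iotaC q0 l0 omP i).
- move=> f; rewrite iota_norm // -rmorphXn; apply: le_trans c3; rewrite cR; apply: iota_le => //.
  rewrite real_normK ?num_real //; apply: le_trans w2.
  have qp : 0 < q%:R :> R by rewrite ltr0n.
  rewrite ler_pXn2r ?nnegrE ?divr_ge0 // ler_pM2r ?invr_gt0 // ler_nat.
  rewrite -[X in (_ <= X)%N]card_ord -sum1_card; apply: leq_sum => i _.
  by case: (f i).
- rewrite mulrA -/cE /e0 mulrA ler_pdivrMr // mulrC; apply: ler_wpM2l; first exact: ltW.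
  by rewrite /d -addrA lerDl addr_ge0.
- rewrite mulrA -/cG /e0 mulrA ler_pdivrMr // mulrC; apply: ler_wpM2l; first exact: ltW.
  by rewrite /d [cE + cG]addrC -addrA lerDl addr_ge0.
Qed.

End PolynomialObstruction.

(** * Continuous families of matrices *)

Local Open Scope classical_set_scope.
Local Open Scope ring_scope.

Lemma continuous_sum (T : topologicalType) (R : realType) (V : normedModType R)
    (I : Type) (r : seq I) (F : I -> T -> V) :
  (forall i, continuous (F i)) -> continuous (fun x => \sum_(i <- r) F i x).
Proof. by move=> Fc; apply: continuous_big => //; exact: add_continuous. Qed.

Lemma continuous_prod (T : topologicalType) (R : realType) (I : Type) (r : seq I)
    (F : I -> T -> R) :
  (forall i, continuous (F i)) -> continuous (fun x => \prod_(i <- r) F i x).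
Proof. by move=> Fc; apply: continuous_big => //; exact: mul_continuous. Qed.

Lemma continuous_det (T : topologicalType) (R : realType) k (A : T -> 'M[R]_k) :
  (forall i j, continuous (fun x => A x i j)) -> continuous (fun x => \det (A x)).
Proof.
move=> Ac; apply: continuous_sum => s x.
apply: cvgM; first exact: cvg_cst.
by apply: continuous_prod => i; exact: Ac.
Qed.

Lemma continuous_adj (T : topologicalType) (R : realType) k (A : T -> 'M[R]_k) i j :
  (forall i j, continuous (fun x => A x i j)) -> continuous (fun x => (\adj (A x)) i j).
Proof.
move=> Ac; rewrite (_ : (fun x => _) =
    fun x => (-1) ^+ (j + i) * \det (row' j (col' i (A x)))); last first.
  by apply/funext => x; rewrite mxE.
move=> x; apply: cvgM; first exact: cvg_cst.
apply: (continuous_det (A := fun x => row' j (col' i (A x)))) => a c.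
by rewrite (_ : (fun x => _) = fun x => A x (lift j a) (lift i c)) //;
  apply/funext => y; rewrite !mxE.
Qed.

Definition cube (R : realType) n : set 'rV[R]_n :=
  [set v | forall i, `[-1, 1]%classic (v ord0 i)].

Lemma compact_cube (R : realType) n : compact (@cube R n).
Proof. by apply: (@rV_compact R n (fun=> `[-1, 1]%classic)) => i; exact: segment_compact. Qed.

Lemma compact_continuous_bounded (T : topologicalType) (R : realType) (A : set T)
    (g : T -> R) :
  compact A -> continuous g -> exists2 G, 0 < G & forall x, A x -> `|g x| <= G.
Proof.
move=> cA gc.
have [[x0 Ax0]|A0] := pselect (A !=set0); last first.
  by exists 1 => // x Ax; case: A0; exists x.
have ngc : {within A, continuous (fun x => `|g x|)}.
  by apply: continuous_subspaceT => x; apply: cvg_norm; exact: gc.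
have [c _ H] := compact_EVT_max (ex_intro _ x0 Ax0) cA ngc.
exists (`|g c| + 1); first by rewrite ltr_wpDl.
by move=> x Ax; apply: le_trans (H x (mem_set Ax)) _; rewrite lerDl.
Qed.

(** The pairs at which [g] differs by at least [eps] form a compact set off the diagonal; the least
    distance within such a pair serves as [d]. *)
Lemma heine_cube (R : realType) n (g : 'rV[R]_n -> R) eps :
  continuous g -> 0 < eps ->
  exists2 d, 0 < d & forall u v, cube u -> cube v ->
    (forall j, `|v ord0 j - u ord0 j| < d) -> `|g v - g u| <= eps.
Proof.
move=> gc e0.
pose A := (@cube R n `*` @cube R n) `&` [set p | eps <= `|g p.2 - g p.1|].
have cA : compact A.
  apply: compact_closedI; first by apply: compact_setX; exact: compact_cube.
  apply: (@closed_comp _ _ (fun p => `|g p.2 - g p.1|) [set x | eps <= x]); last exact: closed_ge.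
  move=> p _; apply: cvg_norm; apply: cvgB.
    by apply: cvg_comp; [exact: cvg_snd|exact: gc].
  by apply: cvg_comp; [exact: cvg_fst|exact: gc].
have [[p0 Ap0]|A0] := pselect (A !=set0); last first.
  exists 1 => // u v cu cv _; case: (leP `|g v - g u| eps) => // h.
  by case: A0; exists (u, v); split => //=; exact: ltW.
have nc : {within A, continuous (fun p => `|p.2 - p.1|)}.
  apply: continuous_subspaceT => p; apply: cvg_norm; apply: cvgB.
    exact: cvg_snd.
  exact: cvg_fst.
have [p pA H] := compact_EVT_min (ex_intro _ p0 Ap0) cA nc.
have {}pA := set_mem pA.
have d0 : 0 < `|p.2 - p.1|.
  rewrite normr_gt0 subr_eq0; apply/eqP => E.
  by case: pA => _ /=; rewrite E subrr normr0 leNgt e0.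
exists `|p.2 - p.1| => // u v cu cv uv; rewrite leNgt; apply/negP => h.
have := H (u, v) (mem_set (conj (conj cu cv) (ltW h))); rewrite /= leNgt => /negP; apply.
rewrite [X in X < _](_ : _ = mx_norm (v - u)) //.
have [->//|/mx_norm_neq0[i ->]] := eqVneq (mx_norm (v - u)) 0.
by rewrite !mxE (ord1 i.1); exact: uv.
Qed.

Lemma compact_continuous_lower (T : topologicalType) (R : realType) (A : set T)
    (g : T -> R) :
  compact A -> continuous g -> (forall x, A x -> g x != 0) ->
  exists2 c, 0 < c & forall x, A x -> c <= `|g x|.
Proof.
move=> cA gc g0.
have [[x0 Ax0]|A0] := pselect (A !=set0); last first.
  by exists 1 => // x Ax; case: A0; exists x.
have ngc : {within A, continuous (fun x => `|g x|)}.
  by apply: continuous_subspaceT => x; apply: cvg_norm; exact: gc.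
have [c cA' H] := compact_EVT_min (ex_intro _ x0 Ax0) cA ngc.
exists `|g c|; first by rewrite normr_gt0; exact: g0 (set_mem cA').
by move=> x Ax; exact: H (mem_set Ax).
Qed.

Lemma coord_le_norm (R : realType) n (v : 'rV[R]_n) i : `|v ord0 i| <= `|v|.
Proof.
rewrite [leRHS](_ : _ = mx_norm v) // mx_normrE.
exact: (le_bigmax _ (fun ij : 'I_1 * 'I_n => `|v ij.1 ij.2|) (ord0, i)).
Qed.

(** * From polynomial to continuous families *)

Section ContinuousObstruction.
Variables (C : numClosedFieldType) (R : realType) (iota : {rmorphism R -> C}).
Hypothesis iotaC : forall c, (iota c)^* = iota c.
Variable re : C -> R.
Hypothesis reP : forall z, iota (re z) = (z + z^*) / 2.
Variables (m K : nat).
Hypothesis m0 : (0 < m)%N.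
Local Notation J := ('I_m + 'I_m + unit)%type.
Local Notation rowJ u := (\row_(i < #|{: J}|) u (enum_val i)).

Lemma weierstrass_continuous (g : 'rV[R]_#|{: J}| -> R) eps :
  continuous g -> 0 < eps ->
  exists e : pexp R J, forall u : J -> R, incube u -> `|peval u e - g (rowJ u)| <= eps.
Proof.
move=> gc e0.
have cubeJ u : incube u -> cube (rowJ u).
  move=> cu i; rewrite mxE /= in_itv /= -ler_norml; exact: cu.
have [G _ HG] := compact_continuous_bounded (@compact_cube R _) gc.
apply: (weierstrass (g := fun u => g (rowJ u)) (G := G)) => //.
- by move=> v cv; apply: HG; exact: cubeJ.
- move=> x x0; have [d d0 H] := heine_cube gc x0.
  exists d => // u v cu cv uv; apply: H; [exact: cubeJ|exact: cubeJ|].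
  by move=> j; rewrite !mxE.
Qed.

(** Meant for [A] a matrix, [B] its adjugate and [d] its determinant: [|d|] divided by a bound for
    [B] bounds [A] below. *)
Lemma kernel_lower (k : nat) (A B : 'I_k -> 'I_k -> C) d v :
  (forall s s', \sum_t B s t * A t s' = d *+ (s == s')) ->
  `|d| ^+ 2 * sqn v <= (k%:R * \sum_s \sum_t `|B s t| ^+ 2) * sqn (kapp A v).
Proof.
move=> BA; rewrite -sqnZ.
rewrite (_ : sqn _ = sqn (kapp B (kapp A v))); last first.
  apply: sqn_ext => s; rewrite /kapp.
  under eq_bigr do rewrite mulr_sumr.
  rewrite exchange_big /=.
  under eq_bigr do (under eq_bigr do rewrite mulrA; rewrite -mulr_suml BA).
  rewrite (bigD1 s) //= eqxx big1 ?addr0 // => i; rewrite eq_sym => /negbTE ->.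
  by rewrite mul0r.
by apply: le_trans (kapp_bounded B _) _; rewrite card_ord.
Qed.

Lemma kernel_perturb (k : nat) (A B : 'I_k -> 'I_k -> C) (c h : C) v :
  0 <= h -> c * sqn v <= sqn (kapp A v) ->
  (forall s t, `|A s t - B s t| ^+ 2 <= h) -> 4 * k%:R ^+ 3 * h <= c ->
  c / 4 * sqn v <= sqn (kapp B v).
Proof.
move=> h0 Ac AB hc.
have h1 : sqn (kapp A v) <= 2 * sqn (kapp (fun s t => A s t - B s t) v) + 2 * sqn (kapp B v).
  apply: le_trans (sqn_add_le _ _); rewrite (sqn_ext (w := kapp A v)) // => s.
  rewrite /kapp -big_split /=; apply: eq_bigr => t _.
  by rewrite -mulrDl subrK.
have h2 : sqn (kapp (fun s t => A s t - B s t) v) <= k%:R ^+ 3 * h * sqn v.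
  apply: le_trans (kapp_bounded _ _) _; apply: ler_wpM2r; first exact: sqn_ge0.
  rewrite card_ord exprS -mulrA; apply: ler_wpM2l; first exact: ler0n.
  rewrite expr2 -mulrA; apply: le_trans (_ : \sum_(s < k) \sum_(t < k) h <= _).
    by apply: ler_sum => s _; apply: ler_sum => t _; exact: AB.
  by rewrite !sumr_const !card_ord -mulrnA -(mulr_natl h) natrM mulrA.
have h3 : 4 * (k%:R ^+ 3 * h * sqn v) <= c * sqn v.
  by rewrite mulrA; apply: ler_wpM2r; [exact: sqn_ge0|rewrite mulrA].
have h4 : c * sqn v <= 2 * (k%:R ^+ 3 * h * sqn v) + 2 * sqn (kapp B v).
  apply: le_trans Ac (le_trans h1 _); apply: lerD => //.
  by apply: ler_wpM2l h2; exact: ler0n.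
rewrite mulrAC ler_pdivrMr ?ltr0n // -(lerD2l (c * sqn v)).
apply: le_trans (lerD h4 h4) _.
rewrite [leLHS](_ : _ = 4 * (k%:R ^+ 3 * h * sqn v) + sqn (kapp B v) * 4); last by ring.
exact: lerD.
Qed.

Variables (M : 'rV[R]_#|{: J}| -> 'M[R]_K) (b : 'I_K -> bool).
Hypothesis Mcont : forall i j, continuous (fun u => M u i j).
Hypothesis Msym : forall u i j, M (- u) i j = (-1) ^+ b i * M u i j.
Hypothesis Munit : forall u, u != 0 -> M u \in unitmx.

(** By compactness the determinant is bounded away from 0 on the part of the cube with norm at least
    [rad]. The adjugate replaces the inverse because it is continuous everywhere, including at 0. *)
Lemma continuous_gap : exists2 c : R, 0 < c &
  forall u : J -> R, incube u -> (exists j, rad R m <= `|u j|) -> forall v : 'I_K -> C,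
  iota c * sqn v <= sqn (kapp (fun i j => iota (M (rowJ u) i j)) v) /\
  iota c * sqn v <= sqn (kapp (kadj (fun i j => iota (M (rowJ u) i j))) v).
Proof.
have r0 : 0 < rad R m by rewrite divr_gt0 // mulr_gt0 // ltr0n.
pose A := @cube R #|{: J}| `&` [set v | rad R m <= `|v|].
have cA : compact A.
  apply: compact_closedI; first exact: compact_cube.
  apply: (@closed_comp _ _ (fun v : 'rV[R]_#|{: J}| => `|v|) [set x | rad R m <= x]); last exact: closed_ge.
  by move=> v _; exact: norm_continuous.
have [c1 c10 H1] : exists2 c, 0 < c & forall v, A v -> c <= `|\det (M v)|.
  apply: compact_continuous_lower => //; first exact: continuous_det.
  move=> v [_ /= rv]; rewrite -unitfE; apply: Munit.
  by rewrite -normr_gt0; exact: lt_le_trans rv.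
have [G G0 HG] : exists2 G, 0 < G & forall v, cube v ->
    `|\sum_s \sum_t (\adj (M v)) s t * (\adj (M v)) s t| <= G.
  apply: compact_continuous_bounded; first exact: compact_cube.
  apply: continuous_sum => s; apply: continuous_sum => t v.
  have ac := @continuous_adj _ _ _ _ s t Mcont.
  exact: cvgM (ac v) (ac v).
have KG0 : 0 < K%:R * G + 1 by rewrite ltr_wpDl // mulr_ge0 // ltW.
exists (c1 ^+ 2 / (K%:R * G + 1)); first by rewrite divr_gt0 // exprn_gt0.
move=> u cu [j rj] v.
have cw : cube (rowJ u).
  by move=> i; rewrite mxE /= in_itv /= -ler_norml; exact: cu.
have Aw : A (rowJ u).
  split=> //=; apply: le_trans rj _.
  by have := coord_le_norm (rowJ u) (enum_rank j); rewrite mxE enum_rankK.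
set w := rowJ u in cw Aw *.
have key (A1 B1 : 'I_K -> 'I_K -> C) :
    (forall s s', \sum_t B1 s t * A1 t s' = iota (\det (M w)) *+ (s == s')) ->
    \sum_s \sum_t `|B1 s t| ^+ 2 = iota (\sum_s \sum_t (\adj (M w)) s t * (\adj (M w)) s t) ->
    iota (c1 ^+ 2 / (K%:R * G + 1)) * sqn v <= sqn (kapp A1 v).
  move=> BA BE; have := kernel_lower v BA; rewrite BE => h.
  rewrite rmorphM fmorphV /= mulrAC ler_pdivrMr; last first.
    by rewrite -(rmorph0 iota); exact: iota_lt.
  apply: (@le_trans _ _ (`|iota (\det (M w))| ^+ 2 * sqn v)).
    apply: ler_wpM2r; first exact: sqn_ge0.
    rewrite rmorphXn /=; apply: lerXn2r; rewrite ?nnegrE ?iota_ge0 ?(ltW c10) //.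
    by rewrite iota_norm //; apply: iota_le => //; exact: H1.
  apply: le_trans h _; rewrite mulrC; apply: ler_wpM2l; first exact: sqn_ge0.
  rewrite -(rmorph_nat iota) -rmorphM; apply: iota_le => //.
  rewrite -[leLHS]addr0; apply: lerD => //; apply: ler_wpM2l => //.
  by apply: le_trans (ler_norm _) _; exact: HG.
have sqE s t : `|iota ((\adj (M w)) s t)| ^+ 2 =
    iota ((\adj (M w)) s t * (\adj (M w)) s t).
  by rewrite iota_norm // -rmorphXn /= -normrX ger0_norm ?sqr_ge0 // expr2.
split.
- apply: (key _ (fun i j => iota ((\adj (M w)) i j))).
    move=> s s'; under eq_bigr do rewrite -rmorphM.
    rewrite -rmorph_sum -rmorphMn; congr (iota _).
    by have /matrixP/(_ s s') := mul_adj_mx (M w); rewrite !mxE.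
  rewrite rmorph_sum; apply: eq_bigr => s _; rewrite rmorph_sum; apply: eq_bigr => t _.
  exact: sqE.
- apply: (key _ (fun i j => iota ((\adj (M w)) j i))).
    move=> s s'; under eq_bigr do rewrite /kadj iotaC -rmorphM mulrC.
    rewrite -rmorph_sum -rmorphMn; congr (iota _).
    by have /matrixP/(_ s' s) := mul_mx_adj (M w); rewrite !mxE eq_sym.
  rewrite exchange_big rmorph_sum; apply: eq_bigr => s _.
  by rewrite rmorph_sum; apply: eq_bigr => t _; exact: sqE.
Qed.

Theorem continuous_obstruction : (2 ^ m %| #|[pred i | b i]|)%N.
Proof.
have [c c0 Hc] := continuous_gap.
pose k4 := 4 * K%:R ^+ 3 + 1 : R.
have k40 : 0 < k4 by rewrite ltr_wpDl // mulr_ge0 // exprn_ge0.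
pose h := c / k4; have h0 : 0 < h by rewrite divr_gt0.
(* The minimum with 1 turns [eta <= h] into [eta ^+ 2 <= h], so no square root is taken; [del] below
   is chosen likewise. *)
pose eta := Order.min 1 h; have eta0 : 0 < eta by rewrite lt_min ltr01.
have eta2 : eta ^+ 2 <= h.
  have : eta <= 1 by rewrite ge_min lexx.
  have : eta <= h by rewrite ge_min lexx orbT.
  move: (ltW eta0); clearbody eta; nra.
have [pe peP] : exists pe : 'I_K -> 'I_K -> pexp R J, forall i j u, incube u ->
    `|peval u (pe i j) - M (rowJ u) i j| <= eta.
  have W i j := weierstrass_continuous (@Mcont i j) eta0.
  pose e i j := projT1 (cid (W i j)).
  by exists e => i j u cu; exact: (projT2 (cid (W i j)) u cu).
pose del := Order.min 1 (c / 4).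
have del0 : 0 < del by rewrite lt_min ltr01 divr_gt0.
have del2 : del ^+ 2 <= c / 4.
  have : del <= 1 by rewrite ge_min lexx.
  have : del <= c / 4 by rewrite ge_min lexx orbT.
  move: (ltW del0); clearbody del; nra.
apply: (polynomial_obstruction iotaC reP m0 (pe := pe) del0) => u cu ru v.
(* Projecting onto a parity averages the errors at [u] and at [- u]; since [M] has that same parity,
   the approximation gets no worse. *)
have close s t : `|M (rowJ u) s t - peval u (Psym pe b s t)| <= eta.
  rewrite distrC /Psym /psym /= peval_pneg.
  have nu : incube (fun j => - u j) by move=> j; rewrite normrN.
  have E : rowJ (fun j => - u j) = - rowJ u by apply/rowP => i; rewrite !mxE.
  have := peP s t _ nu; rewrite E Msym.
  have := peP s t _ cu.
  set x := peval u _; set y := peval _ _; set z := M _ _ _.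
  case: (b s); rewrite ?expr0 ?expr1; rewrite !ler_norml; move=> /andP[? ?] /andP[? ?];
  by apply/andP; split; lra.
have close2 s t : `|iota (M (rowJ u) s t) - Pmat iota pe b u s t| ^+ 2 <= iota h.
  rewrite -rmorphB iota_norm // -rmorphXn /=; apply: iota_le => //; apply: le_trans eta2.
  by apply: lerXn2r; rewrite ?nnegrE ?(ltW eta0).
have hc : 4 * K%:R ^+ 3 * iota h <= iota c.
  rewrite -!(rmorph_nat iota) -rmorphXn -!rmorphM /=; apply: iota_le => //.
  rewrite /h mulrCA ler_piMr ?(ltW c0) // ler_pdivrMr // mul1r.
  by rewrite lerDl.
have fin (x : C) : iota c / 4 * sqn v <= x -> iota (del ^+ 2) * sqn v <= x.
  apply: le_trans; apply: ler_wpM2r; first exact: sqn_ge0.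
  rewrite -(rmorph_nat iota) -fmorphV -rmorphM; exact: iota_le.
have [g1 g2] := Hc u cu ru v.
split; apply: fin.
- apply: (kernel_perturb (h := iota h) _ g1) => //; exact: iota_ge0 (ltW h0).
- apply: (kernel_perturb (h := iota h) _ g2) => //; first exact: iota_ge0 (ltW h0).
  by move=> s t; rewrite /kadj -rmorphB norm_conjC.
Qed.
End ContinuousObstruction.

Import complex.

Theorem parity_obstruction (R : realType) (m n K : nat) (M : 'rV[R]_n -> 'M[R]_K)
    (b : 'I_K -> bool) :
  (0 < m)%N -> n = (m + m + 1)%N ->
  (forall i j, continuous (fun u => M u i j)) ->
  (forall u i j, M (- u) i j = (-1) ^+ b i * M u i j) ->
  (forall u, u != 0 -> M u \in unitmx) ->
  (2 ^ m %| #|[pred i | b i]|)%N.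
Proof.
move=> m0; have -> : (m + m + 1)%N = #|{: 'I_m + 'I_m + unit}|.
  by rewrite !card_sum !card_ord card_unit.
move=> En; subst n => Mc Ms Mu.
apply: (@continuous_obstruction (R[i]) R (real_complex R) _ (@complex.Re R) _ m K m0 M b) => //.
- by move=> c; apply/eqP; rewrite eq_complex /= oppr0 !eqxx.
- case=> x y; rewrite (_ : _ + _ = real_complex R x *+ 2); last first.
    by apply/eqP; rewrite mulr2n eq_complex /= addr0 subrr !eqxx.
  by rewrite -(mulr_natr (real_complex R x)) mulfK // pnatr_eq0.
Qed.

(** * Totally skew embeddings *)

Lemma relation_meet (R : fieldType) (V : lmodType R) (a b p q g g' : V) (c d s : R) :
  s != 0 -> a = c *: p -> b = d *: q -> a + b + s *: (g - g') = 0 ->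
  g + (c / s) *: p = g' + (- (d / s)) *: q.
Proof.
move=> s0 -> -> E; apply: (scalerI s0); apply/eqP; rewrite -subr_eq0 -E.
rewrite !scalerDr !scalerA mulrN !(mulrC s) !divfK // scaleNr scalerN opprD opprK.
by rewrite addrACA addrC.
Qed.

Lemma continuousNarg (R : realType) n (g : 'rV[R]_n -> R) :
  continuous g -> continuous (fun u : 'rV[R]_n => g (- u)).
Proof.
move=> gc u; apply: (@continuous_comp 'rV[R]_n 'rV[R]_n R -%R g u); last exact: gc.
exact: opp_continuous.
Qed.

Section Geometry.
Variables (R : realType) (n N : nat) (f : 'rV[R]_n -> 'rV[R]_N).
Hypothesis fskew : totally_skew_embedding f.
Hypothesis n0 : (0 < n)%N.

Lemma diff_tangent x v : tangent_vector (range f) (f x) ('d f x v).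
Proof.
case: fskew => -[[fd _] _ _ _] _.
exists (fun t => f (t *: v + x)); split; first by rewrite scale0r add0r.
  by apply: filterE => t; exists (t *: v + x).
have E : (fun h : R => h^-1 *: (f ((h *: (1 : R) + 0) *: v + x) - f (0 *: v + x))) =
    (fun h : R => h^-1 *: (f (h *: v + x) - f x)).
  by apply/funext => h; rewrite scale0r add0r addr0 [h *: _]mulr1.
apply: DeriveDef.
  by rewrite /derivable /= E; exact: diff_derivable.
by rewrite /derive /= E -deriveE.
Qed.

Lemma diff_tangent_line x v : v != 0 ->
  tangent_line (range f) (f x) (line_through (f x) ('d f x v)).
Proof.
move=> v0; split; first by exists x.
exists ('d f x v); split => //; last exact: diff_tangent.
case: fskew => -[_ _ _ fi] _; apply: contra_neq v0 => E.
by apply: (fi x); rewrite E linear0.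
Qed.

Lemma line_throughZ p (v : 'rV[R]_N) a : a != 0 ->
  line_through p (a *: v) = line_through p v.
Proof.
move=> a0; apply/seteqP; split=> _ [t _ <-]; first by exists (t * a) => //; rewrite scalerA.
by exists (t / a) => //; rewrite scalerA divfK.
Qed.

(** A relation with [s != 0] yields a common point of a tangent line at [x] and one at [y]. A
    nontrivial relation with [s = 0] makes two such lines parallel. *)
Lemma diff_independent x y v w s : x != y ->
  'd f x v + 'd f y w + s *: (f x - f y) = 0 -> [/\ v = 0, w = 0 & s = 0].
Proof.
move=> xy E.
have [[_ finj _ fi] fs] := fskew.
have fxy : f x <> f y by move=> /finj /eqP; apply/negP.
have di z a : 'd f z a = 0 -> a = 0 by move=> E0; apply: (fi z); rewrite E0 linear0.
(* A zero vector spans no tangent line; it is replaced by a nonzero direction with coefficient 0,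
   which exists as [n > 0]. *)
have nz (a : 'rV[R]_n) : exists a' c, a' != 0 /\ a = c *: a'.
  have [->|a0] := eqVneq a 0; last by exists a, 1; rewrite scale1r.
  exists (delta_mx 0 (Ordinal n0)), 0; rewrite scale0r; split => //.
  by apply/eqP => /rowP/(_ (Ordinal n0)); rewrite !mxE !eqxx; apply/eqP/oner_neq0.
have s0 : s = 0.
  apply/eqP; apply/negPn/negP => s0.
  have [v' [c [v'0 vE]]] := nz v; have [w' [d [w'0 wE]]] := nz w.
  have [_] := fs _ _ _ _ fxy (diff_tangent_line x v'0) (diff_tangent_line y w'0).
  rewrite -classical_sets.subset0 => /(_ (f x + (c / s) *: 'd f x v')); apply; split; first by exists (c / s).
  exists (- (d / s)) => //.
  apply: esym; apply: (relation_meet s0 _ _ E).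
    by rewrite vE linearZ.
  by rewrite wE linearZ.
have {}E : 'd f y w = - 'd f x v.
  by move: E; rewrite s0 scale0r addr0 addrC => /eqP; rewrite addr_eq0 => /eqP.
suff v0 : v = 0.
  by split=> //; apply: (di y); apply: (etrans E); rewrite v0 linear0 oppr0.
apply/eqP; apply/negPn/negP => v0.
have dv0 : 'd f x v != 0 by apply: contra_neq v0 => /di.
have w0 : w != 0.
  apply: contra_neq dv0 => w0; apply: oppr_inj; rewrite oppr0; apply: (etrans (esym E)).
  by rewrite w0 linear0.
have [+ _] := fs _ _ _ _ fxy (diff_tangent_line x v0) (diff_tangent_line y w0).
apply; exists (f x), (f y), ('d f x v); split => //.
apply: (etrans (congr1 (line_through (f y)) E)).
by rewrite -scaleN1r line_throughZ // oppr_eq0 oner_eq0.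
Qed.

Definition jacobian_mx (x : 'rV[R]_n) : 'M[R]_(n, N) := lin1_mx ('d f x).

Lemma mul_jacobian_mx x v : v *m jacobian_mx x = 'd f x v.
Proof. exact: mul_rV_lin1. Qed.

Lemma skew_dim_lower : (n + n + 1 <= N)%N.
Proof.
pose e : 'rV[R]_n := delta_mx 0 (Ordinal n0).
have e0 : 0 != e.
  by apply/eqP => /rowP/(_ (Ordinal n0)); rewrite !mxE !eqxx; apply/eqP; rewrite eq_sym oner_neq0.
pose B := col_mx (col_mx (jacobian_mx 0) (jacobian_mx e)) (f 0 - f e).
suff : row_free B by rewrite /row_free => /eqP <-; exact: rank_leq_col.
apply: inj_row_free => z; rewrite -(hsubmxK z) -(hsubmxK (lsubmx z)) !mul_row_col.
rewrite [rsubmx z]mx11_scalar mul_scalar_mx !mul_jacobian_mx.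
by move=> /(diff_independent e0)[-> -> ->]; rewrite raddf0 !row_mx0.
Qed.

Definition odd_row (i : 'I_(n + n + 1)) : bool := (n <= i)%N.

Lemma card_odd_row : #|[pred i | odd_row i]| = n.+1.
Proof.
rewrite -sum1_card big_mkcond /= !big_split_ord /= big_ord1 big1; last first.
  by move=> i _; rewrite inE /odd_row /= leqNgt ltn_ord.
rewrite (eq_bigr (fun=> 1%N)); last by move=> i _; rewrite inE /odd_row /= leq_addr.
by rewrite sum1_card card_ord inE /odd_row /= addn0 leq_addr add0n addn1.
Qed.

Definition skew_mx (u : 'rV[R]_n) : 'M[R]_(n + n + 1, N) :=
  col_mx (col_mx (jacobian_mx u + jacobian_mx (- u)) (jacobian_mx u - jacobian_mx (- u)))
    (f u - f (- u)).

Lemma skew_mxN u i j : skew_mx (- u) i j = (-1) ^+ odd_row i * skew_mx u i j.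
Proof.
rewrite /skew_mx opprK.
move: (jacobian_mx u) (jacobian_mx (- u)) (f u) (f (- u)) => A B p q.
case: (split_ordP i) => [k|k] ->; last first.
  by rewrite /odd_row !col_mxEd !mxE /= -addnA leq_addr expr1 mulN1r opprB.
rewrite !col_mxEu; case: (split_ordP k) => {}k ->.
  by rewrite /odd_row !col_mxEu !mxE /= leqNgt ltn_ord expr0 mul1r addrC.
by rewrite /odd_row !col_mxEd !mxE /= leq_addr expr1 mulN1r opprB.
Qed.

Lemma skew_mx_continuous i j : continuous (fun u => skew_mx u i j).
Proof.
have [[[fd fc] _ _ _] _] := fskew.
have jc k : continuous (fun u => jacobian_mx u k j).
  rewrite (_ : (fun u => _) = fun u => 'd f u (delta_mx 0 k) ord0 j); last first.
    by apply/funext => u; rewrite mxE.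
  move=> u; apply: (@continuous_comp _ _ _ (fun u => 'd f u (delta_mx 0 k))
    (fun w : 'rV[R]_N => w ord0 j)); first exact: fc.
  exact: coord_continuous.
have jcN k : continuous (fun u : 'rV[R]_n => jacobian_mx (- u) k j).
  exact: continuousNarg (jc k).
have fcj : continuous (fun u => f u ord0 j).
  move=> u; apply: (@continuous_comp _ _ _ f (fun w : 'rV[R]_N => w ord0 j)).
    exact: differentiable_continuous (fd u).
  exact: coord_continuous.
have fcN : continuous (fun u : 'rV[R]_n => f (- u) ord0 j).
  exact: continuousNarg fcj.
case: (split_ordP i) => [k|k] ->; last first.
  rewrite (_ : (fun u => _) = fun u => f u ord0 j - f (- u) ord0 j); last first.
    by apply/funext => u; rewrite col_mxEd !mxE (ord1 k).
  by move=> u; exact: cvgB (fcj u) (fcN u).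
case: (split_ordP k) => {}k ->.
  rewrite (_ : (fun u => _) = fun u => jacobian_mx u k j + jacobian_mx (- u) k j); last first.
    apply/funext => u; rewrite /skew_mx.
  by move: (jacobian_mx u) (jacobian_mx (- u)) => A B; rewrite !col_mxEu !mxE.
  by move=> u; exact: cvgD (jc k u) (jcN k u).
rewrite (_ : (fun u => _) = fun u => jacobian_mx u k j - jacobian_mx (- u) k j); last first.
  apply/funext => u; rewrite /skew_mx.
  by move: (jacobian_mx u) (jacobian_mx (- u)) => A B; rewrite col_mxEu col_mxEd !mxE.
by move=> u; exact: cvgB (jc k u) (jcN k u).
Qed.

(** Passing to the sum and the difference of the two Jacobians is an invertible change of rows, so
    this is independence at the points [u] and [- u]. *)
Lemma skew_mx_free u : u != 0 -> row_free (skew_mx u).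
Proof.
move=> u0; have uN : u != - u.
  by rewrite -addr_eq0 -mulr2n -scaler_nat scaler_eq0 pnatr_eq0.
apply: inj_row_free => z; rewrite -(hsubmxK z) -(hsubmxK (lsubmx z)).
set a := lsubmx (lsubmx z); set b := rsubmx (lsubmx z); set c := rsubmx z.
have comb (A B : 'M[R]_(n, N)) : a *m (A + B) + b *m (A - B) = (a + b) *m A + (a - b) *m B.
  by rewrite mulmxDr mulmxBr mulmxDl mulmxBl addrACA.
rewrite !mul_row_col [c]mx11_scalar mul_scalar_mx comb !mul_jacobian_mx.
move=> /(diff_independent uN)[E1 E2 ->].
have a0 : a = 0.
  apply/eqP; have := congr2 +%R E1 E2; rewrite addrACA subrr !addr0 => /eqP.
  by rewrite -mulr2n -scaler_nat scaler_eq0 pnatr_eq0.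
have b0 : b = 0 by move: E1; rewrite a0 add0r.
by rewrite a0 b0 raddf0 !row_mx0.
Qed.
End Geometry.

(** * Even dimensions, the arithmetic and the lower bound *)

Lemma parity_obstruction_even (R : realType) (n K : nat) (M : 'rV[R]_n -> 'M[R]_K)
    (b : 'I_K -> bool) :
  (1 < n)%N ->
  (forall i j, continuous (fun u => M u i j)) ->
  (forall u i j, M (- u) i j = (-1) ^+ b i * M u i j) ->
  (forall u, u != 0 -> M u \in unitmx) ->
  ~~ odd #|[pred i | b i]|.
Proof.
move=> n1 Mc Ms Mu; apply/negP => bodd.
have n0 : (0 < n)%N by exact: ltnW.
pose e1 : 'rV[R]_n := delta_mx 0 (Ordinal n0).
pose e2 : 'rV[R]_n := delta_mx 0 (Ordinal n1).
have prodb : \prod_(i < K) (-1) ^+ b i = -1 :> R.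
  rewrite prodrXr -signr_odd (_ : \sum_i _ = #|[pred i | b i]|)%N ?bodd //.
  by rewrite -sum1_card [RHS]big_mkcond /=; apply: eq_bigr => i _; rewrite inE; case: (b i).
have detN u : \det (M (- u)) = - \det (M u).
  have -> : M (- u) = diag_mx (\row_i (-1) ^+ b i) *m M u.
    by apply/matrixP => i j; rewrite mul_diag_mx !mxE.
  by rewrite det_mulmx det_diag; under eq_bigr do rewrite mxE; rewrite prodb mulN1r.
(* A parabola from [- e1] to [e1] passing through [e2] at [t = 0], the only place where its first
   coordinate vanishes. *)
pose path (t : R) := t *: e1 + (1 - t ^+ 2) *: e2.
have path0 t : path t != 0.
  apply/eqP => /rowP E; have := E (Ordinal n0); have := E (Ordinal n1).
  rewrite !mxE !eqxx /= !mulr0 !mulr1 !add0r !addr0 => h t0; move: h.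
  by rewrite t0 expr0n subr0; apply/eqP/oner_neq0.
have pathc : continuous path.
  move=> t; apply: cvgD; first exact: scalel_continuous.
  apply: (@continuous_comp _ _ _ (fun t : R => 1 - t ^+ 2) (fun t : R => t *: e2)).
    by apply: cvgB; [exact: cvg_cst|exact: exprn_continuous].
  exact: scalel_continuous.
have [c _ c0] : exists2 c, c \in `[-1, 1]%R & \det (M (path c)) = 0.
  apply: IVT.
  - lra.
  - apply: continuous_subspaceT => t.
    apply: (@continuous_comp _ _ _ path (fun u => \det (M u))); first exact: pathc.
    exact: continuous_det.
  - have -> : path (-1) = - path 1.
      by rewrite /path sqrrN expr1n subrr !scale0r !addr0 scaleNr.
    rewrite detN; case: (ltP 0 (\det (M (path 1)))) => h.
      rewrite minEle maxEle; case: ifP; lra.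
    rewrite minEle maxEle; case: ifP; lra.
by have := Mu _ (path0 c); rewrite unitmxE c0 unitr0.
Qed.

(** For [m = 2] the number 4 does not divide 6, and from [m = 4] on [2 ^ m] exceeds [2 m + 2]. *)
Lemma pow2_dvd_bound m : (0 < m)%N -> (2 ^ m %| m + m + 1 + 1)%N -> m = 1%N \/ m = 3%N.
Proof.
case: m => [|[|[|[|m]]]] // _; [by left|by right|].
move=> /dvdn_leq => /(_ isT); suff : (m.+4 + m.+4 + 1 + 1 < 2 ^ m.+4)%N by lia.
elim: m => // m IH; rewrite expnS; lia.
Qed.

Theorem no_skew_embedding_2n1 (R : realType) n :
  (0 < n)%N -> n <> 1%N -> n <> 3%N -> n <> 7%N ->
  ~ has_totally_skew_embedding R n (n + n + 1).
Proof.
move=> n0 n1 n3 n7 [f fskew].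
have Mc := skew_mx_continuous fskew.
have Mu u : u != 0 -> skew_mx f u \in unitmx.
  by move=> u0; rewrite -row_free_unit; exact: skew_mx_free.
have [no|ne] := boolP (odd n); last first.
  have := parity_obstruction_even _ Mc (skew_mxN f) Mu; rewrite card_odd_row /= ne.
  by move=> /(_ _)/negP; apply => //; lia.
have nE : n = (n./2 + n./2 + 1)%N by rewrite addnn addn1 -{1}(odd_double_half n) no.
have m0 : (0 < n./2)%N by lia.
have := parity_obstruction m0 nE Mc (skew_mxN f) Mu; rewrite card_odd_row => h.
by have := pow2_dvd_bound m0; rewrite -nE addn1 => /(_ h)[]; lia.
Qed.

Theorem skew_dim_ge (R : realType) n N :
  (0 < n)%N -> n <> 1%N -> n <> 3%N -> n <> 7%N ->
  has_totally_skew_embedding R n N -> (2 * n + 2 <= N)%N.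
Proof.
move=> n0 n1 n3 n7 fN; have [f fs] := fN.
have := skew_dim_lower fs n0; rewrite leq_eqVlt => /orP[/eqP E|]; last by lia.
by case: (no_skew_embedding_2n1 n0 n1 n3 n7 (R := R)); rewrite E.
Qed.

(** * The cubic embedding *)

Section C1Calculus.
Variables (R : realType) (n : nat).
Local Notation V := 'rV[R]_n.

(** The differential is carried along explicitly, because that of the cubic map has to be known
    coordinate by coordinate. *)
Definition C1_with (W : normedModType R) (g : V -> W) (dg : V -> V -> W) : Prop :=
  (forall x, is_diff x g (dg x)) /\ (forall v, continuous (fun x => dg x v)).

Lemma C1_with_continuous (W : normedModType R) (g : V -> W) dg :
  C1_with g dg -> continuous g.
Proof. by move=> [gd _] x; have [h _] := gd x; exact: differentiable_continuous. Qed.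

Lemma C1_with_coord k : C1_with (fun z : V => z ord0 k) (fun _ v => v ord0 k).
Proof.
split=> [x|v]; last exact: cst_continuous.
have @f : {linear V -> R}.
  by exists (fun z : V => z ord0 k); do 2![eexists]; do ?[constructor];
     rewrite ?mxE// => ? *; rewrite ?mxE//; move=> ?; rewrite !mxE.
have fc : continuous f by exact: coord_continuous.
apply: DiffDef; first exact: (linear_differentiable (f := f)).
exact: (diff_lin x fc).
Qed.

Lemma C1_with_mul (g h : V -> R) dg dh : C1_with g dg -> C1_with h dh ->
  C1_with (fun z => g z * h z) (fun x v => g x * dh x v + h x * dg x v).
Proof.
move=> Cg Ch; have gc := C1_with_continuous Cg; have hc := C1_with_continuous Ch.
case: Cg Ch => [gd dgc] [hd dhc]; split=> [x|v x]; first exact: is_diffM (gd x) (hd x).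
exact: cvgD (cvgM (gc x) (dhc v x)) (cvgM (hc x) (dgc v x)).
Qed.

Lemma C1_with_scale (W : normedModType R) (g : V -> R) dg (w : W) : C1_with g dg ->
  C1_with (fun z => g z *: w) (fun x v => dg x v *: w).
Proof.
move=> [gd dgc]; split=> [x|v x].
  exact: (@is_diff_comp _ _ _ _ g (dg x) ( *:%R ^~ w) ( *:%R ^~ w)).
apply: (@continuous_comp _ _ _ (fun x => dg x v) (fun t : R => t *: w)); first exact: dgc.
exact: scalel_continuous.
Qed.

Lemma C1_with_sum (W : normedModType R) (I : finType) (g : I -> V -> W) dg :
  (forall i, C1_with (g i) (dg i)) ->
  C1_with (fun z => \sum_i g i z) (fun x v => \sum_i dg i x v).
Proof.
move=> H; split=> [x|v]; last by apply: continuous_sum => i; exact: (H i).2.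
elim: (index_enum I) => [|i r IH].
  rewrite (_ : (fun z => _) = cst 0); last by apply/funext => z; rewrite big_nil.
  by apply: is_diff_eq; apply/funext => v; rewrite big_nil.
rewrite (_ : (fun z => _) = g i + (fun z => \sum_(j <- r) g j z)); last first.
  by apply/funext => z; rewrite big_cons.
apply: is_diff_eq; first exact: (is_diffD ((H i).1 x) IH).
by apply/funext => v; rewrite big_cons.
Qed.
End C1Calculus.

Section CubicEmbedding.
Variables (R : realType) (n : nat).
Local Notation V := 'rV[R]_n.
Local Notation I := ('I_n + 'I_n * 'I_n + 'I_n)%type.

Definition dot (x y : V) : R := \sum_j x ord0 j * y ord0 j.

(** Of the cubics only [|z|^2 z_k] are kept: with the coordinates of lower degree they span, up to
    constants, the test polynomials [|z - x|^2 (z_k - y_k)]. Constants cancel in differences and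
    derivatives. *)
Definition cubic_coord (i : I) (z : V) : R :=
  match i with
  | inl (inl k) => z ord0 k
  | inl (inr p) => z ord0 p.1 * z ord0 p.2
  | inr k => dot z z * z ord0 k
  end.

Definition cubic_dcoord (i : I) (x v : V) : R :=
  match i with
  | inl (inl k) => v ord0 k
  | inl (inr p) => x ord0 p.1 * v ord0 p.2 + x ord0 p.2 * v ord0 p.1
  | inr k => dot x x * v ord0 k + x ord0 k * \sum_j (x ord0 j * v ord0 j + x ord0 j * v ord0 j)
  end.

Definition cubic_map (z : V) : 'rV[R]_#|{: I}| := \row_i cubic_coord (enum_val i) z.
Definition linear_part (w : 'rV[R]_#|{: I}|) : V :=
  \row_k w ord0 (enum_rank (inl (inl k) : I)).

Lemma C1_cubic_coord i : C1_with (cubic_coord i) (cubic_dcoord i).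
Proof.
have cc := @C1_with_coord R n.
case: i => [[k|p]|k] /=; [exact: cc|exact: C1_with_mul|].
apply: C1_with_mul => //; apply: (C1_with_sum (g := fun j (z : V) => z ord0 j * z ord0 j)) => j.
exact: C1_with_mul.
Qed.

Lemma C1_cubic_map :
  C1_with cubic_map (fun x v => \row_i cubic_dcoord (enum_val i) x v).
Proof.
have := C1_with_sum (fun i => C1_with_scale (delta_mx ord0 i : 'rV[R]_#|{: I}|)
  (C1_cubic_coord (enum_val i))).
congr C1_with; last (apply/funext => x; apply/funext => v).
  by apply/funext => z; rewrite [RHS]row_sum_delta; apply: eq_bigr => i _; rewrite mxE.
by rewrite [RHS]row_sum_delta; apply: eq_bigr => i _; rewrite mxE.
Qed.

Lemma cubic_diffE x v : 'd cubic_map x v = \row_i cubic_dcoord (enum_val i) x v.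
Proof. by have [h _] := C1_cubic_map; have [_ ->] := h x. Qed.

Lemma cubic_mapK : cancel cubic_map linear_part.
Proof. by move=> z; apply/rowP => k; rewrite !mxE enum_rankK. Qed.

Lemma linear_part_diff x v : linear_part ('d cubic_map x v) = v.
Proof. by rewrite cubic_diffE; apply/rowP => k; rewrite !mxE enum_rankK. Qed.

Lemma linear_part_is_linear : linear linear_part.
Proof. by move=> a u v; apply/rowP => k; rewrite !mxE. Qed.
HB.instance Definition _ := GRing.isLinear.Build R 'rV[R]_#|{: I}| V _ linear_part linear_part_is_linear.

Lemma linear_part_continuous : continuous linear_part.
Proof.
rewrite (_ : linear_part = fun w => \sum_k w ord0 (enum_rank (inl (inl k) : I)) *: delta_mx ord0 k);
  last by apply/funext => w; rewrite [LHS]row_sum_delta; apply: eq_bigr => k _; rewrite mxE.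
apply: continuous_sum => k w.
apply: (@continuous_comp _ _ _ (fun w : 'rV[R]_#|{: I}| => w ord0 (enum_rank (inl (inl k) : I)))
  (fun t : R => t *: delta_mx ord0 k)); first exact: coord_continuous.
exact: scalel_continuous.
Qed.

Lemma cubic_C1_embedding : C1_embedding cubic_map.
Proof.
have [cd cc] := C1_cubic_map; split.
- split=> [x|v]; first by have [] := cd x.
  rewrite (_ : (fun x => _) = fun x => \row_i cubic_dcoord (enum_val i) x v) //.
  by apply/funext => x; exact: cubic_diffE.
- exact: can_inj cubic_mapK.
- move=> U oU; exists (linear_part @^-1` U).
    by apply: open_comp => // w _; exact: linear_part_continuous.
  by apply/seteqP; split=> z /=; rewrite cubic_mapK.
- by move=> x v w /(congr1 linear_part); rewrite !linear_part_diff.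
Qed.

(** Tangent vectors are velocities of arbitrary curves in the image. Near 0 such a curve is the
    cubic map applied to its own linear part, which is differentiable at 0, so the chain rule gives
    the form of the velocity. *)
Lemma cubic_tangent x u : tangent_vector (range cubic_map) (cubic_map x) u ->
  u = 'd cubic_map x (linear_part u).
Proof.
move=> [g [g0 gr gu]].
pose c t := linear_part (g t).
have c0 : c 0 = x by rewrite /c g0 cubic_mapK.
have gd : differentiable g 0 by apply/derivable1_diffP; have [] := gu.
have cd : differentiable c 0.
  by apply: differentiable_comp => //; apply/linear_differentiable/linear_part_continuous.
have fd : differentiable cubic_map (c 0) by have [] := C1_cubic_map.1 (c 0).
have uE : u = 'D_1 (cubic_map \o c) 0.
  have [_ <-] := gu; apply: near_eq_derive.
  by near=> t; have [z _ E] : range cubic_map (g t) by [near: t]; rewrite /= /c -E cubic_mapK.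
have lc := linear_part_continuous.
have dc : 'd c 0 1 = linear_part u.
  rewrite (_ : c = linear_part \o g) // diff_comp //; last exact: linear_differentiable.
  by rewrite /= diff_lin // -deriveE //; have [_ ->] := gu.
rewrite {1}uE deriveE; last exact: differentiable_comp.
by rewrite diff_comp //= dc c0.
Unshelve. all: by end_near.
Qed.

(* The cubic [|z - x|^2 (z_k - y_k)] vanishes to second order at [x], and its
   derivative at [y] in the direction [w] is [|y - x|^2 w_k]. *)
Lemma cubic_independent x y v w c d s : x != y ->
  (forall i, c * cubic_dcoord i x v + d * cubic_dcoord i y w +
    s * (cubic_coord i x - cubic_coord i y) = 0) -> d *: w = 0.
Proof.
move=> xy E.
have E1 k := E (inl (inl k)); have E2 i k := E (inl (inr (i, k))); have E3 k := E (inr k).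
move: E1 E2 E3; rewrite /= => E1 E2 E3.
apply/rowP => k; rewrite !mxE.
have S2 : c * (dot x x * v ord0 k + dot x v * x ord0 k)
    + d * (dot x y * w ord0 k + dot x w * y ord0 k)
    + s * (dot x x * x ord0 k - dot x y * y ord0 k) = 0.
  rewrite /dot !mulr_suml -sumrB -!big_split /= !mulr_sumr -!big_split /=; apply: big1 => i _.
  by rewrite -[RHS](mulr0 (x ord0 i)) -(E2 i k); ring.
have T2 : c * (dot x v + dot x v) + d * (dot y w + dot y w) + s * (dot x x - dot y y) = 0.
  rewrite /dot -sumrB -!big_split /= !mulr_sumr -!big_split /=; apply: big1 => i _.
  exact: (E2 i i).
have S1 : c * dot x v + d * dot x w + s * (dot x x - dot x y) = 0.
  rewrite /dot -sumrB !mulr_sumr -!big_split /=; apply: big1 => i _.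
  by rewrite -[RHS](mulr0 (x ord0 i)) -(E1 i); ring.
have {}E3 := E3 k; rewrite !big_split /= -!/(dot _ _) in E3.
have : (dot x x - 2 * dot x y + dot y y) * (d * w ord0 k) = 0.
  transitivity (c * (dot x x * v ord0 k + x ord0 k * (dot x v + dot x v))
    + d * (dot y y * w ord0 k + y ord0 k * (dot y w + dot y w))
    + s * (dot x x * x ord0 k - dot y y * y ord0 k)
    - 2 * (c * (dot x x * v ord0 k + dot x v * x ord0 k)
    + d * (dot x y * w ord0 k + dot x w * y ord0 k)
    + s * (dot x x * x ord0 k - dot x y * y ord0 k))
    + dot x x * (c * v ord0 k + d * w ord0 k + s * (x ord0 k - y ord0 k))
    - y ord0 k * (c * (dot x v + dot x v) + d * (dot y w + dot y w) + s * (dot x x - dot y y))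
    + 2 * y ord0 k * (c * dot x v + d * dot x w + s * (dot x x - dot x y))); first by ring.
  by rewrite E3 S2 T2 S1 E1; ring.
move/eqP; rewrite mulf_eq0 => /orP[|/eqP //].
rewrite (_ : _ + _ = \sum_i (x ord0 i - y ord0 i) ^+ 2); last first.
  rewrite /dot mulr_sumr -sumrB -big_split /=; apply: eq_bigr => i _; ring.
rewrite psumr_eq0 => [/allP h|i _]; last exact: sqr_ge0.
case/eqP: xy; apply/rowP => i; apply/eqP; rewrite -subr_eq0 -sqrf_eq0.
by apply: h; rewrite mem_index_enum.
Qed.

Lemma cubic_tangent_independent x y a b c d s : x != y -> b != 0 ->
  tangent_vector (range cubic_map) (cubic_map x) a ->
  tangent_vector (range cubic_map) (cubic_map y) b ->
  c *: a + d *: b + s *: (cubic_map x - cubic_map y) = 0 -> d = 0.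
Proof.
move=> xy b0 ta tb /rowP E.
have Ea := etrans (cubic_tangent ta) (cubic_diffE x _).
have Eb := etrans (cubic_tangent tb) (cubic_diffE y _).
have lb0 : linear_part b != 0.
  by apply: contra_neq b0 => lb; apply: (etrans (cubic_tangent tb)); rewrite lb linear0.
suff /eqP : d *: linear_part b = 0 by rewrite scaler_eq0 (negbTE lb0) orbF => /eqP.
apply: (@cubic_independent x y (linear_part a) (linear_part b) c d s xy) => i.
by have := E (enum_rank i); rewrite {1}Ea {1}Eb !mxE enum_rankK.
Qed.

Lemma line_through_direction N (p v q u : 'rV[R]_N) :
  line_through p v = line_through q u -> exists d, v = d *: u.
Proof.
move=> L; have [t1 _ E1] : line_through q u p by rewrite -L; exists 0; rewrite ?scale0r ?addr0.
have [t2 _ E2] : line_through q u (p + v) by rewrite -L; exists 1; rewrite ?scale1r.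
exists (t2 - t1); apply: (addrI p); rewrite -E2 -E1 -addrA -scalerDl.
by rewrite addrC [t1 + _]addrC subrK addrC.
Qed.

(** Independence controls the coefficient at the second point only; exchanging [x] and [y] controls
    the first. Parallel lines with [a = c u] and [b = d u] are excluded by the relation
    [d a - c b = 0]. *)
Lemma cubic_totally_skew : totally_skew_embedding cubic_map.
Proof.
split; first exact: cubic_C1_embedding.
move=> p q l l' pq [[x _ xp] [a [a0 ta ->]]] [[y _ yq] [b [b0 tb ->]]].
rewrite -xp -yq in pq ta tb *.
have xy : x != y by apply/eqP => e; apply: pq; rewrite e.
split.
- move=> [p1 [p2 [u [_ /line_through_direction[c Ec] /line_through_direction[d Ed]]]]].
  have c0 : - c = 0.
    apply: (@cubic_tangent_independent x y a b d _ 0) => //.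
    by rewrite scale0r addr0 Ec Ed !scalerA mulNr mulrC scaleNr subrr.
  by case/eqP: a0; rewrite Ec -[c]opprK c0 oppr0 scale0r.
- rewrite -classical_sets.subset0 => z [[t _ tz] [t' _ tz']].
  have E : t *: a + (- t') *: b + 1 *: (cubic_map x - cubic_map y) = 0.
    by rewrite scale1r scaleNr addrACA -opprD [t *: a + _]addrC [t' *: b + _]addrC tz tz' subrr.
  have t'0 := cubic_tangent_independent xy b0 ta tb E.
  have yx : y != x by rewrite eq_sym.
  have t0 : t = 0.
    apply: (@cubic_tangent_independent y x b a (- t') t (-1)) => //.
    by rewrite scaleN1r opprB -[RHS]E scale1r [X in X + _]addrC.
  by apply: pq; move: E; rewrite t0 t'0 !scale0r !add0r scale1r => /eqP; rewrite subr_eq0 => /eqP.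
Qed.
End CubicEmbedding.

(** The cubic embedding makes the set of dimensions nonempty, so [xget] returns its least element
    and not the default 0. *)
Lemma has_min_skew_dim (R : realType) n : has_totally_skew_embedding R n (min_skew_dim R n).
Proof.
have [N _ HN] : exists2 N, True & has_totally_skew_embedding R n N.
  by exists #|{: 'I_n + 'I_n * 'I_n + 'I_n}| => //; exists (@cubic_map R n); exact: cubic_totally_skew.
have ex : exists N, `[< has_totally_skew_embedding R n N >] by exists N; apply/asboolP.
rewrite /min_skew_dim; set A := [set _ | _].
have Aex : exists k, A k.
  have [k /asboolP Hk kmin] := ex_minnP ex; exists k; split => // k' Hk'.
  by apply: kmin; apply/asboolP.
by case: (xgetPex 0%N Aex).
Qed.

Theorem corollary1p7 (R : realType) (n : nat) (hn : (1 <= n)%N)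
    (hn1 : n <> 1%N) (hn3 : n <> 3%N) (hn7 : n <> 7%N) :
  (2 * n + 2 <= min_skew_dim R n)%N.
Proof. exact: skew_dim_ge hn hn1 hn3 hn7 (has_min_skew_dim R n). Qed.
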